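(* On any metric graph $G$, the function $\gamma_1:G\times G\to\mathbb R$ is the resistance distance $d_R$ on $G$ as defined by Anderes, Møller and Rasmussen, i.e. $\gamma_1(x_1,x_2)=d_R(x_1,x_2)$ for all $x_1,x_2\in G$. Furthermore, $d_2$ is the natural choice for the biharmonic distance on metric graphs.
   Context: A metric graph $G=(V,E)$ has a finite vertex set $V$ ($n:=|V|$) and a finite edge set $E$; each edge $e\in E$ has a length $0<l_e<\infty$ and is identified with the segment $[0,l_e]$, edges being glued at their common endpoints (the vertices). $G$ also denotes the set of all points on the edges (vertices included). Throughout, $G$ is connected and simple (no self-loops, no multiple edges). For $f:G\to\mathbb R$, $f_e$ is the restriction of $f$ to $e$ viewed as a function on $[0,l_e]$. For a vertex $v$, $E_v$ is the set of edges incident to $v$, and for $e\in E_v$ the exiting derivative $\partial_ef(v)$ is the one-sided derivative of $f$ at $v$ along $e$, in the direction leaving $v$. Definition of $\gamma_p$ and $d_p$ for $p=1,2$. For $p=1$, let $\mathcal F$ be the set of continuous $f:G\to\mathbb R$ such that each $f_e$ is absolutely continuous with $f_e'\in L^2([0,l_e])$, and $\sum_{v\in V}f(v)=0$. For $p=2$, let $\mathcal F$ be the set of continuous $f:G\to\mathbb R$ such that each $f_e$ is $C^1$ with $f_e'$ absolutely continuous and $f_e''\in L^2([0,l_e])$, $\sum_{e\in E_v}\partial_ef(v)=0$ at every $v\in V$, and $\sum_{v\in V}f(v)=0$. In both cases the inner product is $\langle f,g\rangle_{\mathcal F}=\sum_{e\in E}\int_0^{l_e}f_e^{(p)}(x)\,g_e^{(p)}(x)\,dx$.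 This gives a reproducing kernel Hilbert space. Let $Z_{p-1}$ be the (unique in law) zero-mean Gaussian process on $G$ whose covariance function is its reproducing kernel; then $\gamma_p(x_1,x_2):=\mathrm{Var}(Z_{p-1}(x_1)-Z_{p-1}(x_2))$ and $d_p:=\sqrt{\gamma_p}$. Resistance distance of Anderes, Møller and Rasmussen: fix an arbitrary vertex $u_0\in V$ and let $\mathbf L_A$ be the $n\times n$ matrix indexed by $V$ obtained by adding $1$ to the $(u_0,u_0)$ entry of the weighted graph Laplacian $\mathbf L$, where $\mathbf L[v,w]=-1/l_{(v,w)}$ if $v,w$ are adjacent, $\mathbf L[v,w]=0$ if $v\neq w$ are not adjacent, and $\mathbf L[v,v]=\sum_{w\sim v}1/l_{(v,w)}$. The matrix $\mathbf L_A$ is invertible. Let $Z_\mu$ be the process on $G$ whose restriction to $V$ is $\mathcal N(0,\mathbf L_A^{-1})$ and which is extended to each edge by linear interpolation. Independently of $Z_\mu$ and independently across edges, let $Z_e$ be a standard Brownian bridge on $[0,l_e]$ (null at both endpoints, covariance $s(l_e-t)/l_e$ for $s\le t$), extended by zero outside $e$. Then $d_R(x_1,x_2):=\mathrm{Var}\big(\tilde Z(x_1)-\tilde Z(x_2)\big)$ with $\tilde Z:=Z_\mu+\sum_{e\in E}Z_e$. Meaning of the second assertion (informal): the biharmonic distance was previously defined on two-dimensional surfaces (Lipman, Rustamov, Funkhouser) and on combinatorial graphs (Black, Lin, Nayyeri, Wong), but not on metric graphs. Those spectral definitions match the spectral representation of $\gamma_2=d_2^2$, namely $\gamma_2(x_1,x_2)=\sum_{k\ge1}(\phi_k(x_1)-\phi_k(x_2))^2/\lambda_k^2$.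 Here $\lambda_k>0$ ($k\ge1$) are the non-zero eigenvalues, repeated with multiplicity, and $\phi_k$ the corresponding $L^2(G)$-orthonormal eigenfunctions, of the Kirchhoff-Laplace operator on $G$: it acts as $f_e\mapsto-f_e''$ on each edge, on functions that are edge-wise in $H^2$, continuous on $G$, and whose exiting derivatives sum to zero at each vertex. *)

(* Defs.v *)
From HB Require Import structures.
From mathcomp Require Import all_boot all_order all_algebra.
From mathcomp Require Import all_classical all_reals all_analysis.

Set Implicit Arguments.
Unset Strict Implicit.
Unset Printing Implicit Defensive.

Import Order.TTheory GRing.Theory Num.Theory.
Import numFieldNormedType.Exports.

Local Open Scope classical_set_scope.
Local Open Scope ring_scope.

(* Derivative relative to [0, l]: two-sided at interior points and one-sided at
   0 and l. It is a total function, with no meaning where the limit of the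
   difference quotient does not exist. *)
Definition slope_on {R : realType} (f : R -> R) (x : R) : R -> R :=
  fun t => (f t - f x) / (t - x).

Definition derive_on {R : realType} (l : R) (f : R -> R) (x : R) : R :=
  lim (slope_on f x t @[t --> within `[0, l] x^']).

Definition C1_on {R : realType} (l : R) (f : R -> R) : Prop :=
  (forall x : R, 0 <= x <= l -> cvg (slope_on f x t @[t --> within `[0, l] x^'])) /\
  {within `[0, l], continuous (derive_on l f)}.

Definition abs_continuous_on {R : realType} (l : R) (f : R -> R) : Prop :=
  forall eps : R, 0 < eps -> exists2 delta : R, 0 < delta &
    forall (n : nat) (a b : 'I_n -> R),
      (forall i, 0 <= a i /\ a i < b i /\ b i <= l) ->
      (forall i j, i != j -> b i <= a j \/ b j <= a i) ->
      \sum_i (b i - a i) < delta ->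
      \sum_i `|f (b i) - f (a i)| < eps.

Definition L2_on {R : realType} (l : R) (f : R -> R) : Prop :=
  measurable_fun `[0, l] f /\
  (\int[@lebesgue_measure R]_(t in `[0%R, l]) (f t ^+ 2)%:E < +oo)%E.

(* Every edge e carries an arbitrary orientation src e -> tgt e, used only to
   identify e with [0, len e]. *)
Record metric_graph (R : realType) := MetricGraph {
  vertex : finType ;
  edge : finType ;
  src : edge -> vertex ;
  tgt : edge -> vertex ;
  len : edge -> R ;
  len_gt0 : forall e, 0 < len e ;
  no_loop : forall e, src e != tgt e ;
  no_multi_edge : forall e e',
    [set src e; tgt e]%SET = [set src e'; tgt e']%SET -> e = e' ;
  graph_connected : forall v w,
    connect [rel a b | [exists e, [set src e; tgt e]%SET == [set a; b]%SET]] v w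
}.

Section MetricGraphs.
Context {R : realType} (G : metric_graph R).

Definition ends (e : edge G) : {set vertex G} := [set src e; tgt e]%SET.

(* The points of G: the vertices and the points in the open edges. *)
Inductive gpoint : Type :=
| Vertex of vertex G
| Inner (e : edge G) of {t : R | 0 < t < len e}.

(* The gluing map [0, len e] -> G. It is extended to R by constants; only its
   values on [0, len e] matter. *)
Definition on_edge (e : edge G) (t : R) : gpoint :=
  if (insub t : option {t : R | 0 < t < len e}) is Some u then Inner u
  else if t <= 0 then Vertex (src e) else Vertex (tgt e).

Definition edge_fun (f : gpoint -> R) (e : edge G) (t : R) : R :=
  f (on_edge e t).

Definition edge_deriv (p : nat) (f : gpoint -> R) (e : edge G) : R -> R :=
  iter p (derive_on (len e)) (edge_fun f e).

(* Continuity for the quotient topology of the glued segments. *)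
Definition graph_continuous (f : gpoint -> R) : Prop :=
  forall e, {within `[0, len e], continuous (edge_fun f e)}.

(* The point of e at distance t from its end v. *)
Definition leave (v : vertex G) (e : edge G) (t : R) : gpoint :=
  on_edge e (if v == src e then t else len e - t).

Definition exit_deriv (f : gpoint -> R) (v : vertex G) (e : edge G) : R :=
  lim ((f (leave v e t) - f (Vertex v)) / t @[t --> 0^'+]).

Definition kirchhoff_condition (f : gpoint -> R) : Prop :=
  forall v, \sum_(e | v \in ends e) exit_deriv f v e = 0.

Definition edgewise_H1 (f : gpoint -> R) : Prop := forall e,
  abs_continuous_on (len e) (edge_fun f e) /\
  L2_on (len e) (edge_deriv 1 f e).

Definition edgewise_H2 (f : gpoint -> R) : Prop := forall e,
  [/\ C1_on (len e) (edge_fun f e),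
      abs_continuous_on (len e) (edge_deriv 1 f e) &
      L2_on (len e) (edge_deriv 2 f e)].

Definition kirchhoff_domain (f : gpoint -> R) : Prop :=
  [/\ graph_continuous f, edgewise_H2 f & kirchhoff_condition f].

Definition vertex_centered (f : gpoint -> R) : Prop :=
  \sum_(v : vertex G) f (Vertex v) = 0.

Definition energy_space (p : nat) (f : gpoint -> R) : Prop :=
  match p with
  | 1%N => [/\ graph_continuous f, edgewise_H1 f & vertex_centered f]
  | 2%N => kirchhoff_domain f /\ vertex_centered f
  | _ => False
  end.

Definition energy_form (p : nat) (f g : gpoint -> R) : R :=
  \sum_(e : edge G) \int[@lebesgue_measure R]_(t in `[0, len e])
    (edge_deriv p f e t * edge_deriv p g e t).

Definition reproducing_kernel (p : nat) (k : gpoint -> gpoint -> R) : Prop :=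
  forall x, energy_space p (k x) /\
    forall f, energy_space p f -> energy_form p f (k x) = f x.

End MetricGraphs.

Arguments gpoint {R} G.

Section Processes.
Context {d : measure_display} {T : measurableType d} {R : realType}.
Variable P : probability T R.

(* Dirac masses are allowed; normal_prob m 0 is not a Dirac mass. *)
Definition gaussian_rv (X : T -> R) : Prop :=
  measurable_fun [set: T] X /\ exists m s : R, forall A : set R,
    measurable A ->
    P (X @^-1` A) = if s == 0 then \d_m A else normal_prob m s A.

Definition gaussian_process {I : Type} (D : set I) (X : I -> T -> R) : Prop :=
  forall (n : nat) (i : 'I_n -> I) (c : 'I_n -> R), (forall k, D (i k)) ->
    gaussian_rv (fun w => \sum_k c k * X (i k) w).

Definition centered_gaussian_process {I : Type} (D : set I) (X : I -> T -> R)
    (C : I -> I -> R) : Prop :=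
  [/\ gaussian_process D X,
      forall i, D i -> ('E_P[X i] = 0)%E &
      forall i j, D i -> D j -> covariance P (X i) (X j) = (C i j)%:E].

Definition brownian_bridge (l : R) (B : R -> T -> R) : Prop :=
  [/\ centered_gaussian_process `[0, l] B
        (fun s t : R => Num.min s t * (l - Num.max s t) / l),
      forall w, B 0 w = 0 & forall w, B l w = 0].

Definition process_sigma {I : Type} (D : set I) (X : I -> T -> R)
    : set (set T) :=
  <<s [set A | exists i, D i /\
         exists2 S : set R, measurable S & A = X i @^-1` S] >>.

(* The full product rule suffices: some of the A j may be setT. *)
Definition independent_sigmas {J : finType} (S : J -> set (set T)) : Prop :=
  forall A : J -> set T, (forall j, S j (A j)) ->
    fine (P (\bigcap_(j in [set: J]) A j)) = \prod_j fine (P (A j)).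

End Processes.

Definition variogram {d} {T : measurableType d} {R : realType}
    (P : probability T R) {I : Type} (Z : I -> T -> R) (g : I -> I -> R) :=
  forall x1 x2, ((g x1 x2)%:E = 'V_P[(Z x1 \- Z x2)%R])%E.

Section Distances.
Context {R : realType} (G : metric_graph R).

(* gamma_p and d_R are given by relations: the underlying processes are only
   unique in law, and any realization may be used. *)
Definition is_gamma (p : nat) (g : gpoint G -> gpoint G -> R) : Prop :=
  exists (d : measure_display) (T : measurableType d) (P : probability T R)
    (Z : gpoint G -> T -> R) (k : gpoint G -> gpoint G -> R),
  [/\ reproducing_kernel p k,
      centered_gaussian_process P [set: gpoint G] Z k &
      variogram P Z g].

Definition sqrt_dist (g : gpoint G -> gpoint G -> R) : gpoint G -> gpoint G -> R :=
  fun x1 x2 => Num.sqrt (g x1 x2).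

(* G being simple, the off-diagonal sum has at most one term. *)
Definition weighted_laplacian (v w : vertex G) : R :=
  if v == w then \sum_(e | v \in ends e) (len e)^-1
  else - \sum_(e | ends e == [set v; w]%SET) (len e)^-1.

Definition laplacian_A (u0 : vertex G) : 'M[R]_#|vertex G| :=
  \matrix_(i, j) (weighted_laplacian (enum_val i) (enum_val j)
    + ((enum_val i == u0) && (enum_val j == u0))%:R).

Section Ztilde.
Context {T : Type} (Y : vertex G -> T -> R) (B : edge G -> R -> T -> R).

Definition Z_mu (x : gpoint G) : T -> R :=
  match x with
  | Vertex v => Y v
  | Inner e t => fun w =>
      (1 - val t / len e) * Y (src e) w + val t / len e * Y (tgt e) w
  end.

Definition Z_edge (e : edge G) (x : gpoint G) : T -> R :=
  match x with
  | Vertex _ => fun=> 0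
  | Inner e' t => fun w => if e' == e then B e (val t) w else 0
  end.

Definition Z_tilde (x : gpoint G) : T -> R :=
  fun w => Z_mu x w + \sum_(e : edge G) Z_edge e x w.

End Ztilde.

Definition is_resistance_distance (u0 : vertex G)
    (dR : gpoint G -> gpoint G -> R) : Prop :=
  exists (d : measure_display) (T : measurableType d) (P : probability T R)
    (Y : vertex G -> T -> R) (B : edge G -> R -> T -> R),
  [/\ centered_gaussian_process P [set: vertex G] Y
        (fun v w => invmx (laplacian_A u0) (enum_rank v) (enum_rank w)),
      forall e, brownian_bridge P (len e) (B e),
      independent_sigmas P (fun j : option (edge G) =>
        if j is Some e then process_sigma `[0, len e] (B e)
        else process_sigma [set: vertex G] Y) &
      variogram P (Z_tilde Y B) dR].

Definition L2_form (f g : gpoint G -> R) : R := energy_form 0 f g.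

Definition kirchhoff_eigenfunction (mu : R) (f : gpoint G -> R) : Prop :=
  [/\ kirchhoff_domain f, exists x, f x != 0 &
  forall e, {ae @lebesgue_measure R, forall t, `[0, len e]%classic t ->
    - edge_deriv 2 f e t = mu * edge_fun f e t}].

(* (lam k, phi k), k in K, enumerates the non-zero eigenvalues with
   multiplicity and L2-orthonormal eigenfunctions: for every mu <> 0, the phi k
   with lam k = mu span the eigenspace of mu. K is empty if G is a single
   vertex. *)
Definition kirchhoff_spectrum (K : set nat) (lam : nat -> R)
    (phi : nat -> gpoint G -> R) : Prop :=
  [/\ forall k, K k -> 0 < lam k,
      forall k, K k -> kirchhoff_eigenfunction (lam k) (phi k),
      forall j k, K j -> K k -> L2_form (phi j) (phi k) = (j == k)%:R &
      forall mu f, mu != 0 -> kirchhoff_eigenfunction mu f ->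
        exists (s : seq nat) (c : nat -> R),
          (forall k, k \in s -> K k /\ lam k = mu) /\
          forall x, f x = \sum_(k <- s) c k * phi k x].

Definition biharmonic_sq (K : set nat) (lam : nat -> R)
    (phi : nat -> gpoint G -> R) (x1 x2 : gpoint G) : \bar R :=
  \esum_(k in K) ((phi k x1 - phi k x2) ^+ 2 / lam k ^+ 2)%:E.

End Distances.

(* Main.v *)
(* Let C be the covariance of the process Z_tilde. It is a Green function of the
   graph: q = C(x1,.) - C(x2,.) minus a constant lies in the space for p = 1 and
   satisfies <f, q> = f(x1) - f(x2) there, by the fundamental theorem of calculus
   for absolutely continuous functions on each edge and the equations of the
   Laplacian at the vertices. Hence q differs from k(x1,.) - k(x2,.) by a constant,
   k being the reproducing kernel, which gives gamma_1 = d_R.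

   For p = 2 let w be q minus its mean over G. The function x |-> int C(x,y) w(y) dy
   satisfies the Kirchhoff conditions and has second derivative -w, and pairing it
   with the reproducing kernel yields gamma_2(x1,x2) = int w^2. The Fourier
   coefficients of w are (phi_k(x1) - phi_k(x2)) / lambda_k, so the spectral formula
   is Parseval's identity for w. Completeness of (phi_k) is obtained from the
   Hilbert-Schmidt theory of the doubly centered kernel Kc of C: after removal of
   the phi_k with 1/lambda_k > eps, a symmetric kernel without eigenvalue of modulus
   larger than eps remains, and its norm is at most eps; and w is a uniform limit of
   functions in the range of Kc. *)
From HB Require Import structures.
From mathcomp Require Import all_boot all_order all_algebra.
From mathcomp Require Import all_classical all_reals all_analysis.
From mathcomp Require Import measurable_realfun ring lra zify.
Require Import Defs.

Set Implicit Arguments.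
Unset Strict Implicit.
Unset Printing Implicit Defensive.

Import Order.TTheory GRing.Theory Num.Theory.
Import numFieldNormedType.Exports.

Local Open Scope classical_set_scope.
Local Open Scope ring_scope.

(** * Absolutely continuous functions *)

Section AbsoluteContinuity.
Context {R : realType}.
Implicit Types (f : R -> R) (s u : seq (R * R)) (p q : R * R).

(** Absolute continuity is given in its epsilon-delta form and derivatives are total [lim] values,
    so energies become computable only through a fundamental theorem of calculus, obtained from
    total variation, Radon-Nikodym and Lebesgue differentiation. Pairing [f] with the Green function
    at [x] returns [f x] only up to the value of [f] at the base vertex [u0]. Both sides of each
    claim are variances of increments, where this value and all additive constants cancel.
    Integration on the graph is done with bounded measurable functions, which form no complete
    space. Boundedness of the kernel makes up for it: composing with the kernel on both sides turns
    Hilbert-Schmidt convergence into uniform convergence, and uniform limits stay bounded and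
    measurable. An eigenfunction produced by kernel theory is a priori only bounded and measurable,
    while the given spectrum speaks of functions in the Kirchhoff domain. The eigenvalue equation
    itself supplies the regularity, since the Green operator smooths. *)

Definition nonoverlap p q := (p.2 <= q.1) || (q.2 <= p.1).

(** Families are unsorted lists and may contain degenerate intervals: clipping to a subinterval can
    collapse an interval to a point, and the result is still a family. *)
Definition itv_family (a b : R) s :=
  all (fun p => [&& a <= p.1, p.1 <= p.2 & p.2 <= b]) s && pairwise nonoverlap s.

Definition itv_len s := \sum_(p <- s) (p.2 - p.1).
Definition itv_var f s := \sum_(p <- s) `|f p.2 - f p.1|.

Lemma itv_family_cons a b p s : itv_family a b (p :: s) =
  [&& a <= p.1, p.1 <= p.2, p.2 <= b, all (nonoverlap p) s & itv_family a b s].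
Proof.
rewrite /itv_family /=; case: (a <= p.1); case: (p.1 <= p.2);
  case: (p.2 <= b) => //=; by rewrite andbCA.
Qed.

Definition seq_abs_continuous (l : R) f := forall eps, 0 < eps ->
  exists2 delta, 0 < delta & forall s, itv_family 0 l s ->
    itv_len s < delta -> itv_var f s < eps.

(** Degenerate intervals contribute neither length nor variation, so they are filtered out before
    the definition is applied. *)
Lemma abs_continuous_on_seq l f :
  abs_continuous_on l f -> seq_abs_continuous l f.
Proof.
move=> acf eps eps0; have [delta delta0 h] := acf _ eps0.
exists delta => // s sf ls.
pose s' := [seq p <- s | p.1 < p.2].
have fs' : itv_family 0 l s'.
  case/andP: sf => /allP s1 s2; apply/andP; split.
    by apply/allP => p; rewrite mem_filter => /andP[_ /s1].
  by apply: subseq_pairwise s2; exact: filter_subseq.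
have degen p : p \in s -> ~~ (p.1 < p.2) -> p.2 = p.1.
  case/andP: sf => /allP s1 s2 /s1/and3P[_ p12 _]; rewrite -leNgt => p21.
  by apply/eqP; rewrite eq_le p12 p21.
have -> : itv_var f s = itv_var f s'.
  rewrite /itv_var big_filter [LHS](bigID (fun p => p.1 < p.2))/=.
  rewrite [X in _ + X](_ : _ = 0) ?addr0// big_seq_cond big1// => p /andP[ps np].
  by rewrite degen// subrr normr0.
have {}ls : itv_len s' < delta.
  rewrite (_ : itv_len s' = itv_len s)//.
  rewrite /itv_len big_filter [RHS](bigID (fun p => p.1 < p.2))/=.
  rewrite [X in _ = _ + X](_ : _ = 0) ?addr0// big_seq_cond big1// => p /andP[ps np].
  by rewrite degen// subrr.
pose a (i : 'I_(size s')) := (nth (0, 0) s' i).1.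
pose b (i : 'I_(size s')) := (nth (0, 0) s' i).2.
have E (F : R * R -> R) : \sum_(p <- s') F p = \sum_(i < size s') F (a i, b i).
  rewrite (big_nth (0, 0)) big_mkord; apply: eq_bigr => i _.
  by rewrite -surjective_pairing.
rewrite /itv_var E; apply: h => /=; last by rewrite /itv_len E in ls.
- move=> i; have : nth (0, 0) s' i \in s' by exact: mem_nth.
  move=> si; case/andP: fs' => /allP/(_ _ si)/and3P[h1 h2 h3] _; split => //.
  by split => //; move: si; rewrite mem_filter => /andP[].
- move=> i j ij; case/andP: fs' => _ /(pairwiseP (0, 0)) fs.
  have {ij} : (i < j)%N || (j < i)%N by rewrite -neq_ltn.
  case/orP => ij.
    have := fs i j (ltn_ord i) (ltn_ord j) ij.
    by rewrite /nonoverlap => /orP[|]; [left|right].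
  have := fs j i (ltn_ord j) (ltn_ord i) ij.
  by rewrite /nonoverlap => /orP[|]; [right|left].
Qed.

(** Both ends are projected onto [[a, b]]; an interval outside collapses to [a] or to [b]. *)
Definition clip (a b : R) p :=
  (Num.max a (Num.min b p.1), Num.max a (Num.min b p.2)).

Lemma clip_le a b p : p.1 <= p.2 -> (clip a b p).1 <= (clip a b p).2.
Proof.
move=> p12; rewrite /= ge_max le_max lexx/= le_max; apply/orP; right.
by rewrite le_min ge_min lexx/= ge_min p12 orbT.
Qed.

Lemma clip_id a b p : a <= p.1 -> p.1 <= p.2 -> p.2 <= b -> clip a b p = p.
Proof.
move=> ap p12 pb; rewrite /clip (min_r pb) (min_r (le_trans p12 pb)).
by rewrite (max_r ap) (max_r (le_trans ap p12)) -surjective_pairing.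
Qed.

Lemma itv_family_clip a b c d s : c <= d -> itv_family a b s ->
  itv_family c d (map (clip c d) s).
Proof.
move=> cd; elim: s => //= p s IH.
rewrite !itv_family_cons => /and5P[ap p12 pb /allP pov sf].
have clip_mono x y : x <= y -> Num.max c (Num.min d x) <= Num.max c (Num.min d y).
  move=> xy; rewrite ge_max le_max lexx/= le_max; apply/orP; right.
  by rewrite le_min ge_min lexx/= ge_min xy orbT.
apply/and5P; split; first by rewrite /= le_max lexx.
- exact: clip_mono.
- by rewrite /= ge_max cd/= ge_min lexx.
- apply/allP => _ /mapP[q qs ->]; have := pov _ qs.
  by rewrite /nonoverlap /= => /orP[|] /clip_mono->; rewrite ?orbT.
- exact: IH.
Qed.

(** An interval on one side of [c] is left unchanged by one of the clips; one that straddles [c] is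
    handled by the triangle inequality through [f c]. *)
Lemma itv_var_cut f a b c s : a <= c -> c <= b -> itv_family a b s ->
  itv_var f s <= itv_var f (map (clip a c) s) + itv_var f (map (clip c b) s).
Proof.
move=> ac cb; rewrite /itv_var !big_map -big_split/= => /andP[/allP sf _].
rewrite big_seq [leRHS]big_seq; apply: ler_sum => p /sf/and3P[ap p12 pb].
have /orP[p2c|cp2] := le_total p.2 c.
  rewrite /clip /= (min_r p2c) (min_r (le_trans p12 p2c)).
  by rewrite (max_r ap) (max_r (le_trans ap p12)) lerDl.
have /orP[p1c|cp1] := le_total p.1 c.
  rewrite /clip /= (min_l cp2) (min_r p1c) (max_r ap) (max_r ac).
  rewrite (min_r pb) (max_r cp2) (min_r (le_trans p1c cb)) (max_l p1c).
  by rewrite addrC; exact: ler_distD.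
rewrite /clip /= (min_r pb) (max_r cp2) (min_r (le_trans p12 pb)).
by rewrite (max_r cp1) lerDr.
Qed.

(** The list is not sorted. The head [p] forces every other interval into [[a, p.1]] or [[p.2, b]],
    and the induction on the size applies to the two clipped families. *)
Lemma itv_family_len a b s : a <= b -> itv_family a b s -> itv_len s <= b - a.
Proof.
move=> + sf; have [n] := ubnP (size s).
elim: n a b s sf => // n IH a b [|p s]; first by rewrite /itv_len big_nil subr_ge0.
rewrite itv_family_cons => /and5P[ap p12 pb /allP pov sf] /= /ltnSE sn ab.
rewrite /itv_len big_cons -/(itv_len _).
have lenE : itv_len s <= itv_len (map (clip a p.1) s) + itv_len (map (clip p.2 b) s).
  rewrite /itv_len !big_map -big_split big_seq [leRHS]big_seq.
  apply: ler_sum => q qs; case/andP: sf => /allP/(_ _ qs)/and3P[aq q12 qb] _.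
  have /orP[h|h] := pov _ qs.
    by rewrite [clip p.2 b q]clip_id ?h// lerDr subr_ge0 clip_le.
  by rewrite [clip a p.1 q]clip_id ?aq// lerDl subr_ge0 clip_le.
have := IH a p.1 _ (itv_family_clip ap sf); rewrite size_map => /(_ sn ap).
have := IH p.2 b _ (itv_family_clip pb sf); rewrite size_map => /(_ sn pb).
move: lenE; lra.
Qed.

Definition itv_vars f a b := [set itv_var f s | s in [set s | itv_family a b s]].

Definition itv_tv f a b : R := sup (itv_vars f a b).

Lemma itv_vars0 f a b : itv_vars f a b 0.
Proof. by exists [::] => //; rewrite /itv_var big_nil. Qed.

Section bounded.
Variables (l : R) (f : R -> R).
Hypothesis (l0 : 0 <= l) (acf : seq_abs_continuous l f).

Lemma itv_family_sub a b c d s : a <= c -> d <= b -> itv_family c d s ->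
  itv_family a b s.
Proof.
move=> ac db /andP[/allP h h']; rewrite /itv_family h' andbT; apply/allP => p /h/and3P[cp -> pd].
by rewrite (le_trans ac cp) (le_trans pd db).
Qed.

(** With [delta] chosen for the value 1, the interval is exhausted by steps of length [delta / 2],
    and each step adds at most 1 to the variation. *)
Lemma itv_var_bounded : exists M, forall s, itv_family 0 l s -> itv_var f s <= M.
Proof.
have [delta delta0 h] := acf ltr01.
suff H n : forall b, 0 <= b <= l -> b < n.+1%:R * (delta / 2) ->
    forall s, itv_family 0 b s -> itv_var f s <= n.+1%:R.
  exists (Num.truncn (l / (delta / 2))).+1%:R => s sf.
  apply: (H _ l) => //; first by rewrite l0 lexx.
  by rewrite -ltr_pdivrMr ?divr_gt0// truncnS_gt.
elim: n => [|n IH] b /andP[b0 bl] bn s sf.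
  apply/ltW/h; first exact: itv_family_sub sf.
  by apply: (le_lt_trans (itv_family_len b0 sf)); move: bn; rewrite mul1r; lra.
pose c := Num.max 0 (b - delta / 2).
have c0 : 0 <= c by rewrite le_max lexx.
have cb : c <= b by rewrite ge_max b0/=; lra.
apply: (le_trans (itv_var_cut f c0 cb sf)).
have -> : n.+2%:R = n.+1%:R + 1 :> R by rewrite -natr1.
apply: lerD.
  apply: (IH c); rewrite ?c0 ?(le_trans cb)//.
    rewrite /c gt_max; apply/andP; split; first by rewrite mulr_gt0 ?divr_gt0.
    by move: bn; rewrite -natr1; lra.
  exact: itv_family_clip sf.
have cbf := itv_family_clip cb sf.
apply/ltW/h; first exact: itv_family_sub cbf.
apply: le_lt_trans (itv_family_len cb cbf) _.
by rewrite /c; have [] := leP 0 (b - delta / 2); lra.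
Qed.

Lemma itv_vars_ub a b : 0 <= a -> b <= l -> has_ubound (itv_vars f a b).
Proof.
move=> a0 bl; have [M hM] := itv_var_bounded.
by exists M => _ [s sf <-]; apply: hM; exact: itv_family_sub sf.
Qed.

Lemma itv_var_le_tv a b s : 0 <= a -> b <= l -> itv_family a b s ->
  itv_var f s <= itv_tv f a b.
Proof. by move=> a0 bl sf; apply: ub_le_sup; [exact: itv_vars_ub|exists s]. Qed.

Lemma itv_tv_ge a b : 0 <= a -> a <= b -> b <= l -> `|f b - f a| <= itv_tv f a b.
Proof.
move=> a0 ab bl; have := @itv_var_le_tv a b [:: (a, b)] a0 bl.
rewrite /itv_var big_seq1; apply.
by rewrite itv_family_cons /= !lexx ab.
Qed.

Lemma itv_tvD a b c : 0 <= a -> a <= c -> c <= b -> b <= l ->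
  itv_tv f a b = itv_tv f a c + itv_tv f c b.
Proof.
move=> a0 ac cb bl; apply/eqP; rewrite eq_le; apply/andP; split.
  apply: ge_sup; first by exists 0; exact: itv_vars0.
  move=> _ [s sf <-]; apply: (le_trans (itv_var_cut f ac cb sf)).
  by apply: lerD; apply: itv_var_le_tv; rewrite ?(le_trans _ bl) ?(le_trans a0)//;
    apply: itv_family_clip sf.
rewrite -lerBrDr; apply: ge_sup; first by exists 0; exact: itv_vars0.
move=> _ [s sf <-]; rewrite lerBrDl -lerBrDr.
apply: ge_sup; first by exists 0; exact: itv_vars0.
move=> _ [u uf <-]; rewrite lerBrDl /itv_var -big_cat/=.
apply: itv_var_le_tv => //; move: sf uf => /andP[s1 s2] /andP[u1 u2].
rewrite /itv_family all_cat pairwise_cat s2 u2 !andbT -andbA; apply/and3P; split.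
- by apply: sub_all s1 => p /and3P[-> -> /le_trans->].
- by apply: sub_all u1 => p /and3P[/(le_trans ac)-> -> ->].
- apply/allrelP => p q /(allP s1)/and3P[_ _ pc] /(allP u1)/and3P[cq _ _].
  by rewrite /nonoverlap (le_trans pc cq).
Qed.

Lemma itv_tv_ge0 a b : 0 <= a -> b <= l -> 0 <= itv_tv f a b.
Proof. by move=> a0 bl; apply: ub_le_sup; [exact: itv_vars_ub|exact: itv_vars0]. Qed.

(* The intervals of the family are refined one at a time. *)
Lemma itv_tv_abs_continuous eps : 0 < eps -> exists2 delta, 0 < delta &
  forall s, itv_family 0 l s -> itv_len s < delta ->
    \sum_(p <- s) itv_tv f p.1 p.2 <= eps.
Proof.
move=> eps0; have [delta delta0 h] := acf eps0; exists delta => // s sf ls.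
suff H s1 s2 : itv_family 0 l (s1 ++ s2) -> itv_len (s1 ++ s2) < delta ->
    \sum_(p <- s1) itv_tv f p.1 p.2 + itv_var f s2 <= eps.
  by have := H s [::]; rewrite cats0 /itv_var big_nil addr0; exact.
elim: s1 s2 {s sf ls} => [s2 /h + /[dup] l2|p s1 IH s2 + lps].
  by move=> /[apply]; rewrite big_nil add0r => /ltW.
rewrite [(p :: s1) ++ s2]/= itv_family_cons => /and5P[p0 p12 pl /allP pov sf].
rewrite big_cons -addrA -lerBrDr; apply: ge_sup; first by exists 0; exact: itv_vars0.
move=> _ [u uf <-]; rewrite lerBrDr addrCA -big_cat/=; apply: IH.
  have {}uf0 := itv_family_sub p0 pl uf.
  have us : allrel nonoverlap u (s1 ++ s2).
    apply/allrelP => q r /(allP (andP uf).1)/and3P[pq _ qp] /pov.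
    rewrite /nonoverlap => /orP[|] h'; first by rewrite (le_trans qp h').
    by rewrite (le_trans h' pq) orbT.
  move: us; rewrite allrel_catr => /andP[us1 us2].
  move: sf uf0 => /andP[t1 t2] /andP[u1 u2]; apply/andP; split.
    by move: t1; rewrite !all_cat u1 => /andP[-> ->].
  move: t2; rewrite !pairwise_cat allrel_catr us2 u2 => /and3P[-> -> ->] /=.
  rewrite !andbT; apply/allrelP => q r qs ru.
  by have := elimT allrelP us1 r q ru qs; rewrite /nonoverlap orbC.
apply: le_lt_trans lps; rewrite /itv_len !big_cat big_cons/=.
have := itv_family_len p12 uf; rewrite /itv_len; lra.
Qed.

End bounded.
End AbsoluteContinuity.

(** * Densities of nondecreasing absolutely continuous functions *)

Section MonotoneDensity.
Context {R : realType}.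
Notation leb := (@lebesgue_measure R).

Lemma lebesgue_stieltjes_ocitv (f : cumulative R R) (a b : R) : a <= b ->
  lebesgue_stieltjes_measure f `]a, b]%classic = (f b - f a)%:E.
Proof.
move=> ab; rewrite /lebesgue_stieltjes_measure /measure_extension/=.
by rewrite measurable_mu_extE/= ?wlength_itv_bnd//; exact: is_ocitv.
Qed.

(** The intervals are the components of [U]; the pair [(0, 0)] encodes the empty members of the
    enumeration. *)
Lemma open_bounded_itvs (U : set R) : open U -> has_ubound U -> has_lbound U ->
  exists I : nat -> R * R,
  [/\ U = \bigcup_n `](I n).1, (I n).2[%classic,
   trivIset setT (fun n => `](I n).1, (I n).2[%classic) &
   forall n, (I n).1 < (I n).2 \/ I n = (0, 0)].
Proof.
move=> oU uU lU; pose J := open_disjoint_itv oU.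
have JU n : J n `<=` U.
  by rewrite [X in _ `<=` X](open_disjoint_itv_bigcup oU) => x; exists n.
have : forall n, exists I : R * R,
    J n = `]I.1, I.2[%classic /\ (I.1 < I.2 \/ I = (0, 0)).
  move=> n; have [J0|/set0P[x Jx]] := eqVneq (J n) set0.
    by exists (0, 0); rewrite J0 set_itvoo0; split => //; right.
  have JE : J n = `]inf (J n), sup (J n)[%classic.
    rewrite -[LHS](interior_id (J n)).1; last exact: open_disjoint_itv_open.
    rewrite interval_bounded_interior//.
    - exact: open_disjoint_itv_is_interval.
    - by case: lU => m mU; exists m => y /JU /mU.
    - by case: uU => m mU; exists m => y /JU /mU.
  exists (inf (J n), sup (J n)); split => //; left => /=.
  by move: Jx; rewrite {1}JE/= in_itv/= => /andP[]; exact: lt_trans.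
move=> /choice[I JI]; exists I; split.
- rewrite {1}(open_disjoint_itv_bigcup oU); apply: eq_bigcupr => n _.
  by rewrite -(JI n).1.
- have := @open_disjoint_itv_trivIset _ _ oU; congr (trivIset _ _).
  by apply/funext => n; rewrite -(JI n).1.
- by move=> n; case: (JI n).
Qed.

Lemma clip_itvs_family (l : R) (U : set R) (I : nat -> R * R) : 0 <= l ->
  U = \bigcup_n `](I n).1, (I n).2[%classic ->
  trivIset setT (fun n => `](I n).1, (I n).2[%classic) ->
  (forall n, (I n).1 < (I n).2 \/ I n = (0, 0)) ->
  forall n, itv_family 0 l [seq clip 0 l (I k) | k <- iota 0 n] /\
    ((itv_len [seq clip 0 l (I k) | k <- iota 0 n])%:E <= leb U)%E.
Proof.
move=> l0 UE tI I12 n.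
have Ile k : (I k).1 <= (I k).2 by case: (I12 k) => [/ltW//|->].
split; [apply/andP; split|].
- apply/allP => _ /mapP[k _ ->]; apply/and3P; split.
  + by rewrite /= le_max lexx.
  + exact: clip_le.
  + by rewrite /= ge_max l0 ge_min lexx.
- have mono x y : x <= y -> Num.max 0 (Num.min l x) <= Num.max 0 (Num.min l y) :> R.
    by move=> xy; exact: (@clip_le _ 0 l (x, y)).
  have z0 : clip 0 l (0, 0) = (0, 0).
    by rewrite /clip /= (min_r l0) maxxx.
  have := iota_uniq 0 n; rewrite uniq_pairwise pairwise_map.
  apply: sub_pairwise => i j /= ij.
  have [Ii|->] := I12 i; last by rewrite /nonoverlap z0 /= le_max lexx.
  have [Ij|->] := I12 j; last by rewrite /nonoverlap z0 /= le_max lexx orbT.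
  suff : nonoverlap (I i) (I j).
    by rewrite /nonoverlap => /orP[] /mono h; apply/orP; [left|right].
  rewrite /nonoverlap leNgt [in X in _ || X]leNgt -negb_and.
  (* Overlapping intervals would share the midpoint between the larger left end and the smaller
     right end. *)
  apply/negP => /andP[ji ij']; pose x := Num.max (I i).1 (I j).1.
  pose y := Num.min (I i).2 (I j).2.
  have xy : x < y by rewrite gt_max !lt_min Ii Ij ji ij'.
  move/trivIsetP : tI => /(_ i j Logic.I Logic.I ij).
  rewrite -subset0 => /(_ ((x + y) / 2)); apply; split; rewrite /= in_itv/=.
    have xi : (I i).1 <= x by rewrite le_max lexx.
    have yi : y <= (I i).2 by rewrite ge_min lexx.
    by apply/andP; split; move: xi yi xy; lra.
  have xi : (I j).1 <= x by rewrite le_max lexx orbT.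
  have yi : y <= (I j).2 by rewrite ge_min lexx orbT.
  by apply/andP; split; move: xi yi xy; lra.
rewrite /itv_len big_map (_ : iota 0 n = index_iota 0 n); last first.
  by rewrite /index_iota subn0.
rewrite big_mkord UE.
apply: (@le_trans _ _ (\sum_(i < n) leb `](I i).1, (I i).2[%classic)%E).
  rewrite -sumEFin lee_sum// => i _; rewrite lebesgue_measure_itv/= lte_fin.
  have [Ii|->] := I12 i; last by rewrite /= (min_r l0) maxxx subrr ltxx.
  rewrite Ii lee_fin.
  move: Ii l0; case: (I i) => u v /= uv l0.
  have [?|?] := leP l v; have [?|?] := leP l u;
  have [?|?] := leP 0 l; have [?|?] := leP 0 u; have [?|?] := leP 0 v; lra.
rewrite -measure_bigsetU_ord//; last first.
- by move=> i j _ _ ij; apply/val_inj/(tI i j).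
- by apply: le_measure; rewrite ?inE; [exact: bigsetU_measurable|
    exact: bigcup_measurable|exact: bigsetU_bigcup].
Qed.

(** The density is the Radon-Nikodym derivative of the Stieltjes measure of [G] on []0, l]]. For
    domination, a null set is enclosed in a bounded open set of measure less than [delta]; finitely
    many of its components, clipped to [[0, l]], form a family on which [G] grows by at most
    [eps]. *)
Theorem nondecreasing_ac_density (l : R) (G : cumulative R R) : 0 <= l ->
  (forall eps : R, 0 < eps -> exists2 delta, 0 < delta &
    forall s, itv_family 0 l s -> itv_len s < delta ->
      \sum_(p <- s) (G p.2 - G p.1) <= eps) ->
  exists g : R -> R, leb.-integrable setT (EFin \o g) /\
    forall t, 0 <= t <= l -> G t - G 0 = \int[leb]_(x in `]0, t]) g x.
Proof.
move=> l0 acG; pose nu := lebesgue_stieltjes_measure G.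
have mD : measurable (`]0, l]%classic : set (measurableTypeR R)).
  exact: measurable_itv.
have nuD : (nu `]0%R, l]%classic < +oo)%E.
  by rewrite /nu lebesgue_stieltjes_ocitv// ltry.
pose nu' : {finite_measure set (measurableTypeR R) -> \bar R} := mfrestr mD nuD.
have dom : charge_of_finite_measure nu' `<< leb.
  apply/null_content_dominatesP => N mN N0.
  apply/eqP; rewrite eq_le measure_ge0 andbT.
  apply/lee_addgt0Pr => eps eps0; rewrite add0e.
  have [delta delta0 hG] := acG _ eps0.
  have Noo : (leb N < +oo)%E by rewrite N0.
  have [U0 [oU0 NU0 U0N]] := lebesgue_regularity_outer mN Noo delta0.
  pose U := U0 `&` `]-1, l + 1[%classic.
  have oU : open U by apply: openI => //; exact: itv_open.
  have Udelta : (leb U < delta%:E)%E.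
    apply: le_lt_trans U0N; rewrite -[leRHS]adde0 -N0.
    apply: (@le_trans _ _ (leb ((U0 `\` N) `|` N))).
      apply: le_measure; rewrite ?inE.
      - exact: open_measurable.
      - apply: measurableU => //; apply: measurableD => //.
        exact: open_measurable.
      - by move=> x [U0x _]; have [|] := pselect (N x); [right|left].
    apply: measureU2 => //; apply: measurableD => //; exact: open_measurable.
  have uU : has_ubound U.
    by exists (l + 1) => x [_] /=; rewrite in_itv/= => /andP[_ /ltW].
  have lU : has_lbound U.
    by exists (- 1) => x [_] /=; rewrite in_itv/= => /andP[/ltW].
  have [I [UE tI I12]] := open_bounded_itvs oU uU lU.
  have fam := clip_itvs_family l0 UE tI I12.
  pose F n := `](clip 0 l (I n)).1, (clip 0 l (I n)).2]%classic.
  have NF : N `&` `]0, l]%classic `<=` \bigcup_n F n.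
    move=> x [Nx]; rewrite /= in_itv/= => /andP[x0 xl].
    have : U x.
      split; first exact: NU0.
      by rewrite /= in_itv/=; apply/andP; split; move: x0 xl; lra.
    rewrite UE => -[n _]; rewrite /= in_itv/= => /andP[Ix xI]; exists n => //.
    rewrite /F /= in_itv/= gt_max x0 gt_min Ix orbT/= le_max le_min xl (ltW xI).
    by rewrite orbT.
  have clipI k : (clip 0 l (I k)).1 <= (clip 0 l (I k)).2.
    by apply: clip_le; case: (I12 k) => [/ltW//|->].
  have mF n : measurable (F n : set (measurableTypeR R)) by exact: measurable_itv.
  have mND : measurable (N `&` `]0, l]%classic : set (measurableTypeR R)) by exact: measurableI.
  apply: le_trans (measure_sigma_subadditive nu mF mND NF) _.
  apply: lime_le; first exact: is_cvg_nneseries.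
  apply: nearW => n.
  rewrite (eq_bigr (fun k => (G (clip 0 l (I k)).2 - G (clip 0 l (I k)).1)%:E)); last first.
    by move=> k _; exact: lebesgue_stieltjes_ocitv.
  rewrite sumEFin lee_fin.
  have [fn ln] := fam n; have := hG _ fn; rewrite big_map /index_iota subn0; apply.
  by rewrite -lte_fin; exact: le_lt_trans ln Udelta.
pose g := Radon_Nikodym (charge_of_finite_measure nu') leb.
have gfin x : g x \is a fin_num by exact: Radon_Nikodym_fin_num.
have gi : leb.-integrable setT g by exact: Radon_Nikodym_integrable.
exists (fine \o g); split.
  by apply: eq_integrable gi => // x _; rewrite /= fineK.
move=> t /andP[t0 tl].
have := @Radon_Nikodym_integral _ _ _ (charge_of_finite_measure nu') leb `]0, t]%classic dom (measurable_itv _).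
rewrite /charge_of_finite_measure /nu' /= /mfrestr /mrestr setIidl; last first.
  by apply: subset_itvl; rewrite bnd_simp.
rewrite /nu lebesgue_stieltjes_ocitv// /Rintegral => h.
have -> : (\int[leb]_(x in `]0%R, t]) ((fine \o g) x)%:E = \int[leb]_(x in `]0%R, t]) g x)%E.
  by apply: eq_integral => x _; rewrite /= fineK.
by rewrite -h.
Qed.

End MonotoneDensity.

Section AbsContinuousDensity.
Context {R : realType}.
Notation leb := (@lebesgue_measure R).
Variables (l : R) (f : R -> R).
Hypotheses (l0 : 0 <= l) (acf : seq_abs_continuous l f).

(** This is meant for the variation function of [f] and for its difference with [f], whose
    increments can reach twice the variation; hence the factor 2. Composing [H] with the projection
    [cl] onto [[0, l]] makes it continuous and nondecreasing on the whole line. *)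
Lemma tv_dominated_density (H : R -> R) :
  (forall a b, 0 <= a -> a <= b -> b <= l ->
    0 <= H b - H a <= 2 * itv_tv f a b) ->
  exists g : R -> R, leb.-integrable setT (EFin \o g) /\
    forall t, 0 <= t <= l -> H t - H 0 = \int[leb]_(x in `]0, t]) g x.
Proof.
move=> hH; pose cl t := Num.max 0 (Num.min l t).
have cl0 t : 0 <= cl t by rewrite le_max lexx.
have cll t : cl t <= l by rewrite ge_max l0 ge_min lexx.
have clm x y : x <= y -> cl x <= cl y by move=> xy; exact: (@clip_le _ 0 l (x, y)).
have clE t : 0 <= t <= l -> cl t = t.
  by move=> /andP[t0 tl]; rewrite /cl (min_r tl) (max_r t0).
have cld x y : x <= y -> cl y - cl x <= y - x.
  move=> xy; rewrite /cl.
  by have [?|?] := leP l x; have [?|?] := leP l y; have [?|?] := leP 0 l;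
    have [?|?] := leP 0 x; have [?|?] := leP 0 y; lra.
pose G := H \o cl.
have ndG : {homo G : x y / x <= y}.
  move=> x y xy; rewrite -subr_ge0.
  by have /andP[] := hH _ _ (cl0 x) (clm _ _ xy) (cll y).
have close (eps : R) : 0 < eps -> exists2 delta, 0 < delta & forall x y,
    x <= y -> y - x < delta -> G y - G x <= eps.
  move=> eps0; have e20 : 0 < eps / 2 by rewrite divr_gt0.
  have [delta delta0 hd] := itv_tv_abs_continuous acf e20.
  exists delta => // x y xy yx; have /andP[_] := hH _ _ (cl0 x) (clm _ _ xy) (cll y).
  have := hd [:: (cl x, cl y)]; rewrite /itv_len !big_seq1 /= => h /le_trans; apply.
  rewrite mulrC -ler_pdivlMr//; apply: h; last exact: le_lt_trans (cld _ _ xy) yx.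
  by rewrite itv_family_cons/= cl0 clm// cll.
have cG : continuous G.
  move=> x; apply/cvgrPdist_le => eps eps0.
  have [delta delta0 hd] := close _ eps0.
  rewrite /prop_near1; apply/nbhs_ballP; exists delta => //= y yx.
  have [xy|/ltW xy] := leP x y.
    rewrite distrC ger0_norm ?subr_ge0 ?ndG//; apply: hd => //.
    by rewrite -(@ger0_norm _ (y - x)) ?subr_ge0// distrC.
  rewrite ger0_norm ?subr_ge0 ?ndG//; apply: hd => //.
  by rewrite -(@ger0_norm _ (x - y)) ?subr_ge0.
pose Gc : cumulative R R :=
  HB.pack G (isCumulative.Build R _ R G ndG (right_continuousW cG)).
have [|g [gi gE]] := @nondecreasing_ac_density R l Gc l0.
  move=> eps eps0; have e20 : 0 < eps / 2 by rewrite divr_gt0.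
  have [delta delta0 hd] := itv_tv_abs_continuous acf e20.
  exists delta => // s sf sl.
  rewrite -(divfK (_ : 2 != 0) eps)//; apply: le_trans (ler_wpM2r _ (hd _ sf sl)) => //.
  rewrite big_distrl/= big_seq [leRHS]big_seq; apply: ler_sum => p ps.
  case/andP: sf => /allP/(_ _ ps)/and3P[p0 p12 pl] _.
  rewrite /G /= !clE ?p0 ?(le_trans p12)// ?(le_trans p0)//.
  by have /andP[_] := hH _ _ p0 p12 pl; rewrite mulrC.
exists g; split => // t tl.
have := gE t tl; rewrite /Gc /= /G /= !clE ?lexx ?l0//.
Qed.

End AbsContinuousDensity.

Section Slopes.
Context {R : realType}.
Notation leb := (@lebesgue_measure R).

(** Properness of this filter, also at the two ends, makes limits unique; this is what identifies
    the total [derive_on] with an actual derivative. *)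
Lemma within_itv_proper (l x : R) : 0 < l -> 0 <= x <= l ->
  ProperFilter (within `[0, l] x^').
Proof.
move=> l0 /andP[x0 xl]; apply: Build_ProperFilter_ex => A.
rewrite /within /= => /nbhs_ballP[e /= e0 hA].
have [xl'|lx] := ltP x l.
  exists (Num.min l (x + e / 2)); apply: (hA _).
  - rewrite /ball/= ltr_distlC; have [?|?] := leP l (x + e / 2);
      apply/andP; split; move: e0 xl'; lra.
  - have [?|?] := leP l (x + e / 2); move: e0 xl' => ? ?; apply/eqP; lra.
  - by rewrite /= in_itv/=; have [?|?] := leP l (x + e / 2); move: x0 l0 e0 xl' => ? ? ? ?; lra.
exists (Num.max 0 (x - e / 2)); apply: (hA _).
- rewrite /ball/= ltr_distlC; have [?|?] := leP 0 (x - e / 2);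
    apply/andP; split; move: e0 l0 lx; lra.
- have [?|?] := leP 0 (x - e / 2); move: e0 l0 lx => ? ? ?; apply/eqP; lra.
- by rewrite /= in_itv/=; have [?|?] := leP 0 (x - e / 2); move: x0 l0 e0 lx xl => ? ? ? ? ?; lra.
Qed.

Lemma slope_on_cvg (l : R) (f phi : R -> R) (x m : R) :
  0 <= x <= l ->
  (forall t, 0 <= t <= l -> f t - f x = phi t - phi x) ->
  is_derive x 1 phi m ->
  slope_on f x t @[t --> within `[0, l] x^'] --> m.
Proof.
move=> xl fphi [dphi <-].
have /cvgrPdist_lt h := dphi.
apply/cvgrPdist_lt => eps eps0.
have := h _ eps0; rewrite /prop_near1 => /nbhs_ballP[e /= e0 he].
rewrite /prop_near1 /within /=; apply/nbhs_ballP; exists e => //= t xt tx tl.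
have := he (t - x); rewrite /ball/= sub0r normrN distrC subr_eq0 => /(_ xt tx).
by rewrite /slope_on fphi// mulrC /= [_ *: 1]mulr1 subrK.
Qed.

Lemma derive_onE (l : R) (f : R -> R) (x m : R) : 0 < l -> 0 <= x <= l ->
  slope_on f x t @[t --> within `[0, l] x^'] --> m -> derive_on l f x = m.
Proof.
move=> l0 xl h; have ? := within_itv_proper l0 xl.
by apply/cvg_lim => //; exact: Rhausdorff.
Qed.

End Slopes.

(** * The fundamental theorem of calculus for absolutely continuous functions *)

Section FundamentalTheorem.
Context {R : realType}.
Notation leb := (@lebesgue_measure R).
Implicit Types (f g v : R -> R).

#[local] Instance ae_lebesgue_filter : Filter (almost_everywhere leb) :=
  ae_filter_ringOfSetsType leb.

Lemma ae_eq_Rintegral (D : set R) g v : measurable D -> measurable_fun D v ->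
  leb.-integrable D (EFin \o g) -> {ae leb, forall t, D t -> v t = g t} ->
  leb.-integrable D (EFin \o v) /\ \int[leb]_(t in D) v t = \int[leb]_(t in D) g t.
Proof.
move=> mD mv gi vg; have /integrableP[mg goo] := gi.
have mEv : measurable_fun D (EFin \o v) by exact/measurable_EFinP.
have vgE : ae_eq leb D (EFin \o v) (EFin \o g).
  by apply: filterS vg => t h Dt; rewrite /= h.
split; last by rewrite /Rintegral; congr fine; exact: ae_eq_integral.
apply/integrableP; split => //; apply: le_lt_trans goo.
rewrite le_eqVlt; apply/orP; left; apply/eqP; apply: ae_eq_integral => //.
- exact: measurableT_comp.
- exact: measurableT_comp.
- by apply: filterS vgE => t h Dt; have /= [->] := h Dt.
Qed.

Lemma ae_neq (c : R) : {ae leb, forall t, t != c}.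
Proof.
exists [set c]; split; first exact: measurable_set1.
  exact: lebesgue_measure_set1.
by move=> t /= /negP; rewrite negbK => /eqP.
Qed.

Lemma ae_itvoo_itvcc (l : R) (P : R -> Prop) :
  {ae leb, forall t, 0 < t < l -> P t} -> {ae leb, forall t, `[0, l]%classic t -> P t}.
Proof.
move=> h; apply: filterS3 (ae_neq 0) (ae_neq l) h => t t0 tl ht /=; rewrite in_itv/= => /andP[t0' tl'].
by apply: ht; rewrite !lt_neqAle t0' tl' tl eq_sym t0.
Qed.

(** Jordan decomposition: the variation function [F] and [F - f] are nondecreasing with densities
    [g1] and [g2], so [f] has density [g1 - g2]. Convergence of the slopes is Lebesgue
    differentiation of the primitive. *)
Theorem abs_continuous_on_density (l : R) f : 0 < l -> abs_continuous_on l f ->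
  exists g, [/\ leb.-integrable setT (EFin \o g),
    forall t, 0 <= t <= l -> f t - f 0 = \int[leb]_(x in `[0, t]) g x &
    {ae leb, forall t, 0 < t < l ->
      slope_on f t u @[u --> within `[0, l] t^'] --> g t}].
Proof.
move=> lgt0 /abs_continuous_on_seq acf; have l0 := ltW lgt0.
pose F t := itv_tv f 0 t.
have FD a b : 0 <= a -> a <= b -> b <= l -> F b - F a = itv_tv f a b.
  by move=> a0 ab bl; rewrite /F (itv_tvD l0 acf (lexx _) a0 ab bl) addrAC subrr add0r.
have [|g1 [g1i g1E]] := tv_dominated_density l0 acf (H := F).
  move=> a b a0 ab bl; rewrite FD//.
  have := itv_tv_ge0 l0 acf a0 bl.
  by move=> h; apply/andP; split; [|move: h; lra].
have [|g2 [g2i g2E]] := tv_dominated_density l0 acf (H := fun t => F t - f t).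
  move=> a b a0 ab bl.
  have := itv_tv_ge l0 acf a0 ab bl; have := FD _ _ a0 ab bl.
  by rewrite ler_norml => h1 /andP[h2 h3]; apply/andP; split; move: h1 h2 h3; lra.
pose g t := g1 t - g2 t.
have gi : leb.-integrable setT (EFin \o g).
  by apply: eq_integrable (integrableB measurableT g1i g2i).
have gS (D : set R) : measurable D -> leb.-integrable D (EFin \o g).
  by move=> mD; exact: integrableS gi.
have fE t : 0 <= t <= l -> f t - f 0 = \int[leb]_(x in `]0, t]) g x.
  move=> tl; rewrite RintegralB//; try by [exact: integrableS g1i|exact: integrableS g2i].
  by rewrite -g1E// -g2E//; lra.
exists g; split => //.
  by move=> t tl; rewrite fE// Rintegral_itv_obnd_cbnd//; exact: gS.
have gloc : locally_integrable setT g.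
  by apply: open_integrable_locally => //; exact: openT.
apply: filterS (@FTC1 R g (BRight 0) (fun y => gS _ (measurable_itv _)) gloc).
move=> t h /andP[t0 tl]; have [|d1 d2] := h; first exact: t0.
apply: (@slope_on_cvg _ _ _ (fun y => \int[leb]_(x in `]0, y]) g x)).
- by rewrite !ltW.
- move=> u ul; have := fE _ ul; have := fE t; rewrite !ltW// => /(_ isT); lra.
- by apply: DeriveDef; [exact: d1|rewrite -derive1E; exact: d2].
Qed.

(** The condition on [v] binds only where the slopes of [f] converge. They do so almost everywhere,
    which forces [v] to agree almost everywhere with the density of [f]. *)
Theorem abs_continuous_on_FTC (l : R) f v : 0 < l -> abs_continuous_on l f ->
  measurable_fun `[0, l] v ->
  {ae leb, forall t, 0 < t < l -> forall m : R,
    slope_on f t u @[u --> within `[0, l] t^'] --> m -> v t = m} ->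
  leb.-integrable `[0, l] (EFin \o v) /\
  forall t, 0 <= t <= l -> \int[leb]_(x in `[0, t]) v x = f t - f 0.
Proof.
move=> l0 acf mv vE; have [g [gi fg gE]] := abs_continuous_on_density l0 acf.
have gS (D : set R) : measurable D -> leb.-integrable D (EFin \o g).
  by move=> mD; exact: integrableS gi.
have vg : {ae leb, forall t, `[0, l]%classic t -> v t = g t}.
  apply: ae_itvoo_itvcc; apply: filterS2 vE gE => t h1 h2 tl.
  by apply: h1 => //; exact: h2.
split.
  by have [] := ae_eq_Rintegral (measurable_itv _) mv (gS _ (measurable_itv _)) vg.
move=> t tl; rewrite fg//.
have sub : `[0, t]%classic `<=` `[0, l]%classic.
  by apply: subset_itvl; rewrite bnd_simp; case/andP: tl.
have [] := @ae_eq_Rintegral `[0, t]%classic g v => //.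
- by apply: measurable_funS mv.
- exact: gS.
- by apply: filterS vg => u h /sub.
Qed.

Corollary abs_continuous_on_FTC_derive (l : R) f : 0 < l -> abs_continuous_on l f ->
  measurable_fun `[0, l] (derive_on l f) ->
  leb.-integrable `[0, l] (EFin \o derive_on l f) /\
  forall t, 0 <= t <= l -> \int[leb]_(x in `[0, t]) derive_on l f x = f t - f 0.
Proof.
move=> l0 acf mf; apply: abs_continuous_on_FTC => //.
apply: aeW => t tl m; apply: derive_onE => //.
by case/andP: tl => *; rewrite !ltW.
Qed.

End FundamentalTheorem.

(** * Integration over a metric graph *)

Section IntervalFubini.
Context {R : realType}.
Notation leb := (@lebesgue_measure R).

Lemma bounded_itv_integrable (a b M : R) (h : R -> R) :
  measurable_fun setT h -> (forall t, `|h t| <= M) ->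
  leb.-integrable `[a, b] (EFin \o h).
Proof.
move=> mh hM; apply: measurable_bounded_integrable => //.
- by rewrite /= lebesgue_measure_itv/=; case: ifP => _; rewrite -?EFinD ltry.
- exact: measurable_funS mh.
- exists M; split; first exact: num_real.
  by move=> x Mx t _ /=; rewrite (le_trans (hM t))// ltW.
Qed.

Lemma fine_lebesgue_itv (b : R) : 0 <= b -> fine (leb `[0, b]%classic) = b.
Proof.
move=> b0; rewrite lebesgue_measure_itv/= lte_fin.
by case: ltP => [_|h] /=; rewrite ?subr0//; apply/eqP; rewrite eq_le b0 h.
Qed.

Lemma ge0_integral_restr d (T : measurableType d) (f : T * R -> R) (x : T) (b : R) :
  (\int[leb]_t (f (x, t) * \1_(`[0, b]%classic) t)%:E =
   \int[leb]_(t in `[0%R, b]) (f (x, t))%:E)%E.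
Proof.
rewrite [RHS]integral_mkcond; apply: eq_integral => t _.
by rewrite patchE indicE; case: (t \in _); rewrite ?mulr1 ?mulr0.
Qed.

Lemma itv_indic_measurable (b : R) : measurable_fun setT (\1_(`[0, b]%classic) : R -> R).
Proof. exact: measurable_indic. Qed.

Section ParametricIntegral.
Context d (T : measurableType d).
Variables (f : T * R -> R) (M b : R).
Hypotheses (mf : measurable_fun setT f) (fM : forall p, `|f p| <= M).

Lemma section_measurable x : measurable_fun setT (fun t => f (x, t)).
Proof. exact: measurableT_comp mf (pair1_measurable _). Qed.

Lemma section_integrable x : leb.-integrable `[0, b] (EFin \o (fun t => f (x, t))).
Proof. exact: bounded_itv_integrable (section_measurable x) (fun t => fM _). Qed.

(** Tonelli's theorem concerns nonnegative functions, so the bound [M] is added to [f] and its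
    constant contribution subtracted afterwards. *)
Lemma param_Rintegral_measurable :
  measurable_fun setT (fun x => \int[leb]_(t in `[0, b]) f (x, t)).
Proof.
pose F p := (f p + M) * \1_(`[0, b]%classic) p.2.
have mF : measurable_fun setT F.
  apply: measurable_funM; first exact: measurable_funD.
  exact: measurableT_comp (itv_indic_measurable b) measurable_snd.
have F0 p : 0 <= F p.
  apply: mulr_ge0; last by rewrite indicE.
  by have := fM p; rewrite ler_norml => /andP[]; lra.
have h := @measurable_fun_fubini_tonelli_F _ _ _ _ _ leb (EFin \o F).
have {}h := h ((measurable_EFinP _ _).2 mF) (fun p => F0 p).
have fE x : \int[leb]_(t in `[0, b]) f (x, t) =
    fine (fubini_F leb (EFin \o F) x) - M * fine (leb `[0, b]%classic).
  rewrite /fubini_F /F /= (ge0_integral_restr (fun p => f p + M)).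
  rewrite -/(Rintegral _ _ _) RintegralD//=; first by rewrite Rintegral_cst// addrK.
    exact: section_integrable.
  by apply: (@bounded_itv_integrable _ _ `|M| (fun=> M)) => // ?.
rewrite (funext fE); apply: measurable_funB => //.
exact: measurableT_comp h.
Qed.

End ParametricIntegral.

(** Tonelli's theorem is applied to [g = f + M], cut off by the indicators of both intervals; the
    contributions of [M] to the two iterated integrals coincide. *)
Lemma Rintegral_swap (f : R * R -> R) (M a b : R) :
  measurable_fun setT f -> (forall p, `|f p| <= M) ->
  \int[leb]_(s in `[0, a]) \int[leb]_(t in `[0, b]) f (s, t) =
  \int[leb]_(t in `[0, b]) \int[leb]_(s in `[0, a]) f (s, t).
Proof.
move=> mf fM.
have M0 : 0 <= M by apply: le_trans (fM (0, 0)).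
have mfs : measurable_fun setT (fun p => f (p.2, p.1)).
  by apply: measurableT_comp mf _; exact: measurable_swap.
pose g p := f p + M.
have mg : measurable_fun setT g by exact: measurable_funD.
have g0 p : 0 <= g p by have := fM p; rewrite /g ler_norml => /andP[]; lra.
have gM p : `|g p| <= 2 * M.
  by rewrite ger0_norm// /g; have := fM p; rewrite ler_norml => /andP[_]; lra.
have mgs : measurable_fun setT (fun p => g (p.2, p.1)).
  by apply: measurableT_comp mg _; exact: measurable_swap.
suff H : \int[leb]_(s in `[0, a]) \int[leb]_(t in `[0, b]) g (s, t) =
    \int[leb]_(t in `[0, b]) \int[leb]_(s in `[0, a]) g (s, t).
  have cint c (D : set R) : measurable D -> (leb D < +oo)%E -> leb.-integrable D (EFin \o (fun=> c)).
    move=> mD Doo; apply: measurable_bounded_integrable => //.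
    by exists `|c|; split => // x cx t _; rewrite ltW.
  have itvoo c : (leb `[0%R, c]%classic < +oo)%E.
    by rewrite /= lebesgue_measure_itv/=; case: ifP => _; rewrite -?EFinD ltry.
  have bint c (h : R -> R) : measurable_fun setT h -> (exists N, forall t, `|h t| <= N) ->
      leb.-integrable `[0, c] (EFin \o h).
    by move=> mh [N hN]; exact: bounded_itv_integrable hN.
  have pb (k : R * R -> R) c x : (forall p, `|k p| <= M) -> measurable_fun setT k ->
      `|\int[leb]_(t in `[0, c]) k (x, t)| <= M * fine (leb `[0, c]%classic).
    move=> kM mk; apply: le_trans (le_normr_Rintegral _ (section_integrable c mk kM x)) _ => //.
    rewrite -Rintegral_cst//; apply: le_Rintegral => //.
      have := section_integrable c mk kM x => /integrable_norm.
      by apply: eq_integrable => // t _ /=.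
    exact: cint.
  have fsM p : `|f (p.2, p.1)| <= M by exact: fM.
  have E1 s : \int[leb]_(t in `[0, b]) g (s, t) =
      \int[leb]_(t in `[0, b]) f (s, t) + M * fine (leb `[0, b]%classic).
    by rewrite RintegralD ?Rintegral_cst//; [exact: section_integrable mf fM s|exact: cint].
  have E2 t : \int[leb]_(s in `[0, a]) g (s, t) =
      \int[leb]_(s in `[0, a]) f (s, t) + M * fine (leb `[0, a]%classic).
    by rewrite RintegralD ?Rintegral_cst//; [exact: section_integrable mfs fsM t|exact: cint].
  move: H; rewrite [LHS](_ : _ = \int[leb]_(s in `[0, a])
      (\int[leb]_(t in `[0, b]) f (s, t) + M * fine (leb `[0, b]%classic))); last first.
    by apply: eq_Rintegral => s _; exact: E1.
  rewrite [RHS](_ : _ = \int[leb]_(t in `[0, b])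
      (\int[leb]_(s in `[0, a]) f (s, t) + M * fine (leb `[0, a]%classic))); last first.
    by apply: eq_Rintegral => t _; exact: E2.
  rewrite RintegralD//; last 2 first.
  - apply: bint; first exact: param_Rintegral_measurable mf fM.
    by exists (M * fine (leb `[0, b]%classic)) => t; exact: pb.
  - by apply: cint.
  rewrite RintegralD//; last 2 first.
  - apply: bint; first exact: param_Rintegral_measurable mfs fsM.
    by exists (M * fine (leb `[0, a]%classic)) => t; exact: (pb (fun p => f (p.2, p.1))).
  - by apply: cint.
  rewrite !Rintegral_cst// -!mulrA.
  by rewrite [fine (leb `[0, b]%classic) * _]mulrC => /addIr.
pose F p := g p * \1_(`[0, b]%classic) p.2 * \1_(`[0, a]%classic) p.1.
have mF : measurable_fun setT F.
  apply: measurable_funM.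
    by apply: measurable_funM => //; exact: measurableT_comp (itv_indic_measurable b) measurable_snd.
  exact: measurableT_comp (itv_indic_measurable a) measurable_fst.
have F0 p : 0 <= F p by rewrite !mulr_ge0// indicE.
have := @fubini_tonelli _ _ _ _ R leb leb (EFin \o F) ((measurable_EFinP _ _).2 mF) (fun p => F0 p).
have step (k : R * R -> R) c e : measurable_fun setT k -> (forall p, `|k p| <= 2 * M) ->
    (\int[leb]_s \int[leb]_t (k (s, t) * \1_(`[0, e]%classic) t *
        \1_(`[0, c]%classic) s)%:E =
     \int[leb]_(s in `[0%R, c]) (\int[leb]_(t in `[0, e]) k (s, t))%:E)%E.
  move=> mk kM.
  rewrite -(ge0_integral_restr (fun p => \int[leb]_(t in `[0, e]) k (p.2, t)) (0 : R) c).
  apply: eq_integral => s _ /=.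
  under eq_integral do rewrite mulrAC.
  rewrite (ge0_integral_restr (fun p => k p * \1_(`[0, c]%classic) p.1)) /=.
  rewrite /Rintegral EFinM fineK; last first.
    by apply: integrable_fin_num => //; exact: section_integrable mk kM s.
  rewrite -integralZr//; last exact: section_integrable mk kM s.
rewrite /F/= step//.
under [in X in _ = X -> _]eq_integral do under eq_integral do rewrite mulrAC.
rewrite (step (fun p => g (p.2, p.1)))// => h.
by rewrite /Rintegral -!/(Rintegral _ _ _); congr fine.
Qed.

End IntervalFubini.

Lemma Rintegral_itv_sum {R : realType} (b : R) (I : Type) (s : seq I) (F : I -> R -> R) :
  (forall i, measurable_fun setT (F i)) ->
  (forall i, exists M, forall t, `|F i t| <= M) ->
  \int[lebesgue_measure]_(t in `[0, b]) (\sum_(i <- s) F i t) =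
  \sum_(i <- s) \int[lebesgue_measure]_(t in `[0, b]) F i t.
Proof.
move=> mF bF; elim: s => [|i s IH].
  rewrite big_nil -[RHS](mul0r (fine (lebesgue_measure `[0, b]%classic))).
  by rewrite -Rintegral_cst//; apply: eq_Rintegral => t _; rewrite big_nil.
rewrite big_cons -IH -RintegralD//.
- by apply: eq_Rintegral => t _; rewrite big_cons.
- by have [M FM] := bF i; exact: bounded_itv_integrable FM.
have [M sM] : exists M, forall t, `|\sum_(i <- s) F i t| <= M.
  elim: s {IH} => [|j s [N IH]]; first by exists 0 => t; rewrite big_nil normr0.
  have [M FM] := bF j; exists (M + N) => t.
  by rewrite big_cons (le_trans (ler_normD _ _))// lerD.
by apply: bounded_itv_integrable sM; exact: measurable_sum.
Qed.

Section OnEdge.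
Context {R : realType} {G : metric_graph R}.

Lemma on_edge0 (e : edge G) : on_edge e 0 = Vertex (src e).
Proof. by rewrite /on_edge insubF ?ltxx// lexx. Qed.

Lemma on_edgel (e : edge G) : on_edge e (len e) = Vertex (tgt e).
Proof. by rewrite /on_edge insubF ?ltxx ?andbF// leNgt len_gt0. Qed.

Lemma on_edge_inner (e : edge G) (u : {t : R | 0 < t < len e}) :
  on_edge e (val u) = Inner u.
Proof. by rewrite /on_edge valK. Qed.

(** A path from [v] to [src e0] either is trivial or leaves [v] along an edge. The edge [e0]
    excludes the graph reduced to one vertex. *)
Lemma vertex_on_edge (e0 : edge G) (v : vertex G) :
  exists e : edge G, v = src e \/ v = tgt e.
Proof.
have /connectP[p] := graph_connected v (src e0).
case: p => [_ /= e0v|a p /= /andP[/existsP[e /eqP ea] _] _].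
  by exists e0; left.
exists e; have : v \in [set src e; tgt e]%SET by rewrite ea !inE eqxx.
by rewrite !inE => /orP[] /eqP; [left|right].
Qed.

Lemma on_edgeP (e0 : edge G) (x : gpoint G) :
  exists (e : edge G) (t : R), 0 <= t <= len e /\ x = on_edge e t.
Proof.
case: x => [v|e u].
  have [e [->|->]] := vertex_on_edge e0 v; exists e.
    by exists 0; rewrite on_edge0 lexx ltW// len_gt0.
  by exists (len e); rewrite on_edgel lexx ltW// len_gt0.
exists e, (val u); rewrite on_edge_inner; split => //.
by have /andP[/ltW-> /ltW->] := valP u.
Qed.

End OnEdge.

Section GraphIntegral.
Context {R : realType} {G : metric_graph R}.
Notation leb := (@lebesgue_measure R).
Implicit Types (f g : gpoint G -> R) (K L : gpoint G -> gpoint G -> R).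

Definition gint f : R :=
  \sum_(e : edge G) \int[leb]_(t in `[0, len e]) edge_fun f e t.

(** Boundedness replaces square integrability: products of such functions are again of this kind,
    hence integrable. Measurability can be asked on all of [R] because [on_edge] is constant beyond
    both ends. *)
Definition bmeas f := (forall e, measurable_fun setT (edge_fun f e)) /\
  exists M, forall x, `|f x| <= M.

(** Joint measurability and a bound at every pair of points, with no exceptional null set, so that
    each section is [bmeas] and identities between iterated kernels hold pointwise. *)
Definition bker K :=
  (forall e e', measurable_fun setT
    (fun p : R * R => K (on_edge e p.1) (on_edge e' p.2))) /\
  exists M, forall x y, `|K x y| <= M.

Definition total_len : R := \sum_(e : edge G) len e.

Lemma total_len_ge0 : 0 <= total_len.
Proof. by apply: sumr_ge0 => e _; rewrite ltW// len_gt0. Qed.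

Lemma bmeas_cst c : bmeas (fun=> c).
Proof. by split => [e|]; [exact: measurable_cst|exists `|c|]. Qed.

Lemma bmeasD f g : bmeas f -> bmeas g -> bmeas (fun x => f x + g x).
Proof.
move=> [mf [M fM]] [mg [N gN]]; split => [e|]; first exact: (measurable_funD (mf e) (mg e)).
by exists (M + N) => x; rewrite (le_trans (ler_normD _ _))// lerD.
Qed.

Lemma bmeasM f g : bmeas f -> bmeas g -> bmeas (fun x => f x * g x).
Proof.
move=> [mf [M fM]] [mg [N gN]]; split => [e|]; first exact: (measurable_funM (mf e) (mg e)).
by exists (M * N) => x; rewrite normrM ler_pM.
Qed.

Lemma bmeasZ c f : bmeas f -> bmeas (fun x => c * f x).
Proof. by move=> mf; apply: bmeasM => //; exact: bmeas_cst. Qed.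

Lemma bmeasB f g : bmeas f -> bmeas g -> bmeas (fun x => f x - g x).
Proof.
move=> mf mg; have := bmeasD mf (bmeasZ (-1) mg).
by congr bmeas; apply/funext => x; rewrite mulN1r.
Qed.

Lemma bmeas_sum (I : Type) (s : seq I) (F : I -> gpoint G -> R) :
  (forall i, bmeas (F i)) -> bmeas (fun x => \sum_(i <- s) F i x).
Proof.
move=> mF; elim: s => [|i s IH].
  have := bmeas_cst 0; congr bmeas; apply/funext => x; by rewrite big_nil.
have := bmeasD (mF i) IH; congr bmeas; apply/funext => x; by rewrite big_cons.
Qed.

Lemma bmeas_edge_integrable f e : bmeas f ->
  leb.-integrable `[0, len e] (EFin \o edge_fun f e).
Proof. by move=> [mf [M fM]]; exact: (bounded_itv_integrable 0 (len e) (mf e) (fun t => fM _)). Qed.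

Lemma gintD f g : bmeas f -> bmeas g ->
  gint (fun x => f x + g x) = gint f + gint g.
Proof.
move=> mf mg; rewrite /gint -big_split; apply: eq_bigr => e _.
by rewrite /= -RintegralD//; exact: bmeas_edge_integrable.
Qed.

Lemma gintZ c f : bmeas f -> gint (fun x => c * f x) = c * gint f.
Proof.
move=> mf; rewrite /gint big_distrr; apply: eq_bigr => e _ /=.
by rewrite -RintegralZl//; exact: bmeas_edge_integrable.
Qed.

Lemma gintB f g : bmeas f -> bmeas g ->
  gint (fun x => f x - g x) = gint f - gint g.
Proof.
move=> mf mg; rewrite -[- gint g]mulN1r -gintZ// -gintD//; last exact: bmeasZ.
by congr gint; apply/funext => x; rewrite mulN1r.
Qed.

Lemma gint_cst c : gint (fun=> c) = c * total_len.
Proof.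
rewrite /gint /total_len big_distrr; apply: eq_bigr => e _ /=.
by rewrite Rintegral_cst// fine_lebesgue_itv// ltW// len_gt0.
Qed.

Lemma gint_sum (I : Type) (s : seq I) (F : I -> gpoint G -> R) :
  (forall i, bmeas (F i)) ->
  gint (fun x => \sum_(i <- s) F i x) = \sum_(i <- s) gint (F i).
Proof.
move=> mF; elim: s => [|i s IH].
  rewrite big_nil -[RHS](mul0r total_len) -gint_cst; congr gint.
  by apply/funext => x; rewrite big_nil.
rewrite big_cons -IH -gintD//; last exact: bmeas_sum.
by congr gint; apply/funext => x; rewrite big_cons.
Qed.

Lemma le_gint f g : bmeas f -> bmeas g -> (forall x, f x <= g x) ->
  gint f <= gint g.
Proof.
move=> mf mg fg; apply: ler_sum => e _.
apply: le_Rintegral => //; first exact: bmeas_edge_integrable.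
  exact: bmeas_edge_integrable.
by move=> t _; exact: fg.
Qed.

Lemma gint_ge0 f : bmeas f -> (forall x, 0 <= f x) -> 0 <= gint f.
Proof.
move=> mf f0; have := le_gint (bmeas_cst 0) mf f0.
by rewrite gint_cst mul0r.
Qed.

Lemma gint_le_cst f M : bmeas f -> (forall x, f x <= M) -> gint f <= M * total_len.
Proof. by move=> mf fM; rewrite -gint_cst; apply: le_gint => //; exact: bmeas_cst. Qed.

Lemma gint_norm_le f M : bmeas f -> (forall x, `|f x| <= M) ->
  `|gint f| <= M * total_len.
Proof.
move=> mf fM; rewrite ler_norml -mulNr -!gint_cst.
by apply/andP; split; apply: le_gint => //; try exact: bmeas_cst;
  move=> x; have := fM x; rewrite ler_norml => /andP[].
Qed.

Lemma bkerC K : bker K -> bker (fun x y => K y x).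
Proof.
move=> [mK [M KM]]; split; last by exists M.
by move=> e e'; exact: (measurableT_comp (mK e' e) (@measurable_swap _ _ R R)).
Qed.

Lemma bker_section K x : bker K -> bmeas (K x).
Proof.
move=> [mK [M KM]]; split; last by exists M.
move=> e; have [e' [t [_ ->]]] := on_edgeP e x.
exact: (section_measurable (mK e' e)).
Qed.

Lemma bker_section2 K y : bker K -> bmeas (fun x => K x y).
Proof. by move=> /bkerC bK; exact: (bker_section y bK). Qed.

Lemma bker_gint K : bker K -> bmeas (fun x => gint (K x)).
Proof.
move=> bK; have [mK [M KM]] := bK; split; last first.
  by exists (M * total_len) => x; apply: gint_norm_le => //; exact: bker_section.
move=> e; rewrite /edge_fun /gint; apply: measurable_sum => e'.
exact: (param_Rintegral_measurable (len e') (mK e e') (fun p => KM _ _)).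
Qed.

Lemma gint_swap K : bker K ->
  gint (fun x => gint (K x)) = gint (fun y => gint (fun x => K x y)).
Proof.
move=> bK; have [mK [M KM]] := bK.
have int_sum L (e : edge G) : bker L ->
    \int[leb]_(s in `[0, len e]) gint (L (on_edge e s)) =
    \sum_e' \int[leb]_(s in `[0, len e]) \int[leb]_(t in `[0, len e'])
      L (on_edge e s) (on_edge e' t).
  move=> bL; have [mL [N LN]] := bL.
  apply: Rintegral_itv_sum => e'.
    exact: param_Rintegral_measurable (mL e e') (fun p => LN _ _).
  exists (N * fine (leb `[0, len e']%classic)) => s.
  have LI := section_integrable (len e') (mL e e') (fun p => LN _ _) s.
  apply: le_trans (le_normr_Rintegral _ LI) _ => //.
  rewrite -Rintegral_cst//; apply: le_Rintegral => //.
    exact: integrable_norm LI.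
  by apply: (@bounded_itv_integrable _ _ _ `|N| (fun=> N)) => // ?.
have expand L : bker L -> gint (fun x => gint (L x)) =
    \sum_e \sum_e' \int[leb]_(s in `[0, len e]) \int[leb]_(t in `[0, len e'])
      L (on_edge e s) (on_edge e' t).
  by move=> bL; apply: eq_bigr => e _; exact: int_sum.
rewrite (expand K bK) (expand _ (bkerC bK)).
rewrite exchange_big; apply: eq_bigr => e _; apply: eq_bigr => e' _ /=.
exact: (@Rintegral_swap _ (fun p => K (on_edge e' p.1) (on_edge e p.2)) M (len e') (len e) (mK e' e) (fun p => KM _ _)).
Qed.

Lemma bkerD K L : bker K -> bker L -> bker (fun x y => K x y + L x y).
Proof.
move=> [mK [M KM]] [mL [N LN]]; split; last first.
  by exists (M + N) => x y; rewrite (le_trans (ler_normD _ _))// lerD.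
by move=> e e'; exact: measurable_funD.
Qed.

Lemma bkerM K L : bker K -> bker L -> bker (fun x y => K x y * L x y).
Proof.
move=> [mK [M KM]] [mL [N LN]]; split; last first.
  by exists (M * N) => x y; rewrite normrM ler_pM.
by move=> e e'; exact: measurable_funM.
Qed.

Lemma bker_tensor f g : bmeas f -> bmeas g -> bker (fun x y => f x * g y).
Proof.
move=> [mf [M fM]] [mg [N gN]]; split; last first.
  by exists (M * N) => x y; rewrite normrM ler_pM.
move=> e e'; apply: measurable_funM.
  exact: measurableT_comp (mf e) measurable_fst.
exact: measurableT_comp (mg e') measurable_snd.
Qed.

Lemma bkerZ c K : bker K -> bker (fun x y => c * K x y).
Proof.
move=> [mK [M KM]]; split; last first.
  by exists (`|c| * M) => x y; rewrite normrM ler_pM.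
by move=> e e'; apply: measurable_funM => //; exact: measurable_cst.
Qed.

Lemma bkerB K L : bker K -> bker L -> bker (fun x y => K x y - L x y).
Proof.
move=> mf mg; have := bkerD mf (bkerZ (-1) mg); congr bker.
by apply/funext => x; apply/funext => y; rewrite mulN1r.
Qed.

Definition kcomp K L x y := gint (fun z => K x z * L z y).

Lemma bker_comp K L : bker K -> bker L -> bker (kcomp K L).
Proof.
move=> bK bL; have [mK [M KM]] := bK; have [mL [N LN]] := bL.
split; last first.
  exists (M * N * total_len) => x y; apply: gint_norm_le.
    by apply: bmeasM; [exact: bker_section|exact: bker_section2].
  by move=> z; rewrite normrM ler_pM.
move=> e e'; rewrite /kcomp /gint /edge_fun; apply: measurable_sum => i.
pose f (p : (R * R) * R) := K (on_edge e p.1.1) (on_edge i p.2) *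
  L (on_edge i p.2) (on_edge e' p.1.2).
apply: (@param_Rintegral_measurable _ _ _ f (M * N)).
  apply: measurable_funM.
    apply: (measurableT_comp (mK e i) (g := fun p : (R * R) * R => (p.1.1, p.2))).
    apply: measurable_fun_pair; last exact: measurable_snd.
    exact: measurableT_comp measurable_fst measurable_fst.
  apply: (measurableT_comp (mL i e') (g := fun p : (R * R) * R => (p.2, p.1.2))).
  apply: measurable_fun_pair; first exact: measurable_snd.
  exact: measurableT_comp measurable_snd measurable_fst.
by move=> p; rewrite /f normrM ler_pM.
Qed.

End GraphIntegral.

(** * Symmetric Hilbert-Schmidt kernels *)

Section LogConvexSequences.
Context {R : realType}.

Lemma quadratic_cauchy_schwarz (a b c : R) : 0 <= c ->
  (forall t, 0 <= a - 2 * t * b + t ^+ 2 * c) -> b ^+ 2 <= a * c.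
Proof.
move=> c0 h; have [c_gt0|] := ltP 0 c; last first.
  move=> cle; have c00 : c = 0 by apply/eqP; rewrite eq_le cle c0.
  suff -> : b = 0 by rewrite c00 mulr0 expr2 mulr0.
  (* When [c = 0] the expression is affine in [t], and this [t] makes it equal to -1. *)
  apply/eqP/negP => /negP b0; have := h ((a + 1) / (2 * b)).
  rewrite c00 mulr0 addr0 (_ : 2 * _ * b = a + 1); first lra.
  by field; rewrite b0.
have := h (b / c); rewrite (_ : _ + _ = (a * c - b ^+ 2) / c); last first.
  by field; rewrite gt_eqF.
by rewrite pmulr_lge0 ?invr_gt0// subr_ge0.
Qed.

Variables (N : nat -> R).
Hypotheses (N0 : forall n, 0 < N n)
  (Nconv : forall n, N n.+1 ^+ 2 <= N n * N n.+2).

Lemma log_convex_ratio i j : (i <= j)%N -> N i.+1 / N i <= N j.+1 / N j.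
Proof.
move=> /subnKC <-; elim: (j - i)%N => [|n IH]; first by rewrite addn0.
rewrite addnS; apply: (le_trans IH).
by rewrite ler_pdivrMr// mulrAC ler_pdivlMr// mulrC [leRHS]mulrC -expr2.
Qed.

Lemma log_convex_geometric i n : N i * (N i.+1 / N i) ^+ n <= N (i + n)%N.
Proof.
elim: n => [|n IH]; first by rewrite expr0 mulr1 addn0.
rewrite exprSr mulrA addnS.
have r0 : 0 <= N i.+1 / N i by rewrite ltW// divr_gt0.
apply: (le_trans (ler_wpM2r r0 IH)).
by rewrite mulrC -ler_pdivlMr//; apply: log_convex_ratio; exact: leq_addr.
Qed.

Hypothesis Nsub : forall m n, N (m + n).+1 <= N m * N n.

(** The rate [sigma] is the supremum of the ratios [r j = N j.+1 / N j]. Convexity and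
    submultiplicativity give [N j * r j ^+ n.+1 <= N (j + n).+1 <= N j * N n], hence
    [sigma ^+ n.+1 <= N n]. If [sigma < theta], then [N n <= N 0 * sigma ^+ n] would contradict the
    geometric lower bound for large [n]. *)
Lemma submultiplicative_rate (theta : R) : 0 < theta ->
  (forall n, theta ^+ n.+1 <= N n) ->
  exists2 sigma, theta <= sigma &
    forall n, N n.+1 <= sigma * N n /\ sigma ^+ n.+1 <= N n.
Proof.
move=> theta0 thetaN.
pose r n := N n.+1 / N n.
have r0 n : 0 < r n by rewrite divr_gt0.
have rub : has_ubound (range r).
  exists (N 0%N) => _ [n _ <-]; rewrite ler_pdivrMr//.
  by have := Nsub 0 n; rewrite add0n.
have hs : has_sup (range r) by split => //; exists (r 0%N), 0%N.
pose sigma := sup (range r).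
have rs n : r n <= sigma by apply: ub_le_sup => //; exists n.
have s0 : 0 < sigma by exact: lt_le_trans (r0 0%N) (rs 0%N).
have Ns n : N n.+1 <= sigma * N n by rewrite -ler_pdivrMr//; exact: rs.
exists sigma => [|n]; last first.
  (* Taking the root of order [n.+1] first reduces the claim to [r j <= y] for each ratio, which
     passes to the supremum. *)
  split=> //; pose y := N n `^ (n.+1%:R^-1).
  have yE : y ^+ n.+1 = N n.
    by rewrite -powR_mulrn ?powR_ge0// -powRrM mulVf ?powRr1// ltW.
  rewrite -yE lerXn2r ?nnegrE ?powR_ge0 ?(ltW s0)//.
  apply: ge_sup; first by exists (r 0%N), 0%N.
  move=> _ [j _ <-]; rewrite -(@ler_pXn2r _ n.+1)// ?nnegrE ?powR_ge0 ?(ltW (r0 j))// yE.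
  rewrite -(ler_pM2l (N0 j)); apply: (le_trans (log_convex_geometric j n.+1)).
  by rewrite addnS.
rewrite leNgt; apply/negP => st.
have Nn n : N n <= N 0%N * sigma ^+ n.
  elim: n => [|n IH]; first by rewrite expr0 mulr1.
  by apply: (le_trans (Ns n)); rewrite exprS mulrCA ler_pM2l.
have q1 : `|sigma / theta| < 1.
  by rewrite ger0_norm ?divr_ge0 ?ltW// ltr_pdivrMr// mul1r.
have /cvgrPdist_lt := cvg_expr q1.
have eps0 : 0 < theta / N 0%N by rewrite divr_gt0.
move=> /(_ _ eps0)[n _ /(_ n (leqnn n))] /=.
rewrite sub0r normrN ger0_norm ?exprn_ge0 ?divr_ge0 ?ltW//.
rewrite ltr_pdivlMr// expr_div_n mulrAC ltr_pdivrMr ?exprn_gt0//.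
rewrite -exprS ltNge [_ * N 0%N]mulrC; move/negP; apply.
exact: le_trans (thetaN n) (Nn n).
Qed.

End LogConvexSequences.

Section HilbertSchmidt.
Context {R : realType} {G : metric_graph R}.
Implicit Types (f g w : gpoint G -> R) (K L M : gpoint G -> gpoint G -> R).

Definition kop K f x := gint (fun y => K x y * f y).

Lemma kop_bmeas K f : bker K -> bmeas f -> bmeas (kop K f).
Proof.
move=> bK bf; apply: (@bker_gint _ _ (fun x y => K x y * f y)).
by apply: bkerM => //; have := bker_tensor (bmeas_cst 1) bf;
  congr bker; apply/funext => x; apply/funext => y; rewrite mul1r.
Qed.

Lemma kop_integrand K f x : bker K -> bmeas f -> bmeas (fun y => K x y * f y).
Proof. by move=> bK bf; apply: bmeasM => //; exact: bker_section. Qed.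

Lemma kopZ K c f : bker K -> bmeas f ->
  kop K (fun x => c * f x) = fun x => c * kop K f x.
Proof.
move=> bK bf; apply/funext => x; rewrite /kop -gintZ; last exact: kop_integrand.
by congr gint; apply/funext => y; rewrite mulrCA.
Qed.

Lemma kopD K f g : bker K -> bmeas f -> bmeas g ->
  kop K (fun x => f x + g x) = fun x => kop K f x + kop K g x.
Proof.
move=> bK bf bg; apply/funext => x; rewrite /kop -gintD; try exact: kop_integrand.
by congr gint; apply/funext => y; rewrite mulrDr.
Qed.

Lemma kopB K f g : bker K -> bmeas f -> bmeas g ->
  kop K (fun x => f x - g x) = fun x => kop K f x - kop K g x.
Proof.
move=> bK bf bg; apply/funext => x; rewrite /kop -gintB; try exact: kop_integrand.
by congr gint; apply/funext => y; rewrite mulrBr.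
Qed.

Lemma gint_expand a b f g : bmeas f -> bmeas g ->
  gint (fun x => (a * f x + b * g x) ^+ 2) =
  a ^+ 2 * gint (fun x => f x ^+ 2) + 2 * a * b * gint (fun x => f x * g x) +
  b ^+ 2 * gint (fun x => g x ^+ 2).
Proof.
move=> bf bg; have b1 := bmeasM bf bf; have b2 := bmeasM bf bg.
have b3 := bmeasM bg bg; rewrite -gintZ// -gintZ// -gintZ//.
have c1 := bmeasZ (a ^+ 2) b1; have c2 := bmeasZ (2 * a * b) b2.
have c3 := bmeasZ (b ^+ 2) b3; rewrite -gintD// -gintD//; last exact: bmeasD.
by congr gint; apply/funext => x; ring.
Qed.

Lemma gint_cauchy_schwarz f g : bmeas f -> bmeas g ->
  gint (fun x => f x * g x) ^+ 2 <= gint (fun x => f x ^+ 2) * gint (fun x => g x ^+ 2).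
Proof.
move=> bf bg; apply: quadratic_cauchy_schwarz.
  by apply: gint_ge0 => [|x]; [exact: bmeasM|exact: sqr_ge0].
move=> t; have : 0 <= gint (fun x => (1 * f x + - t * g x) ^+ 2).
  apply: gint_ge0 => [|x]; last exact: sqr_ge0.
  by apply: bmeasM; apply: bmeasD; exact: bmeasZ.
by rewrite gint_expand//; congr (_ <= _); ring.
Qed.

Lemma kop_comp K L f x : bker K -> bker L -> bmeas f ->
  kop (kcomp K L) f x = kop K (kop L f) x.
Proof.
move=> bK bL bf; rewrite /kop /kcomp.
have bT : bker (fun y z => K x z * (L z y * f y)).
  have := bkerM (bker_tensor bf (bker_section x bK)) (bkerC bL).
  by congr bker; apply/funext => y; apply/funext => z; ring.
transitivity (gint (fun y => gint (fun z => K x z * (L z y * f y)))).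
  congr gint; apply/funext => y; rewrite mulrC -gintZ; last first.
    by apply: bmeasM; [exact: bker_section|exact: bker_section2].
  by congr gint; apply/funext => z; ring.
rewrite gint_swap//; congr gint; apply/funext => z; rewrite -gintZ//.
by apply: bmeasM => //; exact: bker_section.
Qed.

Lemma kcomp_kop K L x y : kcomp K L x y = kop K (fun z => L z y) x.
Proof. by []. Qed.

Lemma kcompA K L M : bker K -> bker L -> bker M ->
  kcomp (kcomp K L) M = kcomp K (kcomp L M).
Proof.
move=> bK bL bM; apply/funext => x; apply/funext => y.
by rewrite kcomp_kop kop_comp//; exact: bker_section2.
Qed.

Lemma kop_adjoint K f g : bker K -> bmeas f -> bmeas g ->
  (forall x y, K x y = K y x) ->
  gint (fun x => kop K f x * g x) = gint (fun x => f x * kop K g x).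
Proof.
move=> bK bf bg sK; rewrite /kop.
have bT : bker (fun x y => K x y * f y * g x).
  have := bkerM (bker_tensor bg bf) bK.
  by congr bker; apply/funext => y; apply/funext => z; ring.
transitivity (gint (fun x => gint (fun y => K x y * f y * g x))).
  congr gint; apply/funext => x; rewrite mulrC -gintZ.
    by congr gint; apply/funext => y; rewrite mulrC.
  by apply: bmeasM => //; exact: bker_section.
rewrite gint_swap//; congr gint; apply/funext => y; rewrite -gintZ.
  by congr gint; apply/funext => x; rewrite (sK x y); ring.
by apply: bmeasM => //; exact: bker_section.
Qed.

(** The Hilbert-Schmidt inner product. *)
Definition hs K L := gint (fun x => gint (fun y => K x y * L x y)).

Lemma hs_ge0 K : bker K -> 0 <= hs K K.
Proof.
move=> bK; apply: gint_ge0 => [|x]; first by apply: bker_gint; exact: bkerM.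
apply: gint_ge0 => [|y]; last by rewrite -expr2 sqr_ge0.
by apply: bmeasM; exact: bker_section.
Qed.

Lemma hs_expand a b K L : bker K -> bker L ->
  hs (fun x y => a * K x y + b * L x y) (fun x y => a * K x y + b * L x y) =
  a ^+ 2 * hs K K + 2 * a * b * hs K L + b ^+ 2 * hs L L.
Proof.
move=> bK bL.
have bKK := bkerM bK bK; have bKL := bkerM bK bL; have bLL := bkerM bL bL.
transitivity (gint (fun x => a ^+ 2 * gint (fun y => K x y * K x y) +
    2 * a * b * gint (fun y => K x y * L x y) + b ^+ 2 * gint (fun y => L x y * L x y))).
  congr gint; apply/funext => x.
  rewrite -!gintZ; try by [exact: bker_section bKK|exact: bker_section bKL|exact: bker_section bLL].
  have b1 := bmeasZ (a ^+ 2) (bker_section x bKK).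
  have b2 := bmeasZ (2 * a * b) (bker_section x bKL).
  have b3 := bmeasZ (b ^+ 2) (bker_section x bLL).
  rewrite -gintD// -gintD//; last exact: bmeasD.
  by congr gint; apply/funext => y; ring.
have b1 := bmeasZ (a ^+ 2) (bker_gint bKK).
have b2 := bmeasZ (2 * a * b) (bker_gint bKL).
have b3 := bmeasZ (b ^+ 2) (bker_gint bLL).
by rewrite gintD ?gintD ?gintZ//; [exact: bker_gint..|exact: bmeasD].
Qed.

Lemma hs_cauchy_schwarz K L : bker K -> bker L -> hs K L ^+ 2 <= hs K K * hs L L.
Proof.
move=> bK bL; apply: quadratic_cauchy_schwarz; first exact: hs_ge0.
move=> t; have := hs_ge0 (bkerD (bkerZ 1 bK) (bkerZ (- t) bL)).
rewrite (hs_expand 1 (- t) bK bL); move: (hs K K) (hs K L) (hs L L) => a b c.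
by congr (_ <= _); ring.
Qed.

Lemma kop_hs K f : bker K -> bmeas f ->
  gint (fun x => kop K f x ^+ 2) <= hs K K * gint (fun x => f x ^+ 2).
Proof.
move=> bK bf; rewrite mulrC -gintZ; last by apply: bker_gint; exact: bkerM.
have bkf := kop_bmeas bK bf.
apply: le_gint; first exact: bmeasM.
  by apply: bmeasZ; apply: bker_gint; exact: bkerM.
move=> x; rewrite mulrC; apply: gint_cauchy_schwarz => //; exact: bker_section.
Qed.

Lemma hs_kcomp K L : bker K -> bker L ->
  hs (kcomp K L) (kcomp K L) <= hs K K * hs L L.
Proof.
move=> bK bL.
have bKL := bker_comp bK bL.
have -> : hs L L = gint (fun y => gint (fun z => L z y ^+ 2)).
  by rewrite /hs gint_swap//; exact: bkerM.
rewrite mulrC -gintZ; last by apply: bker_gint; exact: bkerM.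
apply: le_gint; first by apply: bker_gint; exact: bkerM.
  by apply: bmeasZ; apply: bker_gint; exact: bkerM.
move=> x; rewrite mulrC -gintZ; last first.
  by apply: (@bker_gint _ _ (fun y z => L z y * L z y)); apply: bkerC; exact: bkerM.
apply: le_gint.
- by apply: bmeasM; exact: bker_section.
- apply: bmeasZ; apply: (@bker_gint _ _ (fun y z => L z y * L z y)).
  by apply: bkerC; exact: bkerM.
- move=> y; rewrite -expr2; apply: gint_cauchy_schwarz.
    exact: bker_section.
  exact: bker_section2.
Qed.

Section Iterates.
Variable K : gpoint G -> gpoint G -> R.
Hypotheses (bK : bker K) (sK : forall x y, K x y = K y x).

(* Off by one: kiter n is the kernel of the (n+1)-st power of kop K. *)
Fixpoint kiter n := if n is m.+1 then kcomp K (kiter m) else K.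

Lemma bker_iter n : bker (kiter n).
Proof. by elim: n => //= n IH; exact: bker_comp. Qed.

Lemma kiterD m n : kcomp (kiter m) (kiter n) = kiter (m + n).+1.
Proof.
elim: m => [|m IH]; first by [].
have -> : kiter m.+1 = kcomp K (kiter m) by [].
by rewrite kcompA ?IH; [|exact: bK|exact: bker_iter..].
Qed.

Lemma kiter_sym n x y : kiter n x y = kiter n y x.
Proof.
elim: n x y => [|n IH] x y //.
have E : kcomp (kiter n) K = kcomp K (kiter n) by rewrite (kiterD n 0) addn0.
rewrite /= -{2}E /kcomp; congr gint; apply/funext => z.
by rewrite (IH y z) (sK z x) mulrC.
Qed.

(** By symmetry the inner product is the trace of a composition and depends on [m + n] alone.
    Log-convexity of the norms, and later the Cauchy property of the normalized powers, come from
    this. *)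
Lemma hs_iter m n : hs (kiter m) (kiter n) = gint (fun x => kiter (m + n).+1 x x).
Proof.
congr gint; apply/funext => x; rewrite -kiterD /kcomp; congr gint.
by apply/funext => y; rewrite (kiter_sym n x y).
Qed.

End Iterates.
End HilbertSchmidt.

Lemma uniform_cauchy_limit {R : realType} (T : Type) (u : nat -> T -> R) :
  (forall eps, 0 < eps -> exists n0, forall i j, (n0 <= i)%N -> (n0 <= j)%N ->
    forall x, `|u i x - u j x| <= eps) ->
  exists P : T -> R, forall eps, 0 < eps -> exists n0, forall n, (n0 <= n)%N ->
    forall x, `|u n x - P x| <= eps.
Proof.
move=> cu.
have cvgu x : cvg (u n x @[n --> \oo]).
  apply/cauchy_cvgP/cauchy_exP => eps eps0.
  have e20 : 0 < eps / 2 by rewrite divr_gt0.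
  have [n0 hn0] := cu _ e20; exists (u n0 x); exists n0 => // n /= n0n.
  rewrite /ball/=; apply: le_lt_trans (hn0 n0 n (leqnn _) n0n x) _.
  by rewrite ltr_pdivrMr// ltr_pMr// ltr1n.
exists (fun x => lim (u n x @[n --> \oo])) => eps eps0.
have [n0 hn0] := cu _ eps0; exists n0 => n n0n x.
apply: (@cvgr_to_le _ \oo _ R (fun m => `|u n x - u m x|)).
  by apply: cvg_norm; apply: cvgB; [exact: cvg_cst|exact: cvgu].
by exists n0 => // m /= n0m; exact: hn0.
Qed.

(** * Schmidt's bound: a symmetric kernel without large eigenvalues has small norm *)

Section SchmidtTheorem.
Context {R : realType} {G : metric_graph R}.
Implicit Types (f g w : gpoint G -> R).
Variable K : gpoint G -> gpoint G -> R.
Hypotheses (bK : bker K) (sK : forall x y, K x y = K y x).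

Let Kn n := kiter K n.
Let NN n := hs (Kn n) (Kn n).
Let tr n := gint (fun x => Kn n x x).

Let bKn n : bker (Kn n). Proof. exact: bker_iter. Qed.

Let hsE m n : hs (Kn m) (Kn n) = tr (m + n).+1.
Proof. exact: hs_iter. Qed.

Lemma hs_iter_log_convex n : NN n.+1 ^+ 2 <= NN n * NN n.+2.
Proof.
apply: le_trans (hs_cauchy_schwarz (bKn n) (bKn n.+2)).
by rewrite /NN !hsE !addnS addSn.
Qed.

Lemma hs_iter_submultiplicative m n : NN (m + n).+1 <= NN m * NN n.
Proof. by rewrite /NN /Kn -kiterD//; apply: hs_kcomp; exact: bKn. Qed.

(* With NN n = ||K^(n+1)||^2 in Hilbert-Schmidt norm and sigma the growth rate of
   NN, the normalized even powers K^(2i+2) / sigma^(i+1) converge uniformly to a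
   nonzero kernel whose sections are fixed by K^2 / sigma. *)
Section TopEigenvalue.
Variables (sigma : R).
Hypotheses (s0 : 0 < sigma) (NN_le : forall n, NN n.+1 <= sigma * NN n)
  (NN_ge : forall n, sigma ^+ n.+1 <= NN n).

Let b n := NN n / sigma ^+ n.+1.

Let b_le n : b n.+1 <= b n.
Proof.
rewrite /b ler_pdivrMr ?exprn_gt0//.
by rewrite (exprS _ n.+1) [sigma * _]mulrC mulrA divfK ?gt_eqF ?exprn_gt0// mulrC.
Qed.

Let b_ge1 n : 1 <= b n.
Proof. by rewrite ler_pdivlMr ?exprn_gt0// mul1r. Qed.

Let b_mono m n : (m <= n)%N -> b n <= b m.
Proof.
move/subnKC <-; elim: (n - m)%N => [|k IH]; first by rewrite addn0.
by rewrite addnS; apply: le_trans IH.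
Qed.

(** Only even powers occur, since both square roots of [sigma] may be eigenvalues of [K] and odd
    powers would then carry both signs. *)
Let E i x y := Kn i.*2.+1 x y / sigma ^+ i.+1.

Let bE i : bker (E i).
Proof.
by have := bkerZ (sigma ^+ i.+1)^-1 (bKn i.*2.+1); congr bker;
  apply/funext => x; apply/funext => y; rewrite mulrC.
Qed.

Let hsEE i j : hs (E i) (E j) = b (i + j).+1.
Proof.
have bKK := bkerM (bKn i.*2.+1) (bKn j.*2.+1).
transitivity ((sigma ^+ i.+1 * sigma ^+ j.+1)^-1 * hs (Kn i.*2.+1) (Kn j.*2.+1)).
  rewrite /hs -gintZ; last exact: bker_gint.
  congr gint; apply/funext => x; rewrite -gintZ; last exact: bker_section bKK.
  by congr gint; apply/funext => y; rewrite /E invfM; ring.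
have E1 : (i.*2.+1 + j.*2.+1 = (i + j).+1 + (i + j).+1)%N by rewrite -!addnn; lia.
by rewrite hsE E1 -hsE -exprD addSn addnS mulrC.
Qed.

(** The squared distance expands to [b (i + i).+1 - 2 * b (i + j).+1 + b (j + j).+1], and [b] is
    nonincreasing and bounded below by 1, so all three values are eventually close to its
    infimum. *)
Lemma top_cauchy eta : 0 < eta -> exists n0, forall i j, (n0 <= i)%N -> (n0 <= j)%N ->
  hs (fun x y => E i x y - E j x y) (fun x y => E i x y - E j x y) <= eta.
Proof.
move=> eta0.
have hb : has_inf (range b).
  by split; [exists (b 0%N), 0%N|exists 1 => _ [n _ <-]].
have [_ [n0 _ <-] hn0] : exists2 y, range b y & y < inf (range b) + eta / 2.
  by apply: inf_adherent => //; rewrite divr_gt0.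
have infb n : inf (range b) <= b n by apply: ge_inf; [case: hb|exists n].
exists n0 => i j ni nj.
have -> : (fun x y => E i x y - E j x y) = (fun x y => 1 * E i x y + (-1) * E j x y).
  by apply/funext => x; apply/funext => y; ring.
rewrite hs_expand// !hsEE.
have h1 : b (i + i).+1 <= b n0 by apply: b_mono; lia.
have h2 : b (j + j).+1 <= b n0 by apply: b_mono; lia.
have h3 := infb (i + j).+1.
by move: hn0 h1 h2 h3; lra.
Qed.

Let step x y i : sigma * E i.+1 x y = kcomp K (kcomp (E i) K) x y.
Proof.
have {1}-> : E i = (fun x y => (sigma ^+ i.+1)^-1 * Kn i.*2.+1 x y).
  by apply/funext => u; apply/funext => v; rewrite mulrC.
transitivity ((sigma ^+ i.+1)^-1 * kcomp K (kcomp (Kn i.*2.+1) K) x y).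
  have -> : kcomp (Kn i.*2.+1) K = Kn i.*2.+2.
    by rewrite /Kn (kiterD bK _ 0) addn0.
  rewrite /E doubleS exprS invfM mulrA mulrACA divff ?gt_eqF// mul1r mulrC.
  by congr (_ * _).
rewrite /kcomp -gintZ; last first.
  apply: bmeasM; first exact: bker_section.
  by have := bker_section2 y (bker_comp (bKn i.*2.+1) bK).
congr gint; apply/funext => z; rewrite mulrCA; congr (_ * _).
rewrite -gintZ; last by apply: bmeasM; [exact: bker_section|exact: bker_section2].
by congr gint; apply/funext => u; ring.
Qed.

Let cK : exists2 c, 0 < c & forall x, gint (fun y => K x y ^+ 2) <= c.
Proof.
have [_ [M KM]] := bK; exists (M ^+ 2 * total_len (G := G) + 1).
  by rewrite ltr_wpDl// mulr_ge0 ?sqr_ge0// total_len_ge0.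
move=> x; rewrite (@le_trans _ _ (M ^+ 2 * total_len (G := G)))// ?lerDl//.
apply: gint_le_cst => [|y]; first by apply: bmeasM; exact: bker_section.
by rewrite -real_normK ?num_real// lerXn2r ?nnegrE// (le_trans _ (KM x y)).
Qed.

(** Cauchy-Schwarz on either side, using that the sections of [K] have bounded norm. Since
    [sigma * E i.+1] is [E i] composed with [K] on both sides, Hilbert-Schmidt convergence of [E]
    becomes uniform convergence. *)
Lemma kcomp_bound : exists2 c, 0 < c & forall D x y, bker D ->
  kcomp K (kcomp D K) x y ^+ 2 <= c ^+ 2 * hs D D.
Proof.
have [c c0 Kc] := cK; exists c => // D x y bD.
have bDK := bker_comp bD bK; have bDD := bker_gint (bkerM bD bD).
apply: (@le_trans _ _ (c * gint (fun z => kcomp D K z y ^+ 2))).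
  apply: le_trans (gint_cauchy_schwarz (bker_section x bK) (bker_section2 y bDK)) _.
  apply: ler_wpM2r; last exact: Kc.
  by apply: gint_ge0 => [|z]; [apply: bmeasM; exact: bker_section2|exact: sqr_ge0].
rewrite expr2 -mulrA ler_pM2l// /hs -gintZ//.
apply: le_gint; [by apply: bmeasM; exact: bker_section2|exact: bmeasZ|].
move=> z; apply: le_trans (gint_cauchy_schwarz (bker_section z bD) (bker_section2 y bK)) _.
rewrite mulrC; apply: ler_wpM2r.
  by apply: gint_ge0 => [|u]; [apply: bmeasM; exact: bker_section|exact: sqr_ge0].
by rewrite (_ : (fun _ => _) = fun u => K y u ^+ 2)//; apply/funext => u; rewrite sK.
Qed.

Lemma top_limit : exists P, [/\ bker P,
  (forall eps, 0 < eps -> exists n0, forall n, (n0 <= n)%N -> forall x y,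
    `|E n.+1 x y - P x y| <= eps) & exists x y, P x y != 0].
Proof.
have [c c0 hc] := kcomp_bound.
have [|P hP] := @uniform_cauchy_limit R (gpoint G * gpoint G)%type
    (fun n p => E n.+1 p.1 p.2).
  move=> eps eps0.
  have eta0 : 0 < (sigma * eps / c) ^+ 2 by rewrite exprn_gt0// divr_gt0// mulr_gt0.
  have [n0 hn0] := top_cauchy eta0; exists n0 => i j ni nj [x y] /=.
  have bD := bkerB (bE i) (bE j).
  have := hc _ x y bD; have -> : kcomp K (kcomp (fun x y => E i x y - E j x y) K) x y =
      sigma * (E i.+1 x y - E j.+1 x y).
    rewrite mulrBr !step /kcomp -gintB; last 2 first.
    - by apply: bmeasM; [exact: bker_section|exact: (bker_section2 y (bker_comp (bE i) bK))].
    - by apply: bmeasM; [exact: bker_section|exact: (bker_section2 y (bker_comp (bE j) bK))].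
    congr gint; apply/funext => z; rewrite -mulrBr; congr (_ * _).
    rewrite -gintB; try by apply: bmeasM; [exact: bker_section|exact: bker_section2].
    by congr gint; apply/funext => u; rewrite mulrBl.
  move=> h; have {}h := le_trans h (ler_wpM2l (sqr_ge0 c) (hn0 i j ni nj)).
  have {}h : `|sigma * (E i.+1 x y - E j.+1 x y)| ^+ 2 <= (sigma * eps) ^+ 2.
    rewrite real_normK ?num_real//; apply: le_trans h _.
    by rewrite -exprMn mulrCA divff ?gt_eqF// mulr1.
  have : `|sigma * (E i.+1 x y - E j.+1 x y)| <= sigma * eps.
    by rewrite -(@ler_pXn2r _ 2)// ?nnegrE// mulr_ge0// ltW.
  by rewrite normrM gtr0_norm// ler_pM2l.
exists (fun x y => P (x, y)); split.
- split; last first.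
    have [n0 hn0] := hP _ ltr01; have [_ [M EM]] := bE n0.+1.
    exists (1 + M) => x y; have := hn0 n0 (leqnn _) (x, y); have := EM x y => /=.
    rewrite !ler_norml => /andP[? ?] /andP[? ?]; apply/andP; split; lra.
  move=> e e'; apply: (@measurable_fun_cvg _ _ _ _
      (fun n p => E n.+1 (on_edge e p.1) (on_edge e' p.2))).
    by move=> n; have [mE _] := bE n.+1; exact: mE.
  move=> p _; apply/cvgrPdist_le => eps eps0; have [n0 hn0] := hP _ eps0.
  by exists n0 => // n /= n0n; rewrite distrC; exact: (hn0 n n0n (_, _)).
- move=> eps eps0; have [n0 hn0] := hP _ eps0.
  by exists n0 => n n0n x y; exact: (hn0 n n0n (x, y)).
- apply: contrapT => hN.
  have P0 x y : P (x, y) = 0.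
    by apply: contrapT => /eqP Pxy; apply: hN; exists x, y.
  have L0 := total_len_ge0 (G := G).
  (* If the limit were 0, some [E n] would be bounded by [1 / (2 * L)], and its squared
     Hilbert-Schmidt norm would be less than 1, against [b_ge1]. The summand 1 keeps [L] positive
     when the total length is 0. *)
  pose L := total_len (G := G) + 1; have Lp : 0 < L by rewrite ltr_wpDl.
  have L10 : 0 < (2 * L)^-1 by rewrite invr_gt0 mulr_gt0.
  have [n0 hn0] := hP _ L10; pose n := n0.+1.
  have EE x y : E n x y * E n x y <= ((2 * L)^-1) ^+ 2.
    have := hn0 n0 (leqnn _) (x, y); rewrite P0 subr0 /= => h.
    by rewrite -expr2 -[leLHS]real_normK ?num_real// lerXn2r// nnegrE ltW.
  have := b_ge1 (n + n).+1; rewrite -hsEE leNgt => /negP; apply.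
  apply: (@le_lt_trans _ _ (((2 * L)^-1) ^+ 2 * total_len (G := G) * total_len (G := G))).
    have bEE := bkerM (bE n) (bE n).
    apply: gint_le_cst => [|x]; first exact: bker_gint.
    by apply: gint_le_cst => [|y]; [exact: (bker_section x bEE)|exact: EE].
  rewrite -mulrA -expr2 exprVn mulrC ltr_pdivrMr ?exprn_gt0 ?mulr_gt0// mul1r.
  by rewrite ltrXn2r// /L; lra.
Qed.

(** The function is the section of the limit kernel at a [y0] where it does not vanish identically.
    The relation between [g n] and [g n.+1] under the square of the operator passes to the uniform
    limit. *)
Lemma top_eigenvector : exists f, [/\ bmeas f, (exists x, f x != 0) &
  forall x, kop K (kop K f) x = sigma * f x].
Proof.
have [P [bP hP [x0 [y0 Pxy]]]] := top_limit.
have bf := bker_section2 y0 bP.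
exists (fun x => P x y0); split => //; first by exists x0.
move=> x; have [_ [M KM]] := bK.
have L0 := total_len_ge0 (G := G); have M0 : 0 <= M := le_trans (normr_ge0 _) (KM x x).
have kop_bound f eps' : bmeas f -> (forall z, `|f z| <= eps') ->
    forall z, `|kop K f z| <= M * eps' * total_len (G := G).
  move=> bf' fe z; apply: gint_norm_le.
    by apply: bmeasM => //; exact: bker_section.
  by move=> u; rewrite normrM ler_pM.
(* The two errors, the operator applied twice to [d] and [sigma] times the error of the next
   iterate, add up to [eps] when each of the approximations is within [eps / C]. *)
pose C := M * (M * total_len (G := G)) * total_len (G := G) + sigma.
have C0 : 0 < C by rewrite ltr_wpDl// !mulr_ge0.
apply/eqP; rewrite -subr_eq0 -normr_le0; apply/ler_addgt0Pr => eps eps0; rewrite add0r.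
have [n0 hn0] := hP _ (divr_gt0 eps0 C0).
pose g n z := E n.+1 z y0; have bg n : bmeas (g n) by exact: bker_section2.
have gE n z : kop K (kop K (g n)) z = sigma * g n.+1 z.
  have -> : g n = fun u => (sigma ^+ n.+2)^-1 * Kn n.+1.*2.+1 u y0.
    by apply/funext => u; rewrite /g /E mulrC.
  have bk m : bmeas (fun u => Kn m u y0) by exact: bker_section2.
  rewrite kopZ ?kopZ//; last exact: kop_bmeas.
  rewrite /g /E (exprS _ n.+2).
  have -> : Kn n.+2.*2.+1 z y0 = kop K (kop K (fun u => Kn n.+1.*2.+1 u y0)) z.
    by rewrite doubleS.
  have : sigma ^+ n.+2 != 0 by rewrite gt_eqF ?exprn_gt0.
  move: (sigma ^+ n.+2) (kop _ _ _) => p k p0.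
  by field; rewrite p0 gt_eqF.
pose d z := P z y0 - g n0 z.
have bd : bmeas d by exact: bmeasB.
have dE z : `|d z| <= eps / C by rewrite distrC; exact: hn0.
have -> : kop K (kop K (P^~ y0)) x - sigma * P x y0 =
    kop K (kop K d) x + sigma * (g n0.+1 x - P x y0).
  rewrite mulrBr -gE addrA; congr (_ - _).
  by rewrite !kopB ?subrK//; exact: kop_bmeas.
rewrite (le_trans (ler_normD _ _))//.
have epsE : eps = M * (M * (eps / C) * total_len (G := G)) * total_len (G := G) + sigma * (eps / C).
  have : C != 0 by rewrite gt_eqF.
  by rewrite /C => C0'; field.
rewrite [leRHS]epsE; apply: lerD.
  by apply: (kop_bound _ _ (kop_bmeas bK bd)); exact: kop_bound.
by rewrite normrM gtr0_norm// ler_pM2l//; apply: hn0; exact: leqnSn.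
Qed.

End TopEigenvalue.

(** If the bound fails for [w], the ratio [theta] of the squared norms of [kop K w] and [w] exceeds
    [eps ^+ 2]. The squared norms [e n] of the iterates of [w] are log-convex, so they grow at least
    like [theta ^+ n]; hence so do the norms of the iterated kernels, and the square of the operator
    has an eigenvalue [sigma >= theta]. *)
Theorem schmidt_bound (eps : R) : 0 <= eps ->
  (forall alpha f, bmeas f -> eps < `|alpha| ->
    (forall x, kop K f x = alpha * f x) -> forall x, f x = 0) ->
  forall w, bmeas w ->
    gint (fun x => kop K w x ^+ 2) <= eps ^+ 2 * gint (fun x => w x ^+ 2).
Proof.
move=> eps0 noeig w bw; rewrite leNgt; apply/negP => hw.
pose A n := iter n (kop K) w.
have bA n : bmeas (A n) by elim: n => //= n IH; exact: kop_bmeas.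
pose e n := gint (fun x => A n x ^+ 2).
have AE n : A n.+1 = kop (Kn n) w.
  elim: n => [//|n IH]; have -> : A n.+2 = kop K (A n.+1) by [].
  rewrite IH.
  by apply/funext => x; rewrite -kop_comp.
have e_le n : e n.+1 <= NN n * e 0%N.
  by rewrite /e AE; exact: kop_hs.
have e_ge0 n : 0 <= e n.
  by apply: gint_ge0 => [|x]; [exact: bmeasM|exact: sqr_ge0].
have e1 : 0 < e 1%N by apply: le_lt_trans hw; rewrite mulr_ge0// ?sqr_ge0// (e_ge0 0%N).
have e0 : 0 < e 0%N.
  rewrite lt_neqAle e_ge0 andbT; apply/eqP => e00.
  by have := e_le 0%N; rewrite -e00 mulr0 leNgt e1.
have econv n : e n.+1 ^+ 2 <= e n * e n.+2.
  apply: le_trans (gint_cauchy_schwarz (bA n) (bA n.+2)).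
  rewrite -(@kop_adjoint _ _ K (A n) (A n.+1))//.
have epos n : 0 < e n /\ 0 < e n.+1.
  elim: n => [|n [h1 h2]]; split; [exact: e0|exact: e1|exact: h2|].
  have : 0 < e n * e n.+2 by apply: lt_le_trans (econv n); rewrite exprn_gt0.
  by rewrite pmulr_rgt0.
pose theta := e 1%N / e 0%N.
have theta0 : 0 < theta by rewrite divr_gt0.
have theta_eps : eps ^+ 2 < theta by rewrite ltr_pdivlMr.
have NNge n : theta ^+ n.+1 <= NN n.
  have := log_convex_geometric (fun n => (epos n).1) econv 0 n.+1.
  rewrite add0n mulrC => h; rewrite -(ler_pM2r e0); exact: le_trans h (e_le n).
have NN0 n : 0 < NN n by apply: lt_le_trans (NNge n); rewrite exprn_gt0.
have [sigma ts hs'] := submultiplicative_rate NN0 hs_iter_log_convex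
  hs_iter_submultiplicative theta0 NNge.
have s0 : 0 < sigma by exact: lt_le_trans ts.
have [f [bf [x0 fx0] fE]] := top_eigenvector s0 (fun n => (hs' n).1) (fun n => (hs' n).2).
pose rho := Num.sqrt sigma.
have rho2 : rho ^+ 2 = sigma by rewrite sqr_sqrtr// ltW.
have rho0 : 0 <= rho by exact: sqrtr_ge0.
have rho_eps : eps < rho.
  by rewrite -(@ltr_pXn2r _ 2)// ?nnegrE// rho2 (lt_le_trans theta_eps).
have bkf := kop_bmeas bK bf.
(* With [sigma = rho ^+ 2] the eigenvalue equation factors as [(K - rho) (K + rho) f = 0]: either
   [(K + rho) f] is an eigenfunction for [rho], or [f] is one for [- rho]. *)
have g0 : forall x, kop K f x + rho * f x = 0.
  apply: (noeig rho).
  - by apply: bmeasD => //; exact: bmeasZ.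
  - by rewrite ger0_norm.
  - move=> x; rewrite kopD//; last exact: bmeasZ.
    by rewrite kopZ// fE -rho2; ring.
move/eqP: fx0; apply; apply: (noeig (- rho)) => //.
  by rewrite normrN ger0_norm.
by move=> x; have := g0 x; move/eqP; rewrite addr_eq0 => /eqP ->; rewrite mulNr.
Qed.

End SchmidtTheorem.

(** * The Green function *)

Section GraphLaplacian.
Context {R : realType} {G : metric_graph R}.
Implicit Types (f g : vertex G -> R).

Definition edge_diff f (e : edge G) : R := f (tgt e) - f (src e).

Definition incidence (e : edge G) (v : vertex G) : R :=
  (v == tgt e)%:R - (v == src e)%:R.

Lemma sum_delta (F : vertex G -> R) a : \sum_v (v == a)%:R * F v = F a.
Proof.
rewrite (bigD1 a)//= eqxx mul1r big1 ?addr0// => v /negbTE->.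
by rewrite mul0r.
Qed.

Lemma sum_incidence f e : \sum_v incidence e v * f v = edge_diff f e.
Proof.
under eq_bigr do rewrite /incidence mulrBl.
by rewrite sumrB !sum_delta.
Qed.

(** Factorization through the signed incidence matrix; symmetry and the Dirichlet form are read off
    from it. *)
Lemma weighted_laplacianE (v w : vertex G) :
  weighted_laplacian v w = \sum_e incidence e v * incidence e w / len e.
Proof.
rewrite /weighted_laplacian; case: eqVneq => [<-|vw].
  rewrite big_mkcond; apply: eq_bigr => e _; rewrite /incidence !inE.
  have /negbTE st := no_loop e.
  case: (eqVneq v (src e)) => [->|vs].
    by rewrite st /= sub0r mulrNN !mul1r.
  by case: (eqVneq v (tgt e)) => vt /=; rewrite subr0 ?mul0r// !mul1r.
rewrite -sumrN big_mkcond; apply: eq_bigr => e _; rewrite /incidence.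
have st := no_loop e; have e0 : len e != 0 by rewrite gt_eqF ?len_gt0.
case: ifPn => [/eqP ee|ne].
  have : v \in ends e by rewrite ee !inE eqxx.
  have : w \in ends e by rewrite ee !inE eqxx orbT.
  rewrite !inE => /orP[] /eqP wE /orP[] /eqP vE.
  - by move: vw; rewrite vE wE eqxx.
  - by rewrite vE wE !eqxx (negbTE st) eq_sym (negbTE st) /= subr0 sub0r mul1r mulN1r.
  - by rewrite vE wE !eqxx (negbTE st) eq_sym (negbTE st) /= subr0 sub0r mulr1 mulN1r.
  - by move: vw; rewrite vE wE eqxx.
case: (eqVneq v (src e)) => [vE|vs]; case: (eqVneq w (tgt e)) => [wE|wt];
  case: (eqVneq v (tgt e)) => [vE'|vt]; case: (eqVneq w (src e)) => [wE'|ws];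
  rewrite ?(subrr, mul0r, mulr0, subr0)//.
all: try by move: vw; rewrite ?vE ?wE ?vE' ?wE' ?eqxx.
all: try by move: st; rewrite -?vE -?wE -?vE' -?wE' ?eqxx.
all: try by move: ne; rewrite /ends ?vE ?wE ?vE' ?wE' ?eqxx.
by move: ne; rewrite /ends vE' wE' finset.setUC eqxx.
Qed.

Lemma laplacian_sum f v : \sum_w weighted_laplacian v w * f w =
  \sum_e incidence e v * edge_diff f e / len e.
Proof.
under eq_bigr do rewrite weighted_laplacianE big_distrl.
rewrite exchange_big; apply: eq_bigr => e _ /=.
rewrite -sum_incidence big_distrr/= big_distrl; apply: eq_bigr => w _ /=; ring.
Qed.

Lemma laplacian_form f g : \sum_v g v * (\sum_w weighted_laplacian v w * f w) =
  \sum_e edge_diff g e * edge_diff f e / len e.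
Proof.
under eq_bigr do rewrite laplacian_sum big_distrr.
rewrite exchange_big; apply: eq_bigr => e _ /=.
rewrite -(sum_incidence g) !mulr_suml; apply: eq_bigr => v _; ring.
Qed.

Lemma connected_const f : (forall e, edge_diff f e = 0) -> forall v w, f v = f w.
Proof.
move=> f0 v w; have /connectP[p + ->] := graph_connected v w.
elim: p v => //= a p IH v /andP[/existsP[e /eqP ea] /IH <-].
have fe : f (tgt e) = f (src e) by apply/eqP; rewrite -subr_eq0; apply/eqP; exact: f0.
have : v \in [set src e; tgt e]%SET by rewrite ea !inE eqxx.
have : a \in [set src e; tgt e]%SET by rewrite ea !inE eqxx orbT.
by rewrite !inE => /orP[] /eqP-> /orP[] /eqP->.
Qed.

Variable u0 : vertex G.

Definition green_mx (v w : vertex G) : R :=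
  invmx (laplacian_A u0) (enum_rank v) (enum_rank w).

(** On a vector of the kernel the quadratic form is the Dirichlet energy plus [f u0 ^+ 2]. Both
    vanish, so [f] is constant by connectedness and 0 at [u0]. *)
Lemma laplacian_A_unit : laplacian_A u0 \in unitmx.
Proof.
rewrite -row_free_unit -kermx_eq0; apply/rowV0P => x /sub_kermxP xA.
pose f v := x ord0 (enum_rank v).
have fA v : \sum_w weighted_laplacian v w * f w + (v == u0)%:R * f u0 = 0.
  have := congr1 (fun y : 'rV_ _ => y ord0 (enum_rank v)) xA.
  rewrite !mxE => E; rewrite -[RHS]E.
  rewrite (reindex_onto (@enum_rank _) (@enum_val _ _))/=; last by move=> *; rewrite enum_valK.
  under [RHS]eq_bigl do rewrite enum_rankK eqxx.
  under [RHS]eq_bigr do rewrite !mxE !enum_rankK mulrDr.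
  rewrite big_split/=; congr (_ + _).
    apply: eq_bigr => w _; rewrite mulrC !weighted_laplacianE; congr (_ * _).
    by apply: eq_bigr => e _; rewrite [incidence e v * _]mulrC.
  rewrite (bigD1 u0)//= eqxx /= mulrC big1 ?addr0// => w /negbTE->.
  by rewrite mulr0.
have sum0 : \sum_e edge_diff f e ^+ 2 / len e + f u0 ^+ 2 = 0.
  transitivity (\sum_v f v * (\sum_w weighted_laplacian v w * f w + (v == u0)%:R * f u0)).
    under [RHS]eq_bigr do rewrite mulrDr.
    rewrite big_split/= laplacian_form; congr (_ + _).
    by under eq_bigr do rewrite mulrCA; rewrite sum_delta.
  by rewrite big1// => v _; rewrite fA mulr0.
have ge0 e : 0 <= edge_diff f e ^+ 2 / len e.
  by rewrite divr_ge0 ?sqr_ge0// ltW// len_gt0.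
move/eqP: sum0; rewrite paddr_eq0 ?sumr_ge0 ?sqr_ge0// sqrf_eq0 => /andP[df0 /eqP fu0].
have {}df0 e : edge_diff f e = 0.
  move: df0; rewrite psumr_eq0// => /allP/(_ e (mem_index_enum _)) /=.
  by rewrite mulf_eq0 sqrf_eq0 invr_eq0 (gt_eqF (len_gt0 e)) orbF => /eqP.
apply/rowP => i; rewrite mxE -(enum_valK i) -/(f _).
by rewrite (connected_const df0 _ u0).
Qed.

Lemma green_mx_sym v w : green_mx v w = green_mx w v.
Proof.
rewrite /green_mx -[in RHS](trmxK (invmx _)) mxE trmx_inv; congr (invmx _ _ _).
apply/matrixP => i j; rewrite !mxE !weighted_laplacianE andbC; congr (_ + _).
by apply: eq_bigr => e _; rewrite [incidence e _ * _]mulrC.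
Qed.

Lemma green_mxP v u : \sum_w weighted_laplacian v w * green_mx w u =
  (v == u)%:R - (v == u0)%:R * green_mx u0 u.
Proof.
have := mulmxV laplacian_A_unit => /matrixP/(_ (enum_rank v) (enum_rank u)).
rewrite !mxE (inj_eq enum_rank_inj) => <-; apply/eqP; rewrite eq_sym subr_eq.
rewrite (reindex_onto (@enum_rank _) (@enum_val _ _))/=; last by move=> *; rewrite enum_valK.
under eq_bigl do rewrite enum_rankK eqxx.
under eq_bigr do rewrite !mxE !enum_rankK mulrDl.
rewrite big_split/=; apply/eqP; congr (_ + _).
rewrite (bigD1 u0)//= eqxx andbT big1 ?addr0// => w /negbTE->.
by rewrite andbF mul0r.
Qed.

(** Summing the equation of [green_mxP] over all vertices: the Laplacian annihilates constants, so
    only the two point masses remain. *)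
Lemma green_mx_u0 v : green_mx u0 v = 1.
Proof.
have h : \sum_u (1 : R) * (\sum_w weighted_laplacian u w * green_mx w v) = 0.
  rewrite (laplacian_form (fun w => green_mx w v) (fun=> 1)) big1// => e _.
  by rewrite /edge_diff subrr !mul0r.
move: h; under eq_bigr do rewrite mul1r green_mxP -[(_ == v)%:R]mulr1.
by rewrite sumrB !sum_delta => /eqP; rewrite subr_eq0 => /eqP.
Qed.

Definition hat (u : vertex G) (x : gpoint G) : R :=
  match x with
  | Vertex v => (u == v)%:R
  | Inner e t => (1 - val t / len e) * (u == src e)%:R + val t / len e * (u == tgt e)%:R
  end.

Lemma hat_on_edge u e t : 0 <= t <= len e ->
  hat u (on_edge e t) = (1 - t / len e) * (u == src e)%:R + t / len e * (u == tgt e)%:R.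
Proof.
move=> /andP[]; rewrite le_eqVlt => /predU1P[<-|t0].
  by rewrite on_edge0 /= mul0r subr0 mul1r mul0r addr0.
rewrite le_eqVlt => /predU1P[->|tl].
  by rewrite on_edgel /= divff ?gt_eqF ?len_gt0// subrr mul0r mul1r add0r.
have tt : 0 < t < len e by rewrite t0 tl.
by rewrite -[t]/(val (exist (fun t => is_true (0 < t < len e)) t tt)) on_edge_inner.
Qed.

Definition interp (f : vertex G -> R) (x : gpoint G) : R := \sum_u hat u x * f u.

Lemma interp_on_edge f e t : 0 <= t <= len e ->
  interp f (on_edge e t) = (1 - t / len e) * f (src e) + t / len e * f (tgt e).
Proof.
move=> tl; rewrite /interp.
have E u : hat u (on_edge e t) * f u = (1 - t / len e) * ((u == src e)%:R * f u) +
    t / len e * ((u == tgt e)%:R * f u) by rewrite hat_on_edge//; ring.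
under eq_bigr do rewrite E.
by rewrite big_split/= -!mulr_sumr !sum_delta.
Qed.

Lemma interp_vertex f v : interp f (Vertex v) = f v.
Proof. exact: sum_delta. Qed.

Lemma interp_cst c x : interp (fun=> c) x = c.
Proof.
case: x => [v|e t]; first exact: interp_vertex.
rewrite -on_edge_inner interp_on_edge; first by rewrite -mulrDl subrK mul1r.
by have /andP[/ltW-> /ltW->] := valP t.
Qed.

(* The junk value 0 off the edge e and at its ends makes tent vanish there. *)
Definition pos (x : gpoint G) (e : edge G) : R :=
  if x is Inner e' t then if e' == e then val t else 0 else 0.

Lemma pos_itv x e : 0 <= pos x e <= len e.
Proof.
case: x => [v|e' t] /=; first by rewrite lexx ltW// len_gt0.
case: eqVneq => [<-|_]; last by rewrite lexx ltW// len_gt0.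
by have /andP[/ltW-> /ltW->] := valP t.
Qed.

(** The covariance of the Brownian bridge, which is also the Green function of [-f''] on [[0, l]]
    with zero values at the ends. *)
Definition tent (l s t : R) : R := Num.min s t * (l - Num.max s t) / l.

Lemma tent0 l t : 0 <= t -> tent l 0 t = 0.
Proof. by move=> t0; rewrite /tent (min_l t0) !mul0r. Qed.

Lemma tentC l s t : tent l s t = tent l t s.
Proof. by rewrite /tent minC maxC. Qed.

Definition bridge (x y : gpoint G) : R :=
  \sum_e tent (len e) (pos x e) (pos y e).

Lemma bridgeC x y : bridge x y = bridge y x.
Proof. by apply: eq_bigr => e _; exact: tentC. Qed.

Lemma bridge_vertex x v : bridge x (Vertex v) = 0.
Proof.
apply: big1 => e _; rewrite tentC tent0//.
by have /andP[] := pos_itv x e.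
Qed.

Lemma pos_on_edge e t e' : 0 <= t <= len e ->
  pos (on_edge e t) e' = if (e == e') && (t < len e) then t else 0.
Proof.
move=> /andP[]; rewrite le_eqVlt => /predU1P[<-|t0].
  by rewrite on_edge0 /= if_same.
rewrite le_eqVlt => /predU1P[->|tl].
  by rewrite on_edgel /= ltxx andbF.
have tt : 0 < t < len e by rewrite t0 tl.
by rewrite -[t]/(val (exist (fun t => is_true (0 < t < len e)) t tt)) on_edge_inner /= tl andbT.
Qed.

Lemma bridge_on_edge x e t : 0 <= t <= len e ->
  bridge x (on_edge e t) = tent (len e) (pos x e) t.
Proof.
move=> tl; have /andP[p0 pl] := pos_itv x e; have /andP[t0 tle] := tl.
rewrite /bridge (bigD1 e)//= big1 ?addr0; last first.
  move=> e' ee'; rewrite pos_on_edge// eq_sym (negbTE ee') /= tentC tent0//.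
  by have /andP[] := pos_itv x e'.
rewrite pos_on_edge// eqxx /=; case: ltP => // lt.
have -> : t = len e by apply/eqP; rewrite eq_le tle lt.
rewrite tentC tent0// /tent (max_r pl) subrr mulr0 mul0r//.
Qed.

(* The covariance of the process Z_tilde, see mprod_Z_tilde; as a Green function
   it inverts -f'' under the Kirchhoff conditions, modulo constants. *)
Definition green (x y : gpoint G) : R :=
  interp (fun u => interp (fun v => green_mx u v) y) x + bridge x y.

Lemma interp_swap (F : vertex G -> vertex G -> R) x y :
  interp (fun u => interp (F u) y) x = interp (fun v => interp (fun u => F u v) x) y.
Proof.
rewrite /interp; under eq_bigr do rewrite mulr_sumr.
rewrite exchange_big; apply: eq_bigr => v _; rewrite mulr_sumr.
by apply: eq_bigr => u _; rewrite mulrCA.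
Qed.

Lemma greenC x y : green x y = green y x.
Proof.
rewrite /green bridgeC interp_swap; congr (_ + _).
congr interp; apply/funext => u; congr interp; apply/funext => v.
exact: green_mx_sym.
Qed.

Lemma green_vertex x v : green x (Vertex v) = interp (fun u => green_mx u v) x.
Proof. by rewrite /green bridge_vertex addr0; congr interp; apply/funext => u; rewrite interp_vertex. Qed.

Lemma green_u0 x : green x (Vertex u0) = 1.
Proof.
rewrite green_vertex -[RHS](interp_cst 1 x); congr interp; apply/funext => u.
by rewrite green_mx_sym green_mx_u0.
Qed.

Lemma green_on_edge x e t : 0 <= t <= len e ->
  green x (on_edge e t) = (1 - t / len e) * green x (Vertex (src e)) +
    t / len e * green x (Vertex (tgt e)) + tent (len e) (pos x e) t.
Proof.
move=> tl; rewrite !green_vertex /green bridge_on_edge//; congr (_ + _).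
by rewrite interp_swap interp_on_edge.
Qed.

(** A discrete Poisson equation: a unit mass at [x], shared linearly between the ends of its edge,
    is balanced by a unit mass at [u0]. *)
Lemma green_laplacian x v :
  \sum_w weighted_laplacian v w * green x (Vertex w) = hat v x - (v == u0)%:R.
Proof.
transitivity (interp (fun u => \sum_w weighted_laplacian v w * green_mx w u) x).
  rewrite /interp; under [RHS]eq_bigr do rewrite mulr_sumr.
  rewrite exchange_big; apply: eq_bigr => w _ /=.
  rewrite green_vertex /interp mulr_sumr; apply: eq_bigr => u _.
  by rewrite green_mx_sym mulrCA.
rewrite -[X in _ - X](interp_cst _ x) /interp.
under eq_bigr do rewrite green_mxP green_mx_u0 mulr1 mulrBr.
rewrite sumrB; congr (_ - _).
by under eq_bigr do rewrite mulrC [v == _]eq_sym; rewrite sum_delta.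
Qed.

Lemma green_edge_form (g : vertex G -> R) x :
  \sum_e edge_diff g e * edge_diff (fun v => green x (Vertex v)) e / len e =
  interp g x - g u0.
Proof.
rewrite -laplacian_form.
under eq_bigr do rewrite green_laplacian mulrBr mulrC [g _ * (_ == _)%:R]mulrC.
by rewrite sumrB sum_delta.
Qed.

End GraphLaplacian.

(** * Calculus on an edge *)

Section SecondOrder.
Context {R : realType}.
Notation leb := (@lebesgue_measure R).
Implicit Types (f p v w : R -> R).

Lemma slope_on_is_derive (l : R) f (x m : R) : 0 < x < l ->
  slope_on f x t @[t --> within `[0, l] x^'] --> m -> is_derive x 1 f m.
Proof.
move=> /andP[x0 xl] /cvgrPdist_lt h.
have hq : h0^-1 *: ((f \o shift x) (h0 *: 1) - f x) @[h0 --> 0^'] --> m.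
  apply/cvgrPdist_lt => eps eps0.
  have := h _ eps0; rewrite /prop_near1 /within /= => /nbhs_ballP[e /= e0 he].
  pose d := Num.min e (Num.min x (l - x)).
  have d0 : 0 < d by rewrite !lt_min e0 x0 subr_gt0.
  rewrite /prop_near1; apply/nbhs_ballP; exists d => //= u.
  rewrite /ball/= sub0r normrN !lt_min => /and3P[ue ux ul] u0.
  have := he (u + x); rewrite /ball/= opprD addrCA subrr addr0 normrN => /(_ ue).
  have uxx : u + x != x by rewrite -subr_eq0 addrK.
  move=> /(_ uxx); rewrite /= in_itv/= /slope_on addrK.
  move: ux ul; rewrite !ltr_norml => /andP[? ?] /andP[? ?].
  have -> : 0 <= u + x <= l by apply/andP; split; lra.
  by move=> /(_ isT); rewrite [u *: 1]mulr1 mulrC.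
by split; [apply/cvg_ex; exists m|apply/cvg_lim].
Qed.

Lemma derive_on_cvg (l : R) f (x : R) :
  cvg (slope_on f x t @[t --> within `[0, l] x^']) ->
  slope_on f x t @[t --> within `[0, l] x^'] --> derive_on l f x.
Proof. by []. Qed.

Lemma within_itv_bounded (l : R) p : 0 <= l -> {within `[0, l], continuous p} ->
  exists2 M, 0 <= M & forall t, 0 <= t <= l -> `|p t| <= M.
Proof.
move=> l0 cp; have [a _ ha] := EVT_max l0 cp; have [b _ hb] := EVT_min l0 cp.
exists (`|p a| + `|p b|); first by rewrite addr_ge0.
move=> t tl; have := ha t; have := hb t; rewrite in_itv/= tl => /(_ isT) h1 /(_ isT) h2.
have := ler_norm (p a); have := ler_norm (- p b); rewrite normrN => h3 h4.
have := normr_ge0 (p a); have := normr_ge0 (p b) => h5 h6.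
by rewrite ler_norml; apply/andP; split; lra.
Qed.

Lemma C1_on_lipschitz (l : R) f : 0 < l -> {within `[0, l], continuous f} ->
  C1_on l f -> exists M, [/\ 0 <= M,
    forall t, 0 <= t <= l -> `|derive_on l f t| <= M &
    forall a b, 0 <= a -> a <= b -> b <= l -> `|f b - f a| <= M * (b - a)].
Proof.
move=> l0 cf [df cdf]; have [M M0 hM] := within_itv_bounded (ltW l0) cdf.
exists M; split => // a b a0; rewrite le_eqVlt => /predU1P[->|ab] bl.
  by rewrite !subrr normr0 mulr0.
have [||c] := @MVT _ f (derive_on l f) a b ab.
- move=> x; rewrite in_itv/= => /andP[ax xb].
  apply: (@slope_on_is_derive l).
    by rewrite (le_lt_trans a0 ax) (lt_le_trans xb bl).
  by apply/derive_on_cvg/df; rewrite !ltW// ?(le_lt_trans a0 ax)// (lt_le_trans xb bl).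
- apply: continuous_subspaceW cf; apply: subset_itv; rewrite bnd_simp//.
rewrite in_itv/= => /andP[ac cb] ->; rewrite normrM (gtr0_norm (_ : 0 < b - a)) ?subr_gt0//.
apply: ler_wpM2r; first by rewrite subr_ge0 ltW.
by apply: hM; rewrite (le_trans a0 (ltW ac)) (le_trans (ltW cb) bl).
Qed.

Lemma abs_continuous_dominated (l c : R) p q : 0 <= c -> abs_continuous_on l p ->
  (forall a b, 0 <= a -> a <= b -> b <= l ->
    `|q b - q a| <= c * (`|p b - p a| + (b - a))) ->
  abs_continuous_on l q.
Proof.
move=> c0 acp qp eps eps0.
have c10 : 0 < c + 1 by rewrite ltr_wpDl.
have e20 : 0 < eps / (c + 1) / 2 by rewrite !divr_gt0.
have [delta delta0 h] := acp _ e20.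
exists (Num.min delta (eps / (c + 1) / 2)); first by rewrite lt_min delta0.
move=> n a b abl dis; rewrite lt_min => /andP[s1 s2].
have hp := h n a b abl dis s1.
apply: (@le_lt_trans _ _ (\sum_i c * (`|p (b i) - p (a i)| + (b i - a i)))).
  by apply: ler_sum => i _; have [a0 [ab bl]] := abl i; apply: qp => //; exact: ltW.
rewrite -mulr_sumr big_split/=.
apply: (@le_lt_trans _ _ (c * (eps / (c + 1)))).
  by apply: ler_wpM2l => //; move: hp s2; lra.
rewrite mulrA ltr_pdivrMr// mulrC ltr_pM2l// ltrDl//.
Qed.

(** Integration by parts. The function [q s = s * f' s - (f s - f 0)] is absolutely continuous and
    has derivative [s * f'' s] wherever [f'] is differentiable. *)
Lemma integral_id_derive2 (l : R) f : 0 < l -> {within `[0, l], continuous f} ->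
  C1_on l f -> abs_continuous_on l (derive_on l f) ->
  measurable_fun `[0, l] (derive_on l (derive_on l f)) ->
  forall t, 0 <= t <= l -> \int[leb]_(s in `[0, t]) (s * derive_on l (derive_on l f) s) =
    t * derive_on l f t - (f t - f 0).
Proof.
move=> l0 cf c1f acp mv t tl; set p := derive_on l f; set v := derive_on l p.
have [M [M0 pM fM]] := C1_on_lipschitz l0 cf c1f.
pose q s := s * p s - (f s - f 0).
have acq : abs_continuous_on l q.
  apply: (@abs_continuous_dominated l (l + 2 * M) p) => //.
    by apply: addr_ge0; [exact: ltW|exact: mulr_ge0].
  move=> a b a0 ab bl.
  have -> : q b - q a = b * (p b - p a) + (b - a) * p a - (f b - f a) by rewrite /q; ring.
  have h1 := fM a b a0 ab bl.
  have h2 : `|p a| <= M by apply: pM; rewrite a0 (le_trans ab bl).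
  apply: (le_trans (ler_normB _ _)).
  apply: (le_trans (lerD (ler_normD _ _) h1)).
  rewrite !normrM (ger0_norm (_ : 0 <= b)) ?(le_trans a0 ab)//.
  rewrite (ger0_norm (_ : 0 <= b - a)) ?subr_ge0//.
  have ba : 0 <= b - a by rewrite subr_ge0.
  have h3 : b * `|p b - p a| <= l * `|p b - p a| by exact: ler_wpM2r.
  have h4 : (b - a) * `|p a| <= (b - a) * M by exact: ler_wpM2l.
  have h5 : 0 <= l * (b - a) by rewrite mulr_ge0// ltW.
  have h6 : 0 <= M * `|p b - p a| by rewrite mulr_ge0.
  by move: h3 h4 h5 h6; lra.
have [g [gi pg gE]] := abs_continuous_on_density l0 acp.
have mid : measurable_fun `[0, l] (fun s => s * v s).
  by apply: measurable_funM => //; exact: measurable_funS (measurable_id _).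
have [|_ H] := abs_continuous_on_FTC l0 acq mid.
  have fil : Filter (almost_everywhere leb) := ae_filter_ringOfSetsType leb.
  apply: filterS gE => x hx xl m hm.
  have xl' : 0 <= x <= l by case/andP: xl => *; rewrite !ltW.
  have pF := within_itv_proper l0 xl'.
  have hg := hx xl; have vg : v x = g x by exact: derive_onE.
  have hf : slope_on f x u @[u --> within `[0, l] x^'] --> p x.
    by apply/derive_on_cvg/(c1f.1).
  have hid : u - x @[u --> within `[0, l] x^'] --> (0 : R).
    rewrite -(subrr x); apply: cvgB; last exact: cvg_cst.
    apply: cvg_within_filter; exact: cvg_within.
  have : (x * slope_on p x u + (p x + (u - x) * slope_on p x u) - slope_on f x u)
      @[u --> within `[0, l] x^'] --> x * g x + (p x + 0 * g x) - p x.
    apply: cvgB hf; apply: cvgD; first by apply: cvgMr.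
    by apply: cvgD; [exact: cvg_cst|exact: cvgM].
  rewrite mul0r addr0 addrK => hq.
  have hq' : slope_on q x u @[u --> within `[0, l] x^'] --> x * g x.
    apply: cvg_trans hq; apply: near_eq_cvg.
    rewrite /prop_near1 /within /=; apply/nbhs_ballP; exists 1 => //= u _ ux _.
    rewrite /slope_on /q; field; by rewrite subr_eq0.
  by rewrite vg; apply: (cvg_unique _ hq' hm); exact: Rhausdorff.
by rewrite H// /q mul0r subrr subr0 subr0.
Qed.

End SecondOrder.

Section TentCalculus.
Context {R : realType}.
Notation leb := (@lebesgue_measure R).
Implicit Types (f v w : R -> R) (l s t u : R).

Lemma tent_le l s t : t <= s -> tent l s t = t * (l - s) / l.
Proof. by move=> ts; rewrite /tent (min_r ts) (max_l ts). Qed.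

Lemma tent_ge l s t : s <= t -> tent l s t = s * (l - t) / l.
Proof. by move=> st; rewrite /tent (min_l st) (max_r st). Qed.

Lemma tentl l s : 0 < l -> s <= l -> tent l s l = 0.
Proof. by move=> l0 sl; rewrite tent_ge// subrr mulr0 mul0r. Qed.

(** The derivative of [tent l s] in [t]; at the kink [t = s] it takes the slope on the left. *)
Definition dtent l s t : R := if t <= s then 1 - s / l else - (s / l).

Lemma tent_lipschitz l s t u : 0 < l -> 0 <= s <= l -> t <= u ->
  `|tent l s u - tent l s t| <= u - t.
Proof.
move=> l0 /andP[s0 sl] tu; have sl0 : 0 <= s / l by rewrite divr_ge0// ltW.
have sl1 : s / l <= 1 by rewrite ler_pdivrMr// mul1r.
have ln0 : l != 0 by rewrite gt_eqF.
have up a b : a <= b -> b <= s -> tent l s b - tent l s a = (1 - s / l) * (b - a).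
  by move=> ab bs; rewrite !tent_le ?(le_trans ab)//; field.
have down a b : a <= b -> s <= a -> tent l s b - tent l s a = - (s / l) * (b - a).
  by move=> ab sa; rewrite !tent_ge ?(le_trans sa)//; field.
have bd a b : a <= b -> (b <= s) || (s <= a) -> `|tent l s b - tent l s a| <= b - a.
  move=> ab /orP[bs|sa].
    by rewrite up// normrM !ger0_norm ?subr_ge0// ler_piMl ?subr_ge0//; lra.
  rewrite down// normrM normrN !ger0_norm ?subr_ge0//.
  by rewrite ler_piMl ?subr_ge0.
have [us|su] := leP u s; first by apply: bd => //; rewrite us.
have [ts|st] := leP t s; last by apply: bd => //; rewrite (ltW st) orbT.
rewrite -(subrK (tent l s s) (tent l s u)) -addrA.
apply: (le_trans (ler_normD _ _)).
have := bd s u (ltW su); rewrite lexx orbT => /(_ isT).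
by have := bd t s ts; rewrite lexx => /(_ isT); lra.
Qed.

Lemma slope_on_affine l f t m e : 0 < e ->
  (forall u, 0 <= u <= l -> `|u - t| < e -> f u - f t = m * (u - t)) ->
  slope_on f t u @[u --> within `[0, l] t^'] --> m.
Proof.
move=> e0 h; apply/cvgrPdist_lt => eps eps0.
rewrite /prop_near1 /within /=; apply/nbhs_ballP; exists e => //= u.
rewrite /ball/= distrC => ue ut; rewrite in_itv/= => ul.
by rewrite /slope_on h// mulfK ?subr_eq0// subrr normr0.
Qed.

Lemma tent_affine l s t : 0 < l -> t != s -> exists2 e, 0 < e &
  forall u, `|u - t| < e -> tent l s u - tent l s t = dtent l s t * (u - t).
Proof.
move=> l0 ts; have ln0 : l != 0 by rewrite gt_eqF.
exists `|t - s|; first by rewrite normr_gt0 subr_eq0.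
move=> u; rewrite /dtent; have [ts'|st] := leP t s.
  have lt : t < s by rewrite lt_neqAle ts.
  rewrite [`|t - s|]distrC (gtr0_norm (_ : 0 < s - t)) ?subr_gt0// ltr_distl.
  move=> /andP[_ us]; have {}us : u <= s by move: us; rewrite addrC subrK => /ltW.
  by rewrite !tent_le//; field.
rewrite (gtr0_norm (_ : 0 < t - s)) ?subr_gt0// ltr_distl => /andP[us _].
have {}us : s <= u by move: us; lra.
by rewrite !tent_ge ?(ltW st)//; field.
Qed.

Lemma lipschitz_within_continuous l f c : 
  (forall t u, 0 <= t -> t <= u -> u <= l -> `|f u - f t| <= c * (u - t)) ->
  {within `[0, l], continuous f}.
Proof.
move=> fl; apply/subspace_continuousP => x; rewrite /= in_itv/= => /andP[x0 xl].
apply/cvgrPdist_lt => eps eps0.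
have c0 : 0 < `|c| + 1 by rewrite ltr_wpDl.
rewrite /prop_near1 /within /=; apply/nbhs_ballP.
exists (eps / (`|c| + 1)); first by rewrite /= divr_gt0.
move=> u; rewrite /ball/= => xu; rewrite in_itv/= => /andP[u0 ul].
have bound a b : 0 <= a -> a <= b -> b <= l -> `|f b - f a| <= (`|c| + 1) * (b - a).
  move=> a0 ab bl; apply: le_trans (fl a b a0 ab bl) _.
  by apply: ler_wpM2r; rewrite ?subr_ge0//; have := ler_norm c; lra.
move: xu; rewrite ltr_pdivlMr// mulrC; apply: le_lt_trans.
have [xu|ux] := leP x u.
  by rewrite distrC [`|x - u|]distrC (ger0_norm (_ : 0 <= u - x)) ?subr_ge0// bound.
by rewrite (gtr0_norm (_ : 0 < x - u)) ?subr_gt0// bound// ltW.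
Qed.

Lemma lipschitz_abs_continuous l f c : 0 <= c ->
  (forall t u, 0 <= t -> t <= u -> u <= l -> `|f u - f t| <= c * (u - t)) ->
  abs_continuous_on l f.
Proof.
move=> c0 fl; apply: (@abs_continuous_dominated _ l c (fun=> 0)) => //.
  move=> eps eps0; exists 1 => // n a b _ _ _.
  by rewrite big1// => i _; rewrite subrr normr0.
by move=> a b a0 ab bl; rewrite subrr normr0 add0r; exact: fl.
Qed.

Lemma Rintegral_split l s (T T1 T2 : R -> R) : 0 <= s <= l ->
  leb.-integrable `[0, l] (EFin \o T1) -> leb.-integrable `[0, l] (EFin \o T2) ->
  (forall t, 0 <= t -> t <= s -> T t = T1 t) ->
  (forall t, s < t -> t <= l -> T t = T2 t) ->
  \int[leb]_(t in `[0, l]) T t = \int[leb]_(t in `[0, s]) T1 t +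
    (\int[leb]_(t in `[0, l]) T2 t - \int[leb]_(t in `[0, s]) T2 t).
Proof.
move=> /andP[s0 sl] i1 i2 E1 E2.
have ind (D : set R) : measurable D -> measurable_fun `[0, l] (\1_D : R -> R).
  by move=> mD; exact/measurable_funTS/measurable_indic.
have bind (D : set R) : [bounded \1_D x : R | x in `[0, l]].
  exists 1; split => // x x1 t _ /=; rewrite indicE.
  by case: (_ \in _); rewrite ?normr1 ?normr0 ltW// (lt_trans ltr01).
pose U t := T1 t * \1_(`[0, s]%classic) t + T2 t * \1_(`]s, l]%classic) t.
have iU : leb.-integrable `[0, l] (EFin \o U).
  have j (V : R -> R) (D : set R) : measurable D -> leb.-integrable `[0, l] (EFin \o V) ->
      leb.-integrable `[0, l] ((EFin \o V) \* (EFin \o \1_D))%E.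
    by move=> mD iV; apply: integrableMl => //; exact: ind.
  pose I1 : R -> R := \1_(`[0, s]%classic); pose I2 : R -> R := \1_(`]s, l]%classic).
  have : leb.-integrable `[0, l] (((EFin \o T1) \* (EFin \o I1)) \+
      ((EFin \o T2) \* (EFin \o I2)))%E.
    by apply: integrableD => //; apply: j.
  by apply: eq_integrable => // t _; rewrite /= /U EFinD !EFinM.
have U1 t : `[0, s]%classic t -> U t = T1 t.
  rewrite /= in_itv/= => /andP[t0 ts]; rewrite /U !indicE.
  rewrite mem_set ?mulr1/=; last by rewrite in_itv/= t0.
  by rewrite memNset ?mulr0 ?addr0//= in_itv/= ltNge ts.
have U2 t : `]s, l]%classic t -> U t = T2 t.
  rewrite /= in_itv/= => /andP[st tl]; rewrite /U !indicE.
  rewrite memNset ?mulr0 ?add0r/=; last by rewrite in_itv/= [t <= s]leNgt st andbF.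
  by rewrite mem_set ?mulr1//= in_itv/= st.
have -> : \int[leb]_(t in `[0, l]) T t = \int[leb]_(t in `[0, l]) U t.
  apply: eq_Rintegral => t; rewrite inE /= in_itv/= => /andP[t0 tl].
  have [ts|st] := leP t s.
    by rewrite U1 ?E1//= in_itv/= t0.
  by rewrite U2 ?E2//= in_itv/= st.
apply/eqP; rewrite addrC -subr_eq.
have -> : \int[leb]_(t in `[0, s]) T1 t = \int[leb]_(t in `[0, s]) U t.
  by apply: eq_Rintegral => t; rewrite inE => /U1.
rewrite !Rintegral_itvB ?bnd_simp//.
by apply/eqP; apply: eq_Rintegral => t; rewrite inE => /U2.
Qed.

Lemma itv_integrableS l s v : s <= l -> leb.-integrable `[0, l] (EFin \o v) ->
  leb.-integrable `[0, s] (EFin \o v).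
Proof.
by move=> sl; apply: integrableS => //; apply: subset_itvl; rewrite bnd_simp.
Qed.

Lemma integrable_idM l v : leb.-integrable `[0, l] (EFin \o v) ->
  leb.-integrable `[0, l] (EFin \o (fun t => t * v t)).
Proof.
move=> iv; have mid : measurable_fun `[0, l] (@idfun R).
  exact/measurable_funTS/measurable_id.
have bid : [bounded idfun x : R | x in `[0, l]].
  exists l; split; first exact: num_real.
  move=> x lx t; rewrite /= in_itv/= => /andP[t0 tl].
  by rewrite ger0_norm// (le_trans tl)// ltW.
have : leb.-integrable `[0, l] ((EFin \o idfun) \* (EFin \o v))%E.
  by apply: integrableMr.
by apply: eq_integrable => // t _.
Qed.

Lemma itv_integrableZ l c v : leb.-integrable `[0, l] (EFin \o v) ->
  leb.-integrable `[0, l] (EFin \o (fun t => c * v t)).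
Proof.
move=> iv; have : leb.-integrable `[0, l] (fun t => c%:E * (EFin \o v) t)%E.
  by apply: integrableZl.
by apply: eq_integrable => // t _; rewrite /= EFinM.
Qed.

Lemma bounded_mul_integrable l v (h : R -> R) M : measurable_fun setT h ->
  (forall t, 0 <= t <= l -> `|h t| <= M) -> leb.-integrable `[0, l] (EFin \o v) ->
  leb.-integrable `[0, l] (EFin \o (fun t => v t * h t)).
Proof.
move=> mh hM iv.
have mh' : measurable_fun `[0, l] h by exact: measurable_funTS.
have bh : [bounded h x : R | x in `[0, l]].
  exists M; split; first exact: num_real.
  by move=> x Mx t; rewrite /= in_itv/= => tl; rewrite (le_trans (hM t tl))// ltW.
have : leb.-integrable `[0, l] ((EFin \o v) \* (EFin \o h))%E.
  by apply: integrableMl.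
by apply: eq_integrable => // t _.
Qed.

Lemma measurable_tent l s : measurable_fun setT (tent l s).
Proof.
apply: measurable_funM => //; apply: measurable_funM.
  exact: measurable_minr.
by apply: measurable_funB => //; exact: measurable_maxr.
Qed.

Lemma tent_integrable l s v : 0 < l -> 0 <= s <= l ->
  leb.-integrable `[0, l] (EFin \o v) ->
  leb.-integrable `[0, l] (EFin \o (fun t => v t * tent l s t)).
Proof.
move=> l0 sl; apply: (@bounded_mul_integrable _ _ _ l); first exact: measurable_tent.
move=> t /andP[t0 tl]; have := tent_lipschitz l0 sl t0.
have /andP[s0 _] := sl; rewrite (tentC l s 0) tent0// !subr0 => h.
exact: le_trans h tl.
Qed.

Lemma dtent_integrable l s v : 0 < l -> 0 <= s <= l ->
  leb.-integrable `[0, l] (EFin \o v) ->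
  leb.-integrable `[0, l] (EFin \o (fun t => v t * dtent l s t)).
Proof.
move=> l0 /andP[s0 sl]; apply: (@bounded_mul_integrable _ _ _ 1).
  apply: measurable_fun_ifT => //; exact: measurable_fun_ler.
have h1 : s / l <= 1 by rewrite ler_pdivrMr// mul1r.
have h2 : 0 <= s / l by rewrite divr_ge0// ltW.
by move=> t _; rewrite /dtent; case: ifP => _; rewrite ler_norml; lra.
Qed.

Lemma affine_integrable l (A B : R) v : leb.-integrable `[0, l] (EFin \o v) ->
  leb.-integrable `[0, l] (EFin \o (fun t => v t * ((1 - t / l) * A + t / l * B))).
Proof.
move=> iv; have iv1 := integrable_idM iv.
pose f1 t : R := A * v t; pose f2 t : R := (B - A) / l * (t * v t).
have : leb.-integrable `[0, l] ((EFin \o f1) \+ (EFin \o f2))%E.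
  by apply: integrableD => //; exact: itv_integrableZ.
by apply: eq_integrable => // t _; rewrite /= /f1 /f2 -EFinD; congr EFin; ring.
Qed.

Lemma dtent_integral l s v : 0 < l -> 0 <= s <= l ->
  leb.-integrable `[0, l] (EFin \o v) ->
  \int[leb]_(t in `[0, l]) (v t * dtent l s t) =
  \int[leb]_(t in `[0, s]) v t - s / l * \int[leb]_(t in `[0, l]) v t.
Proof.
move=> l0 sl iv; have /andP[s0 sl'] := sl.
rewrite (@Rintegral_split l s _ (fun t => (1 - s / l) * v t) (fun t => - (s / l) * v t))//;
  try exact: itv_integrableZ.
- rewrite !RintegralZl//; try exact: itv_integrableS iv; ring.
- by move=> t t0 ts; rewrite /dtent ts mulrC.
- by move=> t st tl; rewrite /dtent leNgt st mulrC.
Qed.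

(** Only the integrals of [v t] and [t * v t] over [[0, s]] and [[0, l]] enter. For [v = f''] these
    are known in terms of [f] and [f']. *)
Lemma tent_integral l s v : 0 < l -> 0 <= s <= l ->
  leb.-integrable `[0, l] (EFin \o v) ->
  \int[leb]_(t in `[0, l]) (v t * tent l s t) =
  (1 - s / l) * \int[leb]_(t in `[0, s]) (t * v t) +
  s * (\int[leb]_(t in `[0, l]) v t - \int[leb]_(t in `[0, s]) v t) -
  s / l * (\int[leb]_(t in `[0, l]) (t * v t) - \int[leb]_(t in `[0, s]) (t * v t)).
Proof.
move=> l0 sl iv; have /andP[s0 sl'] := sl; have ln0 : l != 0 by rewrite gt_eqF.
have iv1 := integrable_idM iv.
have iv0s := itv_integrableS sl' iv; have iv1s := itv_integrableS sl' iv1.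
rewrite (@Rintegral_split l s _ (fun t => (1 - s / l) * (t * v t))
  (fun t => s * v t - s / l * (t * v t)))//.
- rewrite RintegralZl// !RintegralB// ?RintegralZl//; try exact: itv_integrableZ.
  ring.
- exact: itv_integrableZ.
- pose f1 t : R := s * v t; pose f2 t : R := s / l * (t * v t).
  have : leb.-integrable `[0, l] ((EFin \o f1) \- (EFin \o f2))%E.
    by apply: integrableB => //; exact: itv_integrableZ.
  by apply: eq_integrable => // t _.
- by move=> t t0 ts; rewrite tent_le//; field.
- by move=> t st tl; rewrite tent_ge ?(ltW st)//; field.
Qed.

Lemma affine_integral l (A B : R) v : 0 < l ->
  leb.-integrable `[0, l] (EFin \o v) ->
  \int[leb]_(t in `[0, l]) (v t * ((1 - t / l) * A + t / l * B)) =
  A * \int[leb]_(t in `[0, l]) v t + (B - A) / l * \int[leb]_(t in `[0, l]) (t * v t).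
Proof.
move=> l0 iv; have iv1 := integrable_idM iv.
rewrite -RintegralZl// -RintegralZl// -RintegralD//; try exact: itv_integrableZ.
by apply: eq_Rintegral => t _; field; rewrite gt_eqF.
Qed.

End TentCalculus.

(** * Green's identity *)

Section GreenIdentities.
Context {R : realType} {G : metric_graph R}.
Notation leb := (@lebesgue_measure R).
Variable u0 : vertex G.
Implicit Types (f : gpoint G -> R) (x : gpoint G) (e : edge G).
Local Notation green := (green u0).

Definition at_vertex f (v : vertex G) : R := f (Vertex v).

Lemma edge_fun0 f e : edge_fun f e 0 = f (Vertex (src e)).
Proof. by rewrite /edge_fun on_edge0. Qed.

Lemma edge_funl f e : edge_fun f e (len e) = f (Vertex (tgt e)).
Proof. by rewrite /edge_fun on_edgel. Qed.

(** An edge that does not contain [x] in its interior has position 0, and its term vanishes; so the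
    deviation from linear interpolation can be written as a sum over all edges. *)
Lemma interp_defect f x :
  \sum_e (edge_fun f e (pos x e) - ((1 - pos x e / len e) * edge_fun f e 0 +
    pos x e / len e * edge_fun f e (len e))) = f x - interp (at_vertex f) x.
Proof.
have z e : edge_fun f e 0 - ((1 - 0 / len e) * edge_fun f e 0 +
    0 / len e * edge_fun f e (len e)) = 0.
  by rewrite !mul0r subr0 mul1r addr0 subrr.
case: x => [v|e u].
  by rewrite interp_vertex subrr big1// => e _; exact: z.
have ul : 0 <= val u <= len e by have /andP[/ltW-> /ltW->] := valP u.
rewrite (bigD1 e)//= eqxx big1 ?addr0 => [|e' ee']; last first.
  by rewrite eq_sym (negbTE ee') z.
rewrite -on_edge_inner interp_on_edge// /at_vertex.
by rewrite /edge_fun on_edge0 on_edgel.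
Qed.

Lemma edge_fun_green x e t : 0 <= t <= len e -> edge_fun (green x) e t =
  (1 - t / len e) * green x (Vertex (src e)) + t / len e * green x (Vertex (tgt e)) +
  tent (len e) (pos x e) t.
Proof. exact: green_on_edge. Qed.

Definition dgreen x e (t : R) : R :=
  edge_diff (at_vertex (green x)) e / len e + dtent (len e) (pos x e) t.

(** On each edge the slope part of [dgreen] yields a term of the Dirichlet form at the vertices and
    [dtent] yields the interpolation defect. The first sum is
    [interp (at_vertex f) x - f (Vertex u0)], the second restores [f x]. *)
Lemma dgreen_integral f x (D : edge G -> R -> R) :
  (forall e, leb.-integrable `[0, len e] (EFin \o D e)) ->
  (forall e t, 0 <= t <= len e ->
    \int[leb]_(s in `[0, t]) D e s = edge_fun f e t - edge_fun f e 0) ->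
  \sum_e \int[leb]_(t in `[0, len e]) (D e t * dgreen x e t) =
  f x - f (Vertex u0).
Proof.
move=> iD DE.
have E e : \int[leb]_(t in `[0, len e]) (D e t * dgreen x e t) =
   edge_diff (at_vertex f) e * edge_diff (at_vertex (green x)) e / len e +
   (edge_fun f e (pos x e) - ((1 - pos x e / len e) * edge_fun f e 0 +
    pos x e / len e * edge_fun f e (len e))).
  have le0 := len_gt0 e; have /andP[p0 pl] := pos_itv x e.
  have ll : 0 <= len e <= len e by rewrite lexx ltW.
  pose f1 t := edge_diff (at_vertex (green x)) e / len e * D e t.
  pose f2 t := D e t * dtent (len e) (pos x e) t.
  have i1 : leb.-integrable `[0, len e] (EFin \o f1) by exact: itv_integrableZ.
  have i2 : leb.-integrable `[0, len e] (EFin \o f2).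
    exact: (dtent_integrable le0 (pos_itv x e) (iD e)).
  transitivity (\int[leb]_(t in `[0, len e]) (f1 t + f2 t)).
    by apply: eq_Rintegral => t _; rewrite /f1 /f2 /dgreen; ring.
  rewrite RintegralD// RintegralZl// dtent_integral ?pos_itv//.
  rewrite !DE ?pos_itv// /edge_diff /at_vertex edge_fun0 edge_funl.
  by field; rewrite gt_eqF.
under eq_bigr do rewrite E.
rewrite big_split/= interp_defect (green_edge_form u0 (at_vertex f) x).
by rewrite /at_vertex; ring.
Qed.

Lemma exit_deriv_src f e :
  cvg (slope_on (edge_fun f e) 0 t @[t --> within `[0, len e] 0^']) ->
  exit_deriv f (src e) e = edge_deriv 1 f e 0.
Proof.
move=> /derive_on_cvg /cvgrPdist_lt h; apply/cvg_lim; first exact: Rhausdorff.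
apply/cvgrPdist_lt => eps eps0.
have := h _ eps0; rewrite /prop_near1 /within /= => /nbhs_ballP[d /= d0 hd].
rewrite /at_right /within /= ; apply/nbhs_ballP.
exists (Num.min d (len e)); first by rewrite /= lt_min d0 len_gt0.
move=> t; rewrite /ball/= sub0r normrN lt_min => /andP[td tl] t0.
have := hd t; rewrite /ball/= sub0r normrN => /(_ td); rewrite gt_eqF// => /(_ isT).
rewrite in_itv/= (ltW t0) (le_trans (ler_norm t) (ltW tl)) => /(_ isT).
by rewrite /slope_on subr0 /leave eqxx edge_fun0.
Qed.

Lemma exit_deriv_tgt f e :
  cvg (slope_on (edge_fun f e) (len e) t @[t --> within `[0, len e] (len e)^']) ->
  exit_deriv f (tgt e) e = - edge_deriv 1 f e (len e).
Proof.
move=> /derive_on_cvg /cvgrPdist_lt h; apply/cvg_lim; first exact: Rhausdorff.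
apply/cvgrPdist_lt => eps eps0.
have := h _ eps0; rewrite /prop_near1 /within /= => /nbhs_ballP[d /= d0 hd].
rewrite /at_right /within /= ; apply/nbhs_ballP.
exists (Num.min d (len e)); first by rewrite /= lt_min d0 len_gt0.
move=> t; rewrite /ball/= sub0r normrN lt_min => /andP[td tl] t0.
have := hd (len e - t); rewrite /ball/= subKr => /(_ td).
have -> : len e - t != len e by rewrite -subr_eq0 addrAC subrr add0r oppr_eq0 gt_eqF.
move=> /(_ isT); have := ler_norm t => tn.
have -> : len e - t \in `[0, len e] by rewrite in_itv/=; apply/andP; split; lra.
move=> /(_ isT); rewrite /slope_on addrAC subrr add0r.
rewrite /leave eq_sym (negbTE (no_loop e)) -/(edge_fun f e (len e - t)) edge_funl.
move=> hh; rewrite -normrN; move: hh; congr (`|_| < _).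
by rewrite invrN mulrN !opprD !opprK.
Qed.

(** The exit derivative is [f'] at a source and [- f'] at a target, so the boundary terms regroup by
    vertices into sums that the Kirchhoff condition annihilates. *)
Lemma kirchhoff_sum f (g : vertex G -> R) :
  (forall e, C1_on (len e) (edge_fun f e)) -> kirchhoff_condition f ->
  \sum_e (g (tgt e) * edge_deriv 1 f e (len e) - g (src e) * edge_deriv 1 f e 0) = 0.
Proof.
move=> c1 kf; transitivity (- \sum_v g v * \sum_(e | v \in ends e) exit_deriv f v e); last first.
  by rewrite big1 ?oppr0// => v _; rewrite kf mulr0.
under [in RHS]eq_bigr do rewrite big_mkcond mulr_sumr.
rewrite exchange_big -sumrN; apply: eq_bigr => e _ /=.
have st := no_loop e; have l0 := ltW (len_gt0 e).
rewrite (bigD1 (src e))//= (bigD1 (tgt e)) 1?eq_sym//= big1 ?addr0; last first.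
  by move=> v /andP[vs vt]; rewrite !inE (negbTE vs) (negbTE vt) mulr0.
rewrite !inE !eqxx orbT /= exit_deriv_src; last by apply: (c1 e).1; rewrite lexx l0.
rewrite exit_deriv_tgt; last by apply: (c1 e).1; rewrite lexx l0.
by rewrite /edge_deriv /=; ring.
Qed.

(** Against the affine part of the Green function, [f''] gives boundary terms, cancelled by
    [kirchhoff_sum], and minus the Dirichlet form at the vertices; against the tent it gives minus
    the interpolation defect. *)
Lemma green_identity f x : kirchhoff_domain f ->
  \sum_e \int[leb]_(t in `[0, len e])
    (edge_deriv 2 f e t * edge_fun (green x) e t) = f (Vertex u0) - f x.
Proof.
move=> [cf H2 kf].
pose A e := green x (Vertex (src e)); pose B e := green x (Vertex (tgt e)).
pose p e := edge_deriv 1 f e.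
have E e : \int[leb]_(t in `[0, len e]) (edge_deriv 2 f e t * edge_fun (green x) e t) =
   (B e * p e (len e) - A e * p e 0) -
   edge_diff (at_vertex f) e * edge_diff (at_vertex (green x)) e / len e -
   (edge_fun f e (pos x e) - ((1 - pos x e / len e) * edge_fun f e 0 +
    pos x e / len e * edge_fun f e (len e))).
  have le0 := len_gt0 e; have /andP[p0 pl] := pos_itv x e.
  have ll : 0 <= len e <= len e by rewrite lexx ltW.
  have [c1 acp [mv _]] := H2 e.
  have [iv vE] := abs_continuous_on_FTC_derive le0 acp mv.
  have jE := integral_id_derive2 le0 (cf e) c1 acp mv.
  rewrite -/(edge_deriv 2 f e) in iv vE jE.
  pose f1 t := edge_deriv 2 f e t * ((1 - t / len e) * A e + t / len e * B e).
  pose f2 t := edge_deriv 2 f e t * tent (len e) (pos x e) t.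
  have i1 : leb.-integrable `[0, len e] (EFin \o f1) by exact: affine_integrable.
  have i2 : leb.-integrable `[0, len e] (EFin \o f2) by exact: (tent_integrable le0 (pos_itv x e) iv).
  transitivity (\int[leb]_(t in `[0, len e]) (f1 t + f2 t)).
    apply: eq_Rintegral => t; rewrite inE /= in_itv/= => tl.
    rewrite /f1 /f2 edge_fun_green//; exact: mulrDr.
  rewrite RintegralD// affine_integral// tent_integral ?pos_itv//.
  rewrite !vE ?pos_itv// !jE ?pos_itv// /edge_diff /at_vertex edge_fun0 edge_funl.
  rewrite /p /edge_deriv /= /A /B.
  by field; rewrite gt_eqF.
under eq_bigr do rewrite E.
rewrite 2!sumrB interp_defect (green_edge_form u0 (at_vertex f) x).
rewrite (kirchhoff_sum (at_vertex (green x)))//; last by move=> e; have [] := H2 e.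
by rewrite /at_vertex; ring.
Qed.

End GreenIdentities.

(** * Boundedness and measurability of the Green function *)

Section BoundedMeasurable.
Context {R : realType} {G : metric_graph R}.
Notation leb := (@lebesgue_measure R).
Implicit Types (f : gpoint G -> R) (x : gpoint G) (e : edge G).

Lemma on_edge_clamp e (t : R) :
  on_edge e t = on_edge e (Num.max 0 (Num.min (len e) t)).
Proof.
have l0 := len_gt0 e; have [t0|t0] := leP t 0.
  rewrite (min_r (le_trans t0 (ltW l0))) (max_l t0) on_edge0.
  by rewrite /on_edge insubF ?t0// ltNge t0.
have [tl|lt] := leP (len e) t.
  rewrite (max_r (ltW l0)) on_edgel.
  by rewrite /on_edge insubF ?[t < _]ltNge ?tl ?andbF// leNgt t0.
by rewrite (max_r (ltW t0)).
Qed.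

Lemma edge_fun_measurable f e : measurable_fun `[0, len e] (edge_fun f e) ->
  measurable_fun setT (edge_fun f e).
Proof.
move=> mf; pose cl t : R := Num.max 0 (Num.min (len e) t).
have -> : edge_fun f e = edge_fun f e \o cl.
  by apply/funext => t; rewrite /edge_fun /= -on_edge_clamp.
apply: (@measurable_comp _ _ _ _ _ _ `[0, len e]%classic) => //.
  move=> _ [t _ <-]; rewrite /= in_itv/= le_max lexx/= ge_max ge_min lexx.
  by rewrite ltW// len_gt0.
by apply: measurable_maxr => //; exact: measurable_minr.
Qed.

Lemma graph_continuous_bmeas f : graph_continuous f -> bmeas f.
Proof.
move=> cf; split.
  move=> e; apply: edge_fun_measurable.
  exact: subspace_continuous_measurable_fun.
have /choice[M hM] : forall e, exists M, 0 <= M /\ forall t, 0 <= t <= len e -> `|edge_fun f e t| <= M.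
  by move=> e; have [M] := within_itv_bounded (ltW (len_gt0 e)) (cf e); exists M.
exists (\sum_v `|f (Vertex v)| + \sum_e M e) => x.
have M0 e : 0 <= M e by case: (hM e).
have s1 : 0 <= \sum_(v : vertex G) `|f (Vertex v)| by apply: sumr_ge0.
have s2 : 0 <= \sum_e M e by apply: sumr_ge0.
case: x => [v|e t].
  rewrite (bigD1 v)//= -addrA lerDl addr_ge0//; apply: sumr_ge0 => *; exact: normr_ge0.
rewrite -on_edge_inner; apply: (@le_trans _ _ (M e)).
  by apply: (hM e).2; have /andP[/ltW-> /ltW->] := valP t.
by rewrite (bigD1 e)//= addrCA lerDl addr_ge0// sumr_ge0.
Qed.

Lemma bmeas_hat (u : vertex G) : bmeas (hat u).
Proof.
apply: graph_continuous_bmeas => e.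
have l0 := len_gt0 e.
apply: (@lipschitz_within_continuous _ _ _ (2 / len e)) => t s t0 ts sl.
rewrite /edge_fun !hat_on_edge ?t0 ?(le_trans t0) ?(le_trans ts)//.
have -> : forall a b : R, (1 - s / len e) * a + s / len e * b -
  ((1 - t / len e) * a + t / len e * b) = (s - t) / len e * (b - a).
  by move=> a b; field; rewrite gt_eqF.
have d0 : 0 <= (s - t) / len e by rewrite divr_ge0 ?subr_ge0// ltW.
rewrite normrM (ger0_norm d0) [leRHS](_ : _ = (s - t) / len e * 2); last by ring.
apply: ler_wpM2l => //.
by case: (_ == _); case: (_ == _); rewrite /= ?subr0 ?sub0r ?subrr ?normrN ?normr1 ?normr0; lra.
Qed.

Lemma bmeas_pos e : bmeas (pos^~ e).
Proof.
split; last first.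
  exists (len e) => x; have /andP[p0 pl] := pos_itv x e.
  by rewrite ger0_norm.
move=> e'; apply: edge_fun_measurable.
pose h t : R := if (e' == e) && (t < len e') then t else 0.
have mh : measurable_fun `[0, len e'] h.
  apply: measurable_funTS; rewrite /h; case: (e' == e) => //=.
  by apply: measurable_fun_ifT => //; exact: measurable_fun_ltr.
apply: eq_measurable_fun mh => t; rewrite inE /= in_itv/= => tl.
by rewrite /edge_fun pos_on_edge.
Qed.

Lemma bker_sum (I : Type) (s : seq I) (F : I -> gpoint G -> gpoint G -> R) :
  (forall i, bker (F i)) -> bker (fun x y => \sum_(i <- s) F i x y).
Proof.
move=> bF; elim: s => [|i s IH].
  have := bker_tensor (bmeas_cst (G := G) 0) (bmeas_cst (G := G) 0); congr bker.
  by apply/funext => x; apply/funext => y; rewrite big_nil mul0r.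
have := bkerD (bF i) IH; congr bker.
by apply/funext => x; apply/funext => y; rewrite big_cons.
Qed.

Lemma bker_tent e : bker (fun x y => tent (len e) (pos x e) (pos y e)).
Proof.
have l0 := len_gt0 e; split; last first.
  exists (len e) => x y; have /andP[p0 pl] := pos_itv y e.
  have := tent_lipschitz l0 (pos_itv x e) p0.
  have /andP[q0 _] := pos_itv x e.
  by rewrite (tentC _ _ 0) tent0// !subr0 => h; exact: le_trans h pl.
move=> e1 e2.
have [m1 _] := bmeas_pos e.
have p1 : measurable_fun setT (fun p : R * R => pos (on_edge e1 p.1) e).
  exact: (measurableT_comp (m1 e1) measurable_fst).
have p2 : measurable_fun setT (fun p : R * R => pos (on_edge e2 p.2) e).
  exact: (measurableT_comp (m1 e2) measurable_snd).
apply: measurable_funM => //; apply: measurable_funM.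
  exact: measurable_minr.
by apply: measurable_funB => //; exact: measurable_maxr.
Qed.

Lemma bker_green (u0 : vertex G) : bker (green u0).
Proof.
rewrite /green; apply: bkerD; last by apply: bker_sum => e; exact: bker_tent.
rewrite /interp; apply: bker_sum => u.
have h1 := bker_tensor (bmeas_hat u) (bmeas_cst (G := G) 1).
have := bkerM h1 (bker_sum (index_enum (vertex G)) (fun v =>
  bker_tensor (bmeas_cst (G := G) 1) (bmeasM (bmeas_hat v) (bmeas_cst (G := G) (green_mx u0 u v))))).
congr bker; apply/funext => x; apply/funext => y.
by rewrite mulr1; congr (_ * _); apply: eq_bigr => v _; rewrite mul1r.
Qed.

End BoundedMeasurable.

(** * The Green operator *)

Section SlopeAlgebra.
Context {R : realType}.
Notation leb := (@lebesgue_measure R).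
Implicit Types (f g w : R -> R) (l t : R).

Lemma slope_on_congr l f t (h : R -> R) (a : R) :
  (forall u, u != t -> 0 <= u <= l -> slope_on f t u = h u) ->
  h u @[u --> within `[0, l] t^'] --> a ->
  slope_on f t u @[u --> within `[0, l] t^'] --> a.
Proof.
move=> fh; apply: cvg_trans; apply: near_eq_cvg.
rewrite /prop_near1 /within /=; apply/nbhs_ballP; exists 1 => //= u _ ut.
by rewrite in_itv/= => ul; exact/esym/fh.
Qed.

Lemma slope_on_eq l f g t (m : R) : 0 <= t <= l ->
  (forall u, 0 <= u <= l -> f u = g u) ->
  slope_on g t u @[u --> within `[0, l] t^'] --> m ->
  slope_on f t u @[u --> within `[0, l] t^'] --> m.
Proof.
by move=> tl fg; apply: slope_on_congr => u _ ul; rewrite /slope_on !fg.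
Qed.

Lemma slope_onD l f g t (a b : R) :
  slope_on f t u @[u --> within `[0, l] t^'] --> a ->
  slope_on g t u @[u --> within `[0, l] t^'] --> b ->
  slope_on (fun s => f s + g s) t u @[u --> within `[0, l] t^'] --> a + b.
Proof.
move=> fa gb; apply: (@slope_on_congr _ _ _ (fun u => slope_on f t u + slope_on g t u)).
  by move=> u _ _; rewrite /slope_on; ring.
exact: cvgD.
Qed.

Lemma slope_onZ l f t (c a : R) :
  slope_on f t u @[u --> within `[0, l] t^'] --> a ->
  slope_on (fun s => c * f s) t u @[u --> within `[0, l] t^'] --> c * a.
Proof.
move=> fa; apply: (@slope_on_congr _ _ _ (fun u => c * slope_on f t u)).
  by move=> u _ _; rewrite /slope_on; ring.
exact: cvgMr.
Qed.

Lemma slope_on_cst l t (c : R) :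
  slope_on (fun=> c) t u @[u --> within `[0, l] t^'] --> 0.
Proof.
apply: (@slope_on_affine _ _ _ _ _ 1) => // u _ _.
by rewrite subrr mul0r.
Qed.

Lemma slope_on_id l t : slope_on idfun t u @[u --> within `[0, l] t^'] --> (1 : R).
Proof. by apply: (@slope_on_affine _ _ _ _ _ 1) => // u _ _; rewrite mul1r. Qed.

Lemma slope_on_idM l f t (a : R) :
  slope_on f t u @[u --> within `[0, l] t^'] --> a ->
  slope_on (fun s => s * f s) t u @[u --> within `[0, l] t^'] --> t * a + f t.
Proof.
move=> fa.
have hid : u @[u --> within `[0, l] t^'] --> t.
  apply: cvg_within_filter; exact: cvg_within.
apply: (@slope_on_congr _ _ _ (fun u => u * slope_on f t u + f t)).
  by move=> u ut _; rewrite /slope_on /=; field; rewrite subr_eq0.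
by apply: cvgD; [exact: cvgM|exact: cvg_cst].
Qed.

(** The primitive is taken from -1 instead of 0, a change by a constant, so that [t = 0] is also an
    interior point. *)
Lemma primitive_slope_on l w t : continuous w -> 0 <= t <= l ->
  slope_on (fun s => \int[leb]_(r in `[0, s]) w r) t u @[u --> within `[0, l] t^']
    --> w t.
Proof.
move=> cw tl; have /andP[t0 tle] := tl.
have iw a b : leb.-integrable `[a, b] (EFin \o w).
  apply: continuous_compact_integrable; first exact: segment_compact.
  exact: continuous_subspaceT.
apply: (@slope_on_cvg _ _ _ (fun x => \int[leb]_(r in `[-1, x]) w r)) => //.
  move=> u /andP[u0 ul].
  have h s : 0 <= s -> \int[leb]_(r in `[0, s]) w r =
      \int[leb]_(r in `[-1, s]) w r - \int[leb]_(r in `[-1, 0]) w r.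
    move=> s0; rewrite (@Rintegral_itvB _ w (BLeft (-1)) (BRight s) 0)//.
    - by rewrite Rintegral_itv_obnd_cbnd//; apply: integrableS (iw 0 s) => //;
        apply: subset_itvr; rewrite bnd_simp.
    - by rewrite bnd_simp.
  by rewrite !h//; ring.
have tt : -1 < t by apply: lt_le_trans t0; rewrite ltrN10.
have [|d1 d2] := @continuous_FTC1_closed R w (-1) t (t + 1) _ (iw _ _) tt (cw t).
  by rewrite ltrDl.
by apply: DeriveDef; [exact: d1|rewrite -derive1E; exact: d2].
Qed.

End SlopeAlgebra.

Section GreenOperator.
Context {R : realType} {G : metric_graph R}.
Notation leb := (@lebesgue_measure R).
Variable u0 : vertex G.
Implicit Types (f w : gpoint G -> R) (x y : gpoint G) (e : edge G).
Local Notation green := (green u0).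

Lemma edge_fun_continuous f e : graph_continuous f -> continuous (edge_fun f e).
Proof.
move=> cf; pose cl t : R := Num.max 0 (Num.min (len e) t).
have -> : edge_fun f e = edge_fun f e \o cl.
  by apply/funext => t; rewrite /edge_fun /= -on_edge_clamp.
have cl_le t s : t <= s -> 0 <= cl s - cl t <= s - t.
  move=> ts; rewrite /cl; have l0 := len_gt0 e.
  have [?|?] := leP (len e) t; have [?|?] := leP (len e) s; have [?|?] := leP 0 (len e);
    have [?|?] := leP 0 t; have [?|?] := leP 0 s; apply/andP; split; lra.
have cl_dist t s : `|cl t - cl s| <= `|t - s|.
  have [ts|/ltW ts] := leP t s; have /andP[h1 h2] := cl_le _ _ ts.
    by rewrite distrC (ger0_norm h1) distrC (ger0_norm (_ : 0 <= s - t)) ?subr_ge0.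
  by rewrite (ger0_norm h1) (ger0_norm (_ : 0 <= t - s)) ?subr_ge0.
have /subspace_continuousP cfe := cf e.
move=> t; have clt : `[0, len e]%classic (cl t).
  rewrite /= in_itv/= /cl le_max lexx/= ge_max ge_min lexx.
  by rewrite ltW// len_gt0.
have /cvgrPdist_lt h := cfe _ clt.
apply/cvgrPdist_lt => eps eps0.
have := h _ eps0; rewrite /prop_near1 /within /= => /nbhs_ballP[d /= d0 hd].
rewrite /prop_near1; apply/nbhs_ballP; exists d => //= u tu; apply: hd.
  exact: le_lt_trans (cl_dist t u) tu.
rewrite in_itv/= /cl le_max lexx/= ge_max ge_min lexx.
by rewrite ltW// len_gt0.
Qed.

(** The constant is uniform in [y], so the estimate survives integration in [y] and gives the
    continuity of [kop green w]. *)
Lemma green_lipschitz e : exists2 c, 0 <= c & forall y s t, 0 <= s -> s <= t ->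
  t <= len e -> `|green (on_edge e t) y - green (on_edge e s) y| <= c * (t - s).
Proof.
have l0 := len_gt0 e; have [_ [M gM]] := bker_green u0.
exists (2 * `|M| / len e + 1).
  by apply: addr_ge0 => //; apply: divr_ge0; [exact: mulr_ge0|exact: ltW].
move=> y s t s0 st tl.
have sl : 0 <= s <= len e by rewrite s0 (le_trans st).
have tl' : 0 <= t <= len e by rewrite (le_trans s0 st).
rewrite ![green _ y]greenC !green_on_edge//.
set A := green y _; set B := green y _.
have -> : forall a b, (1 - t / len e) * A + t / len e * B + a -
    ((1 - s / len e) * A + s / len e * B + b) = (t - s) / len e * (B - A) + (a - b).
  by move=> a b; field; rewrite gt_eqF.
have ts0 : 0 <= (t - s) / len e by rewrite divr_ge0 ?subr_ge0// ltW.
apply: (le_trans (ler_normD _ _)); rewrite [leRHS]mulrDl mul1r; apply: lerD; last first.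
  by apply: tent_lipschitz => //; exact: pos_itv.
rewrite normrM (ger0_norm ts0) [leRHS](_ : _ = (t - s) / len e * (2 * `|M|)); last by ring.
apply: ler_wpM2l => //; apply: (le_trans (ler_normB _ _)).
have := gM y (Vertex (src e)); have := gM y (Vertex (tgt e)); have := ler_norm M.
rewrite -/A -/B; lra.
Qed.

Lemma kop_green_continuous w : bmeas w -> graph_continuous (kop green w).
Proof.
move=> bw e; have [c c0 gc] := green_lipschitz e; have [_ [M wM]] := bw.
apply: (@lipschitz_within_continuous _ _ _ (c * `|M| * total_len (G := G))) => s t s0 st tl.
rewrite /edge_fun /kop -gintB; try by apply: kop_integrand => //; exact: bker_green.
rewrite [leRHS](_ : _ = c * (t - s) * `|M| * total_len (G := G)); last by ring.
apply: gint_norm_le => [|y].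
  by apply: bmeasB; apply: kop_integrand => //; exact: bker_green.
rewrite -mulrBl normrM ler_pM// ?gc//; exact: le_trans (wM y) (ler_norm M).
Qed.

Lemma bmeas_tent e (s : R) : 0 <= s <= len e -> bmeas (fun y => tent (len e) s (pos y e)).
Proof.
move=> sl; split; last first.
  exists (len e) => x; have /andP[p0 pl] := pos_itv x e.
  have := tent_lipschitz (len_gt0 e) sl p0; have /andP[s0 _] := sl.
  by rewrite (tentC _ _ 0) tent0// !subr0 => h; exact: le_trans h pl.
by move=> e'; exact: (measurableT_comp (measurable_tent (len e) s) ((bmeas_pos e).1 e')).
Qed.

Let V0 w e (s : R) := \int[leb]_(t in `[0, s]) edge_fun w e t.
Let V1 w e (s : R) := \int[leb]_(t in `[0, s]) (t * edge_fun w e t).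

(** The derivative of [kop green w] at the source end of [e] when [w] is continuous. *)
Let kappa w e := edge_diff (at_vertex (kop green w)) e / len e +
  (V0 w e (len e) - V1 w e (len e) / len e).

Lemma gint_tent w e (s : R) : 0 <= s <= len e -> bmeas w ->
  gint (fun y => tent (len e) s (pos y e) * w y) =
  \int[leb]_(t in `[0, len e]) (edge_fun w e t * tent (len e) s t).
Proof.
move=> /andP[s0 sl] bw; rewrite /gint (bigD1 e)//= [X in _ + X]big1 ?addr0.
  apply: eq_Rintegral => t; rewrite inE /= in_itv/= => tl.
  rewrite {1}/edge_fun pos_on_edge// eqxx /= mulrC; congr (_ * _).
  case: ltP => // lt; have -> : t = len e.
    by apply/eqP; rewrite eq_le lt; case/andP: tl => _ ->.
  by rewrite tentl ?len_gt0// tentC tent0.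
move=> e' ee'; rewrite -[RHS](mul0r (fine (leb `[0, len e']%classic))) -Rintegral_cst//.
apply: eq_Rintegral => t; rewrite inE /= in_itv/= => tl.
by rewrite /edge_fun pos_on_edge// (negbTE ee') /= tentC tent0// mul0r.
Qed.

Lemma kop_green_on_edge w e (s : R) : 0 <= s <= len e -> bmeas w ->
  kop green w (on_edge e s) =
  (1 - s / len e) * kop green w (Vertex (src e)) +
  s / len e * kop green w (Vertex (tgt e)) +
  \int[leb]_(t in `[0, len e]) (edge_fun w e t * tent (len e) s t).
Proof.
move=> sl bw; rewrite -gint_tent// /kop.
have bg v : bmeas (fun y => green (Vertex v) y * w y).
  by apply: kop_integrand => //; exact: bker_green.
rewrite -!gintZ// -gintD ?bmeasZ//; try exact: bmeasZ.
rewrite -gintD//; last 2 first.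
- by apply: bmeasD; exact: bmeasZ.
- by apply: bmeasM => //; exact: bmeas_tent.
congr gint; apply/funext => y.
rewrite greenC green_on_edge// !(greenC _ _ (Vertex _)) (tentC _ (pos y e)).
ring.
Qed.

(** Here [s * V0 w e s - V1 w e s] is the integral of [(s - t) * w t] over [[0, s]], a second
    primitive of [w]; so the formula displays the first two derivatives when [w] is continuous. *)
Lemma kop_green_edge w e (s : R) : 0 <= s <= len e -> bmeas w ->
  edge_fun (kop green w) e s =
  kop green w (Vertex (src e)) + kappa w e * s + (V1 w e s - s * V0 w e s).
Proof.
move=> sl bw; have l0 := len_gt0 e.
rewrite /edge_fun kop_green_on_edge// tent_integral//; last exact: bmeas_edge_integrable.
by rewrite /kappa /edge_diff /at_vertex -!/(V0 _ _ _) -!/(V1 _ _ _); field; rewrite gt_eqF.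
Qed.

Section Domain.
Variables (w : gpoint G -> R).
Hypotheses (cw : graph_continuous w).

Let bw : bmeas w. Proof. exact: graph_continuous_bmeas. Qed.
Let psi := kop green w.

Let idM_continuous e : continuous (fun t : R => t * edge_fun w e t).
Proof. by move=> t; apply: cvgM; [exact: cvg_id|exact: edge_fun_continuous]. Qed.

Let psi_slope e t : 0 <= t <= len e ->
  slope_on (edge_fun psi e) t u @[u --> within `[0, len e] t^'] --> kappa w e - V0 w e t.
Proof.
move=> tl; have cwe := edge_fun_continuous (e := e) cw.
have s0 := primitive_slope_on cwe tl.
have s1 := primitive_slope_on (@idM_continuous e) tl.
apply: (slope_on_eq tl (fun u ul => kop_green_edge ul bw)).
have -> : kappa w e - V0 w e t = 0 + kappa w e * 1 +
    (t * edge_fun w e t + -1 * (t * edge_fun w e t + V0 w e t)) by ring.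
have h2 := slope_onD s1 (slope_onZ (c := -1) (slope_on_idM s0)).
have h1 := slope_onD (slope_on_cst (len e) t (kop green w (Vertex (src e))))
  (slope_onZ (c := kappa w e) (slope_on_id (len e) t)).
apply: slope_on_eq tl _ (slope_onD h1 h2) => u ul /=.
by rewrite -/(V0 _ _ _) -/(V1 _ _ _); ring.
Qed.

Let psi_derive e t : 0 <= t <= len e ->
  edge_deriv 1 psi e t = kappa w e - V0 w e t.
Proof. by move=> tl; apply: derive_onE => //; [exact: len_gt0|exact: psi_slope]. Qed.

Let psi_derive_slope e t : 0 <= t <= len e ->
  slope_on (edge_deriv 1 psi e) t u @[u --> within `[0, len e] t^'] --> - edge_fun w e t.
Proof.
move=> tl; apply: (slope_on_eq tl (fun u ul => psi_derive ul)).
have s0 := primitive_slope_on (edge_fun_continuous (e := e) cw) tl.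
have -> : - edge_fun w e t = 0 + -1 * edge_fun w e t by ring.
apply: slope_on_eq tl _ (slope_onD (slope_on_cst (len e) t (kappa w e)) (slope_onZ (c := -1) s0)) => u ul /=.
by rewrite -/(V0 _ _ _); ring.
Qed.

Lemma kop_green_deriv2 e t : 0 <= t <= len e -> edge_deriv 2 psi e t = - edge_fun w e t.
Proof.
by move=> tl; apply: derive_onE => //; [exact: len_gt0|exact: psi_derive_slope].
Qed.

Let V0_lipschitz e : exists2 M, 0 <= M & forall s t, 0 <= s -> s <= t -> t <= len e ->
  `|V0 w e t - V0 w e s| <= M * (t - s).
Proof.
have [mw [M wM]] := bw; exists `|M| => // s t s0 st tl.
have iw := bounded_itv_integrable 0 t (mw e) (fun t => wM _).
rewrite /V0 (@Rintegral_itvB _ _ (BLeft 0) (BRight t) s)// ?bnd_simp//.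
have iw' : leb.-integrable `]s, t] (EFin \o edge_fun w e).
  by apply: integrableS iw => //; apply: subset_itvr; rewrite bnd_simp.
apply: (le_trans (le_normr_Rintegral _ iw')) => //.
have -> : t - s = fine (leb `]s, t]%classic).
  rewrite lebesgue_measure_itv/= lte_fin; case: ltP => //= ts.
  by apply/eqP; rewrite subr_eq0 eq_le st ts.
rewrite -Rintegral_cst//; apply: le_Rintegral => //.
- exact: integrable_norm iw'.
- apply: measurable_bounded_integrable => //.
    by rewrite /= lebesgue_measure_itv/=; case: ifP => _; rewrite -?EFinD ltry.
  by exists `|M|; split => // x Mx r _; rewrite normr_id ltW.
- by move=> r _; rewrite (le_trans (wM _))// ler_norm.
Qed.

Lemma kop_green_H2 : edgewise_H2 psi.
Proof.
move=> e; have l0 := len_gt0 e; have [M M0 hM] := V0_lipschitz e.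
have dl s t : 0 <= s -> s <= t -> t <= len e ->
    `|edge_deriv 1 psi e t - edge_deriv 1 psi e s| <= M * (t - s).
  move=> s0 st tl; rewrite !psi_derive ?s0 ?(le_trans s0) ?(le_trans st)//.
  rewrite [X in `|X|](_ : _ = - (V0 w e t - V0 w e s)); last by ring.
  by rewrite normrN; exact: hM.
split.
- split; last exact: (lipschitz_within_continuous dl).
  by move=> x xl; apply/cvg_ex; exists (kappa w e - V0 w e x); exact: psi_slope.
- exact: (lipschitz_abs_continuous M0 dl).
have [mw [N wN]] := bw.
have m2 : measurable_fun `[0, len e] (edge_deriv 2 psi e).
  have : measurable_fun `[0, len e] (fun t => - edge_fun w e t).
    by apply: measurable_funTS; exact: measurableT_comp.
  by apply: eq_measurable_fun => t /set_mem tl'; rewrite kop_green_deriv2.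
split => //.
have mw2 : measurable_fun setT (fun t => edge_fun w e t ^+ 2) by exact: measurable_funX.
have i2 : leb.-integrable `[0, len e] (EFin \o (fun t => edge_fun w e t ^+ 2)).
  apply: (@bounded_itv_integrable _ 0 (len e) (N ^+ 2)) => //.
  by move=> t; rewrite normrX lerXn2r ?nnegrE// (le_trans _ (wN (on_edge e t))).
have /integrableP[_] := i2; apply: le_lt_trans.
rewrite le_eqVlt; apply/orP; left; apply/eqP; apply: eq_integral => t.
rewrite inE /= in_itv/= => tl; have /= -> := kop_green_deriv2 tl.
by rewrite sqrrN ger0_norm ?sqr_ge0.
Qed.

(** The exit derivatives at [v] add up to the integral of [hat v * w] minus the graph Laplacian of
    [psi] at [v]. By [green_laplacian] the difference is a multiple of [gint w], located at [u0]. *)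
Lemma kop_green_kirchhoff : gint w = 0 -> kirchhoff_condition psi.
Proof.
move=> w0 v; have l0 e := len_gt0 e.
have c1 e : C1_on (len e) (edge_fun psi e) by have [] := kop_green_H2 e.
have exs e : exit_deriv psi (src e) e = kappa w e.
  rewrite exit_deriv_src; last by apply: (c1 e).1; rewrite lexx ltW.
  rewrite psi_derive ?lexx ?ltW// /V0 set_itv1 Rintegral_set1 subr0//.
have ext e : exit_deriv psi (tgt e) e = V0 w e (len e) - kappa w e.
  rewrite exit_deriv_tgt; last by apply: (c1 e).1; rewrite lexx ltW.
  by rewrite psi_derive ?lexx ?ltW// opprB.
have bhw u : bmeas (fun y => hat u y * w y) by apply: bmeasM => //; exact: bmeas_hat.
have hatE u : gint (fun y => hat u y * w y) =
    \sum_e ((u == src e)%:R * (V0 w e (len e) - V1 w e (len e) / len e) +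
            (u == tgt e)%:R * (V1 w e (len e) / len e)).
  apply: eq_bigr => e _.
  transitivity (\int[leb]_(t in `[0, len e]) (edge_fun w e t *
     ((1 - t / len e) * (u == src e)%:R + t / len e * (u == tgt e)%:R))).
    apply: eq_Rintegral => t; rewrite inE /= in_itv/= => tl.
    by rewrite {1}/edge_fun hat_on_edge// mulrC.
  rewrite affine_integral//; last exact: bmeas_edge_integrable.
  by rewrite -/(V0 _ _ _) -/(V1 _ _ _); ring.
have lapE : \sum_e incidence e v * edge_diff (at_vertex psi) e / len e =
    gint (fun y => hat v y * w y).
  rewrite -laplacian_sum /at_vertex /psi /kop.
  have bg z : bmeas (fun y => green (Vertex z) y * w y).
    by apply: kop_integrand => //; exact: bker_green.
  under eq_bigr do rewrite -gintZ//.
  rewrite -gint_sum; last by move=> z; exact: bmeasZ.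
  transitivity (gint (fun y => hat v y * w y - (v == u0)%:R * w y)).
    congr gint; apply/funext => y; rewrite -mulrBl -(green_laplacian u0 y v) mulr_suml.
    by apply: eq_bigr => z _; rewrite greenC mulrA.
  by rewrite gintB// ?gintZ// ?w0 ?mulr0 ?subr0//; exact: bmeasZ.
transitivity (\sum_e ((v == src e)%:R * exit_deriv psi (src e) e +
    (v == tgt e)%:R * exit_deriv psi (tgt e) e)).
  rewrite big_mkcond; apply: eq_bigr => e _; rewrite !inE; move: (exit_deriv psi) => D.
  have st := no_loop e; case: (eqVneq v (src e)) => [->|vs] /=.
    by rewrite (negbTE st) mul1r mul0r addr0.
  by case: (eqVneq v (tgt e)) => [->|vt] /=; rewrite ?mul0r ?mul1r ?add0r.
transitivity (- (\sum_e incidence e v * edge_diff (at_vertex psi) e / len e) +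
    gint (fun y => hat v y * w y)); last by rewrite lapE addNr.
rewrite hatE -sumrN -big_split; apply: eq_bigr => e _ /=.
by rewrite exs ext /kappa -/psi /incidence; ring.
Qed.

Lemma kop_green_domain : gint w = 0 -> kirchhoff_domain psi.
Proof.
move=> w0; split; [exact: kop_green_continuous|exact: kop_green_H2|].
exact: kop_green_kirchhoff.
Qed.

End Domain.
End GreenOperator.

(** * Reproducing kernels *)

Section EnergySpaces.
Context {R : realType} {G : metric_graph R}.
Notation leb := (@lebesgue_measure R).
Variable u0 : vertex G.
Implicit Types (f w : gpoint G -> R) (x y : gpoint G) (e : edge G).
Local Notation green := (green u0).

Lemma measurable_fun_off_point (D : set R) (f h : R -> R) a : measurable D ->
  measurable_fun D h -> (forall t, D t -> t != a -> f t = h t) -> measurable_fun D f.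
Proof.
move=> mD mh fh.
have mi : measurable_fun D (fun t => h t + (f a - h a) * \1_[set a] t).
  apply: measurable_funD => //; apply: measurable_funM => //.
apply: eq_measurable_fun mi => t /set_mem Dt; rewrite indicE.
have [->|ta] := eqVneq t a; first by rewrite mem_set// mulr1 addrC subrK.
by rewrite memNset ?mulr0 ?addr0 ?fh//= => /eqP; rewrite (negbTE ta).
Qed.

Lemma measurable_fun_off_pair (D : set R) (f h : R -> R) a b : measurable D ->
  measurable_fun D h -> (forall t, D t -> t != a -> t != b -> f t = h t) ->
  measurable_fun D f.
Proof.
move=> mD mh fh; pose g t := if t == b then f b else h t.
apply: (@measurable_fun_off_point _ _ g a) => //.
  by apply: (measurable_fun_off_point (a := b) mD mh) => t _ tb; rewrite /g (negbTE tb).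
by move=> t Dt ta; rewrite /g; case: eqVneq => [->//|tb]; exact: fh.
Qed.

Lemma slope_onBc (f : R -> R) (c x : R) :
  slope_on (fun t => f t - c) x = slope_on f x.
Proof. by apply/funext => t; rewrite /slope_on; congr (_ / _); ring. Qed.

Lemma derive_onBc (l c : R) (f : R -> R) :
  derive_on l (fun t => f t - c) = derive_on l f.
Proof.
by apply/funext => x; rewrite /derive_on slope_onBc.
Qed.

Lemma edge_derivBc p f c e : edge_deriv p.+1 (fun x => f x - c) e = edge_deriv p.+1 f e.
Proof.
rewrite /edge_deriv !iterSr; congr (iter p _ _).
exact: (derive_onBc (len e) c (edge_fun f e)).
Qed.

Lemma within_continuousBc (l c : R) (f : R -> R) :
  {within `[0, l], continuous f} -> {within `[0, l], continuous (fun t => f t - c)}.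
Proof.
move=> /subspace_continuousP cf; apply/subspace_continuousP => x xl.
by apply: cvgB; [exact: cf|exact: cvg_cst].
Qed.

Lemma kirchhoff_domainBc f c : kirchhoff_domain f ->
  kirchhoff_domain (fun x => f x - c).
Proof.
move=> [cf H2 kf]; split.
- by move=> e; exact: (within_continuousBc (c := c) (f := edge_fun f e) (cf e)).
- move=> e; have [[c1 c1'] acf l2] := H2 e; rewrite !edge_derivBc; split => //.
  split; last by rewrite (derive_onBc _ c (edge_fun f e)).
  by move=> x xl; rewrite (slope_onBc (edge_fun f e) c x); exact: c1.
- move=> v; rewrite -[RHS](kf v); apply: eq_bigr => e _.
  rewrite /exit_deriv [X in lim (X @ _)](_ : _ = fun t => (f (leave v e t) - f (Vertex v)) / t)//.
  by apply/funext => t; congr (_ / _); ring.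
Qed.

Definition vertex_mean f : R := (\sum_(v : vertex G) f (Vertex v)) / #|vertex G|%:R.

Lemma vertex_centered_mean f : vertex_centered (fun x => f x - vertex_mean f).
Proof.
rewrite /vertex_centered sumrB sumr_const -mulr_natr /vertex_mean.
rewrite divfK ?subrr// pnatr_eq0 -lt0n; apply/card_gt0P; exists u0.
by [].
Qed.

(** The variance of the increment between [x1] and [x2] of a centered process with covariance
    [k]. *)
Definition kquad (k : gpoint G -> gpoint G -> R) x1 x2 : R :=
  k x1 x1 - k x1 x2 - (k x2 x1 - k x2 x2).

Definition green_diff x1 x2 y : R := green x1 y - green x2 y.

Lemma green_diff_lipschitz x1 x2 e : exists2 c, 0 <= c & forall s t, 0 <= s -> s <= t ->
  t <= len e -> `|edge_fun (green_diff x1 x2) e t - edge_fun (green_diff x1 x2) e s| <= c * (t - s).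
Proof.
have [c c0 hc] := green_lipschitz u0 e; exists (c + c); first exact: addr_ge0.
move=> s t s0 st tl; rewrite /edge_fun /green_diff !(greenC _ _ (on_edge _ _)).
rewrite [X in `|X|](_ : _ = (green (on_edge e t) x1 - green (on_edge e s) x1) -
  (green (on_edge e t) x2 - green (on_edge e s) x2)); last by ring.
by rewrite mulrDl; apply: le_trans (ler_normB _ _) _; apply: lerD; exact: hc.
Qed.

Lemma green_diff_continuous x1 x2 : graph_continuous (green_diff x1 x2).
Proof.
move=> e; have [c _ hc] := green_diff_lipschitz x1 x2 e.
exact: (lipschitz_within_continuous hc).
Qed.

Definition dgreen_diff x1 x2 e (t : R) : R := dgreen u0 x1 e t - dgreen u0 x2 e t.

Lemma green_diff_derive x1 x2 e (t : R) : 0 <= t <= len e ->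
  t != pos x1 e -> t != pos x2 e ->
  edge_deriv 1 (green_diff x1 x2) e t = dgreen_diff x1 x2 e t.
Proof.
move=> tl t1 t2; have l0 := len_gt0 e.
have [d1 d10 h1] := tent_affine l0 t1; have [d2 d20 h2] := tent_affine l0 t2.
apply: derive_onE => //; apply: (@slope_on_affine _ _ _ _ _ (Num.min d1 d2)).
  by rewrite lt_min d10.
move=> u ul; rewrite lt_min => /andP[ut1 ut2].
have := h1 u ut1; have := h2 u ut2.
rewrite /edge_fun /green_diff !green_on_edge// /dgreen_diff /dgreen /edge_diff /at_vertex.
set T1 := tent _ _ u; set T2 := tent _ _ t; set T3 := tent _ _ u; set T4 := tent _ _ t.
move=> /(canRL (subrK _)) -> /(canRL (subrK _)) ->.
by field; rewrite gt_eqF.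
Qed.

Lemma measurable_dtent (l s : R) : measurable_fun setT (dtent l s).
Proof. by apply: measurable_fun_ifT => //; exact: measurable_fun_ler. Qed.

Lemma dtent_bound (l s t : R) : 0 < l -> 0 <= s <= l -> `|dtent l s t| <= 1.
Proof.
move=> l0 /andP[s0 sl]; have h1 : s / l <= 1 by rewrite ler_pdivrMr// mul1r.
have h2 : 0 <= s / l by rewrite divr_ge0// ltW.
by rewrite /dtent; case: ifP => _; rewrite ler_norml; lra.
Qed.

Lemma dgreen_diff_bounded x1 x2 e : measurable_fun setT (dgreen_diff x1 x2 e) /\
  exists M, forall t, `|dgreen_diff x1 x2 e t| <= M.
Proof.
split.
  by apply: measurable_funB; apply: measurable_funD => //; exact: measurable_dtent.
pose a x := edge_diff (at_vertex (green x)) e / len e.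
exists ((`|a x1| + 1) + (`|a x2| + 1)) => t.
apply: (le_trans (ler_normB _ _)); apply: lerD.
  by apply: (le_trans (ler_normD _ _)); rewrite lerD2l dtent_bound ?len_gt0 ?pos_itv.
by apply: (le_trans (ler_normD _ _)); rewrite lerD2l dtent_bound ?len_gt0 ?pos_itv.
Qed.

(** At the two kinks [derive_on] may be a [lim] that does not exist, so its value there is not
    controlled; changing a function at two points preserves measurability. *)
Lemma green_diff_derive_measurable x1 x2 e :
  measurable_fun `[0, len e] (edge_deriv 1 (green_diff x1 x2) e).
Proof.
have [md _] := dgreen_diff_bounded x1 x2 e.
apply: (measurable_fun_off_pair (h := dgreen_diff x1 x2 e) (a := pos x1 e) (b := pos x2 e)) => //.
  exact: measurable_funTS.
by move=> t; rewrite /= in_itv/= => tl; exact: green_diff_derive.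
Qed.

Lemma green_diff_derive_ae x1 x2 e : {ae leb, forall t, `[0, len e]%classic t ->
  edge_deriv 1 (green_diff x1 x2) e t = dgreen_diff x1 x2 e t}.
Proof.
have fil : Filter (almost_everywhere leb) := ae_filter_ringOfSetsType leb.
apply: filterS2 (ae_neq (pos x1 e)) (ae_neq (pos x2 e)) => t t1 t2.
by rewrite /= in_itv/= => tl; exact: green_diff_derive.
Qed.

Lemma green_diff_energy1 x1 x2 (c : R) : vertex_centered (fun y => green_diff x1 x2 y - c) ->
  energy_space 1 (fun y => green_diff x1 x2 y - c).
Proof.
move=> vc; split => //.
  by move=> e; exact: (within_continuousBc (c := c) (f := edge_fun (green_diff x1 x2) e)
    (@green_diff_continuous x1 x2 e)).
move=> e; have [k k0 hk] := green_diff_lipschitz x1 x2 e; split.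
  apply: (lipschitz_abs_continuous k0) => s t s0 st tl.
  rewrite /edge_fun [X in `|X|](_ : _ = edge_fun (green_diff x1 x2) e t -
    edge_fun (green_diff x1 x2) e s); last by rewrite /edge_fun; ring.
  exact: hk.
rewrite edge_derivBc; split; first exact: green_diff_derive_measurable.
have [md [M dM]] := dgreen_diff_bounded x1 x2 e.
have md2 : measurable_fun setT (fun t => dgreen_diff x1 x2 e t ^+ 2) by exact: measurable_funX.
have i2 : leb.-integrable `[0, len e] (EFin \o (fun t => dgreen_diff x1 x2 e t ^+ 2)).
  apply: (@bounded_itv_integrable _ 0 (len e) (M ^+ 2)) => //.
  by move=> t; rewrite normrX lerXn2r ?nnegrE// (le_trans _ (dM t)).
have [] := @ae_eq_Rintegral _ `[0, len e]%classic _
  (fun t => edge_deriv 1 (green_diff x1 x2) e t ^+ 2) _ _ i2 => //.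
- by apply: measurable_funX; exact: green_diff_derive_measurable.
- have fil : Filter (almost_everywhere leb) := ae_filter_ringOfSetsType leb.
  by apply: filterS (green_diff_derive_ae x1 x2 e) => t h tl; rewrite h.
move=> /integrableP[_] + _; apply: le_lt_trans.
rewrite le_eqVlt; apply/orP; left; apply/eqP; apply: eq_integral => t _ /=.
by rewrite ger0_norm ?sqr_ge0.
Qed.

(** Each Green function contributes [f x - f (Vertex u0)], and the base value cancels in the
    difference; the constant [c] is lost in the derivative. *)
Lemma green_diff_reproducing x1 x2 c f : energy_space 1 f ->
  energy_form 1 f (fun y => green_diff x1 x2 y - c) = f x1 - f x2.
Proof.
move=> [_ H1 _]; pose D e := edge_deriv 1 f e.
have FTC e : leb.-integrable `[0, len e] (EFin \o D e) /\
    forall t, 0 <= t <= len e ->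
      \int[leb]_(s in `[0, t]) D e s = edge_fun f e t - edge_fun f e 0.
  have [acf [mf _]] := H1 e.
  exact: (abs_continuous_on_FTC_derive (len_gt0 e) acf mf).
have Dg x e : leb.-integrable `[0, len e] (EFin \o (fun t => D e t * dgreen u0 x e t)).
  apply: (@bounded_mul_integrable _ _ _ _ (`|edge_diff (at_vertex (green x)) e / len e| + 1)).
  - by apply: measurable_funD => //; exact: measurable_dtent.
  - move=> t _; apply: (le_trans (ler_normD _ _)).
    by rewrite lerD2l dtent_bound ?len_gt0 ?pos_itv.
  - by case: (FTC e).
transitivity (\sum_e (\int[leb]_(t in `[0, len e]) (D e t * dgreen u0 x1 e t) -
    \int[leb]_(t in `[0, len e]) (D e t * dgreen u0 x2 e t))).
  apply: eq_bigr => e _; rewrite -RintegralB//.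
  have [] := @ae_eq_Rintegral _ `[0, len e]%classic
    (fun t => D e t * dgreen u0 x1 e t - D e t * dgreen u0 x2 e t)
    (fun t => D e t * edge_deriv 1 (fun y => green_diff x1 x2 y - c) e t) => //.
  - apply: measurable_funM; first by have [_ []] := H1 e.
    rewrite edge_derivBc; exact: green_diff_derive_measurable.
  - pose f1 t := D e t * dgreen u0 x1 e t; pose f2 t := D e t * dgreen u0 x2 e t.
    have : leb.-integrable `[0, len e] ((EFin \o f1) \- (EFin \o f2))%E.
      by apply: integrableB => //; exact: Dg.
    by apply: eq_integrable => // t _.
  - have fil : Filter (almost_everywhere leb) := ae_filter_ringOfSetsType leb.
    apply: filterS (green_diff_derive_ae x1 x2 e) => t h tl.
    by rewrite edge_derivBc h// -mulrBr.
rewrite sumrB !(dgreen_integral _ _ (fun e => (FTC e).1) (fun e => (FTC e).2)); ring.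
Qed.

(** The energy product of [k x] and [q - c] is computed twice: Green's identity gives
    [k x x1 - k x x2], the reproducing property gives [q x - c]. *)
Lemma kernel1_green (k : gpoint G -> gpoint G -> R) x1 x2 :
  reproducing_kernel 1 k -> kquad k x1 x2 = kquad green x1 x2.
Proof.
move=> rk; pose q := green_diff x1 x2; pose c := vertex_mean q.
have Fq : energy_space 1 (fun y => q y - c).
  by apply: green_diff_energy1; exact: vertex_centered_mean.
have kE x : k x x1 - k x x2 = q x - c.
  have [Fk _] := rk x; rewrite -(green_diff_reproducing x1 x2 c Fk).
  have [_ /(_ _ Fq) <-] := rk x; rewrite /energy_form; apply: eq_bigr => e _.
  by apply: eq_Rintegral => t _; rewrite mulrC.
by rewrite /kquad !kE /q /green_diff (greenC _ x1 x2); ring.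
Qed.

End EnergySpaces.

Section EnergySpaceTwo.
Context {R : realType} {G : metric_graph R}.
Notation leb := (@lebesgue_measure R).
Variable u0 : vertex G.
Implicit Types (f w : gpoint G -> R) (x y : gpoint G) (e : edge G).
Local Notation green := (green u0).

Definition gmean f : R := gint f / total_len (G := G).

Definition zero_mean f x : R := f x - gmean f.

Lemma zero_mean_bmeas f : bmeas f -> bmeas (zero_mean f).
Proof. by move=> bf; apply: bmeasB => //; exact: bmeas_cst. Qed.

(** Without edges the total length is 0 and [gmean f] is 0 by the convention on inverses; the
    integral is then 0 as well. *)
Lemma gmean_total f : bmeas f -> gmean f * total_len (G := G) = gint f.
Proof.
move=> bf; rewrite /gmean; have [L0|L0] := eqVneq (total_len (G := G)) 0; last by rewrite divfK.
rewrite L0 mulr0; apply/esym/eqP; rewrite -normr_le0.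
have [_ [M fM]] := bf; have := gint_norm_le bf fM.
by rewrite L0 mulr0.
Qed.

Lemma gint_zero_mean f : bmeas f -> gint (zero_mean f) = 0.
Proof.
move=> bf; rewrite gintB//; last exact: bmeas_cst.
by rewrite gint_cst gmean_total// subrr.
Qed.

Lemma gint_mul_zero_mean f : bmeas f ->
  gint (fun y => f y * zero_mean f y) = gint (fun y => zero_mean f y ^+ 2).
Proof.
move=> bf; have bz := zero_mean_bmeas bf.
have -> : (fun y => f y * zero_mean f y) =
    fun y => zero_mean f y ^+ 2 + gmean f * zero_mean f y.
  by apply/funext => y; rewrite /zero_mean; ring.
rewrite gintD; last 2 first.
- exact: bmeasM.
- exact: bmeasZ.
by rewrite gintZ// gint_zero_mean// mulr0 addr0.
Qed.

Lemma deriv2_integrable f w e : kirchhoff_domain f -> bmeas w ->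
  leb.-integrable `[0, len e] (EFin \o (fun t => edge_deriv 2 f e t * edge_fun w e t)).
Proof.
move=> [_ H2 _] [mw [M wM]]; have [_ acp [mv _]] := H2 e.
have [iv _] := abs_continuous_on_FTC_derive (len_gt0 e) acp mv.
by apply: (@bounded_mul_integrable _ _ _ _ M) => // t _; exact: wM.
Qed.

Definition deriv2_pairing f w : R := \sum_e \int[leb]_(t in `[0, len e])
  (edge_deriv 2 f e t * edge_fun w e t).

Lemma deriv2_pairingB f v w : kirchhoff_domain f -> bmeas v -> bmeas w ->
  deriv2_pairing f (fun y => v y - w y) = deriv2_pairing f v - deriv2_pairing f w.
Proof.
move=> Df bv bw; rewrite /deriv2_pairing -sumrB; apply: eq_bigr => e _.
rewrite -RintegralB//; try exact: deriv2_integrable.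
by apply: eq_Rintegral => t _; rewrite -mulrBr.
Qed.

Lemma deriv2_pairingZ f c w : kirchhoff_domain f -> bmeas w ->
  deriv2_pairing f (fun y => c * w y) = c * deriv2_pairing f w.
Proof.
move=> Df bw; rewrite /deriv2_pairing big_distrr; apply: eq_bigr => e _ /=.
rewrite -RintegralZl//; last exact: deriv2_integrable.
by apply: eq_Rintegral => t _; rewrite mulrCA.
Qed.

Lemma green_u0l y : green (Vertex u0) y = 1.
Proof. by rewrite greenC green_u0. Qed.

(** A constant is a multiple of the Green function at [u0], so the claim is Green's identity at
    [x = u0]. *)
Lemma deriv2_pairing_cst f c : kirchhoff_domain f -> deriv2_pairing f (fun=> c) = 0.
Proof.
move=> Df; have -> : (fun=> c) = fun y : gpoint G => c * green (Vertex u0) y.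
  by apply/funext => y; rewrite green_u0l mulr1.
rewrite deriv2_pairingZ//; last by apply: bker_section; exact: bker_green.
by rewrite /deriv2_pairing green_identity// subrr mulr0.
Qed.

Lemma deriv2_pairing_green_diff f x1 x2 : kirchhoff_domain f ->
  deriv2_pairing f (zero_mean (green_diff u0 x1 x2)) = f x2 - f x1.
Proof.
have bg x : bmeas (green x) by apply: bker_section; exact: bker_green.
move=> Df; rewrite deriv2_pairingB//; last 2 first.
- exact: bmeasB.
- exact: bmeas_cst.
rewrite deriv2_pairing_cst// deriv2_pairingB// /deriv2_pairing !green_identity//; ring.
Qed.

Lemma kernel2_green (k : gpoint G -> gpoint G -> R) x1 x2 :
  reproducing_kernel 2 k ->
  kquad k x1 x2 = gint (fun y => zero_mean (green_diff u0 x1 x2) y ^+ 2).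
Proof.
have bg := bker_green u0.
move=> rk; set q := green_diff u0 x1 x2; set w := zero_mean q.
have bq : bmeas q by apply: bmeasB; exact: bker_section.
have bw : bmeas w by exact: zero_mean_bmeas.
have cw : graph_continuous w.
  move=> e; exact: (within_continuousBc (c := gmean q) (f := edge_fun q e)
    (@green_diff_continuous _ _ u0 x1 x2 e)).
pose c := vertex_mean (kop green w).
pose H x := kop green w x - c.
have FH : energy_space 2 H.
  split; last exact: (vertex_centered_mean u0).
  by apply: kirchhoff_domainBc; apply: kop_green_domain => //; exact: gint_zero_mean.
(* The energy product of [k x] and [H] is computed twice, by the reproducing property and, since
   [H'' = - w], by Green's identity. *)
have kE x : k x x1 - k x x2 = H x.
  have [[Dk _] _] := rk x; have [_ /(_ _ FH) <-] := rk x.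
  apply: (@oppr_inj R); rewrite opprB -deriv2_pairing_green_diff//.
  rewrite /deriv2_pairing /energy_form -sumrN; apply: eq_bigr => e _.
  rewrite -[RHS]mulN1r -RintegralZl//; last first.
    have := deriv2_integrable e Dk (bmeasZ (-1) bw).
    apply: eq_integrable => // t /set_mem tl.
    have {}tl : 0 <= t <= len e by move: tl; rewrite /= in_itv.
    congr EFin.
    rewrite (edge_derivBc 1 (kop green w)) kop_green_deriv2// /edge_fun; ring.
  apply: eq_Rintegral => t /set_mem tl.
  have {}tl : 0 <= t <= len e by move: tl; rewrite /= in_itv.
  by rewrite (edge_derivBc 1 (kop green w)) kop_green_deriv2//; ring.
(* What remains is [H x1 - H x2], the integral of [q * w]; [q] may be replaced by [w] because [w]
   has mean zero. *)
rewrite -gint_mul_zero_mean// /kquad !kE.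
rewrite /H /q /green_diff [LHS](_ : _ = kop green w x1 - kop green w x2); last by ring.
rewrite /kop -gintB; try exact: kop_integrand.
by congr gint; apply/funext => y; rewrite mulrBl.
Qed.

End EnergySpaceTwo.

(** * Spectral expansion *)

Section CenteredGreen.
Context {R : realType} {G : metric_graph R}.
Notation leb := (@lebesgue_measure R).
Variable u0 : vertex G.
Implicit Types (f w : gpoint G -> R) (x y : gpoint G) (e : edge G).
Local Notation green := (green u0).

Lemma gmeanB f g : bmeas f -> bmeas g -> gmean (fun y => f y - g y) = gmean f - gmean g.
Proof. by move=> bf bg; rewrite /gmean gintB// mulrBl. Qed.

Lemma gmean_norm_le f M : bmeas f -> 0 <= M -> (forall x, `|f x| <= M) -> `|gmean f| <= M.
Proof.
move=> bf M0 fM; rewrite /gmean; have [->|L0] := eqVneq (total_len (G := G)) 0.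
  by rewrite invr0 mulr0 normr0.
have Lp : 0 < total_len (G := G) by rewrite lt_neqAle eq_sym L0 total_len_ge0.
by rewrite normrM normfV (gtr0_norm Lp) ler_pdivrMr// gint_norm_le.
Qed.

Lemma bker_gmean k : bker k -> bmeas (fun x => gmean (k x)).
Proof.
move=> bk; have := bmeasZ (total_len (G := G))^-1 (bker_gint bk).
by congr bmeas; apply/funext => x; rewrite mulrC.
Qed.

(** Centering in both variables keeps the kernel symmetric and makes it annihilate constants, so its
    eigenfunctions for non-zero eigenvalues have integral zero. *)
Definition centered_green x y : R :=
  green x y - gmean (green x) - gmean (green y) + gmean (fun z => gmean (green z)).

Lemma centered_greenC x y : centered_green x y = centered_green y x.
Proof. by rewrite /centered_green greenC; ring. Qed.

Lemma bker_centered_green : bker centered_green.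
Proof.
have bg := bker_green u0; have bm := bker_gmean bg; have b1 c := bmeas_cst (G := G) c.
rewrite /centered_green; apply: bkerD.
  apply: bkerB.
    apply: bkerB => //; have := bker_tensor bm (b1 1); congr bker.
    by apply/funext => x; apply/funext => y; rewrite mulr1.
  have := bker_tensor (b1 1) bm; congr bker.
  by apply/funext => x; apply/funext => y; rewrite mul1r.
have := bker_tensor (b1 (gmean (fun z => gmean (green z)))) (b1 1); congr bker.
by apply/funext => x; apply/funext => y; rewrite mulr1.
Qed.

Lemma centered_green_diff x1 x2 y :
  zero_mean (green_diff u0 x1 x2) y = centered_green x1 y - centered_green x2 y.
Proof.
rewrite /zero_mean /green_diff /centered_green gmeanB; try exact: (bker_section _ (bker_green u0)).
ring.
Qed.

Lemma gint_centered_green x : gint (centered_green x) = 0.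
Proof.
have bg := bker_green u0; have bm := bker_gmean bg; have b1 c := bmeas_cst (G := G) c.
have bgx : bmeas (green x) by exact: bker_section.
rewrite /centered_green gintD; last 2 first.
- by apply: bmeasB => //; apply: bmeasB.
- exact: b1.
rewrite gintB//; last exact: bmeasB.
by rewrite gintB// !gint_cst !gmean_total//; ring.
Qed.

Lemma gint_kop_centered_green f : bmeas f -> gint (kop centered_green f) = 0.
Proof.
move=> bf; have bK := bker_centered_green; have b1 := bmeas_cst (G := G) 1.
transitivity (gint (fun x => kop centered_green f x * 1)).
  by congr gint; apply/funext => x; rewrite mulr1.
rewrite kop_adjoint//; last exact: centered_greenC.
transitivity (gint (fun x : gpoint G => 0)); last by rewrite gint_cst mul0r.
congr gint; apply/funext => x; rewrite (_ : kop _ _ _ = 0) ?mulr0//.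
rewrite -(gint_centered_green x) /kop; congr gint.
by apply/funext => y; rewrite mulr1.
Qed.

Lemma kop_centered_green f x : bmeas f -> gint f = 0 ->
  kop centered_green f x = kop green f x - gint (fun y => gmean (green y) * f y).
Proof.
move=> bf f0; have bg := bker_green u0; have bm := bker_gmean bg.
have bgf : bmeas (fun y => green x y * f y) by exact: kop_integrand.
have bmf : bmeas (fun y => gmean (green y) * f y) by exact: bmeasM.
rewrite /kop; set c0 := gmean (fun z => gmean (green z)).
rewrite (_ : (fun y => centered_green x y * f y) = fun y =>
  (green x y * f y - gmean (green y) * f y) + (c0 - gmean (green x)) * f y); last first.
  by apply/funext => y; rewrite /centered_green -/c0; ring.
rewrite gintD; last 2 first.
- exact: bmeasB.
- exact: bmeasZ.
by rewrite gintZ// f0 mulr0 addr0 gintB.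
Qed.

(** Green's identity with [f'' = - mu f] almost everywhere on each edge. *)
Lemma eigenfunction_kop mu f x : mu != 0 -> kirchhoff_eigenfunction mu f ->
  mu * kop green f x = f x - f (Vertex u0).
Proof.
move=> mu0 [Df _ fae]; have [cf H2 _] := Df.
have bf := graph_continuous_bmeas cf; have bg := bker_green u0.
rewrite -[RHS]opprB -(green_identity u0 x Df) /kop /gint big_distrr -sumrN /=.
apply: eq_bigr => e _.
have bgf : bmeas (fun y => - mu * (f y * green x y)).
  by apply: bmeasZ; apply: bmeasM => //; exact: bker_section.
have iv := deriv2_integrable e Df (bker_section x bg).
have [] := @ae_eq_Rintegral _ `[0, len e]%classic
  (edge_fun (fun y => - mu * (f y * green x y)) e)
  (fun t => edge_deriv 2 f e t * edge_fun (green x) e t) => //.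
- by move/integrableP: iv => [/measurable_EFinP].
- exact: bmeas_edge_integrable.
- have fil : Filter (almost_everywhere leb) := ae_filter_ringOfSetsType leb.
  apply: filterS (fae e) => t h tl; have := h tl; rewrite /edge_fun => /eqP.
  by rewrite eqr_oppLR => /eqP ->; ring.
have i1 := bmeas_edge_integrable e (kop_integrand x bg bf).
move=> _ ->; apply: (@oppr_inj R); rewrite opprK -mulNr -RintegralZl//.
by apply: eq_Rintegral => t _; rewrite /edge_fun; ring.
Qed.

(** Evaluation of [eigenfunction_kop] at [u0]: the right side vanishes there, and the Green function
    at [u0] is the constant 1. *)
Lemma eigenfunction_gint mu f : mu != 0 -> kirchhoff_eigenfunction mu f -> gint f = 0.
Proof.
move=> mu0 ef; have := eigenfunction_kop (Vertex u0) mu0 ef.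
rewrite subrr => /eqP; rewrite mulf_eq0 (negbTE mu0) /= => /eqP <-.
by rewrite /kop; congr gint; apply/funext => y; rewrite greenC green_u0 mul1r.
Qed.

(** The two sides differ by a constant and both have integral zero, so the constant vanishes once
    the total length does not. *)
Lemma eigenfunction_kop_centered mu f x : mu != 0 -> total_len (G := G) != 0 ->
  kirchhoff_eigenfunction mu f -> kop centered_green f x = f x / mu.
Proof.
move=> mu0 L0 ef; have f0 := eigenfunction_gint mu0 ef; have [[cf _ _] _ _] := ef.
have bf := graph_continuous_bmeas cf.
pose c := gint (fun y => gmean (green y) * f y) + f (Vertex u0) / mu.
have E y : kop centered_green f y = mu^-1 * f y - c.
  rewrite kop_centered_green// -[kop green f y](mulKf mu0) (eigenfunction_kop _ mu0 ef) /c.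
  ring.
have c0 : c = 0.
  have := gint_kop_centered_green bf; rewrite (_ : kop _ _ = fun y => mu^-1 * f y - c); last exact/funext.
  rewrite gintB; last exact: bmeas_cst; last exact: bmeasZ.
  rewrite gintZ// f0 mulr0 gint_cst sub0r => /eqP; rewrite oppr_eq0 mulf_eq0 (negbTE L0) orbF.
  by move/eqP.
by rewrite E c0 subr0 mulrC.
Qed.

End CenteredGreen.

(** * Bessel's inequality and truncation of the centered kernel *)

Section Bessel.
Context {R : realType} {G : metric_graph R}.
Variables (psi : nat -> gpoint G -> R) (S : seq nat).
Hypotheses (bpsi : forall k, bmeas (psi k)) (uS : uniq S).
Hypothesis orth : forall j k, j \in S -> k \in S ->
  gint (fun x => psi j x * psi k x) = (j == k)%:R.

Lemma gint_lincomb v c : bmeas v ->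
  gint (fun x => v x * (\sum_(k <- S) c k * psi k x)) =
  \sum_(k <- S) c k * gint (fun x => v x * psi k x).
Proof.
move=> bv; rewrite (_ : (fun x => _) = fun x => \sum_(k <- S) c k * (v x * psi k x)).
  rewrite gint_sum => [|k]; last by apply: bmeasZ; exact: bmeasM.
  by apply: eq_bigr => k _; rewrite gintZ//; exact: bmeasM.
by apply/funext => x; rewrite big_distrr; apply: eq_bigr => k _; rewrite mulrCA.
Qed.

Lemma sum_delta_seq (F : nat -> R) j : j \in S -> \sum_(k <- S) F k * (k == j)%:R = F j.
Proof.
move=> jS; rewrite (bigD1_seq j)//= eqxx mulr1 big1 ?addr0// => k /negbTE->.
by rewrite mulr0.
Qed.

Lemma bessel_identity v c : bmeas v ->
  gint (fun x => (v x - \sum_(k <- S) c k * psi k x) ^+ 2) =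
  gint (fun x => v x ^+ 2) - \sum_(k <- S) gint (fun x => v x * psi k x) ^+ 2 +
  \sum_(k <- S) (gint (fun x => v x * psi k x) - c k) ^+ 2.
Proof.
move=> bv; pose s x := \sum_(k <- S) c k * psi k x; pose b k := gint (fun x => v x * psi k x).
have bs : bmeas s by apply: bmeas_sum => k; exact: bmeasZ.
rewrite (_ : (fun x => _) = fun x => (1 * v x + -1 * s x) ^+ 2); last first.
  by apply/funext => x; rewrite mul1r mulN1r.
rewrite gint_expand// gint_lincomb//.
have -> : gint (fun x => s x ^+ 2) = \sum_(k <- S) c k ^+ 2.
  rewrite (_ : (fun x => _) = fun x => s x * \sum_(k <- S) c k * psi k x); last exact/funext.
  rewrite gint_lincomb//; apply: eq_big_seq => k kS; rewrite expr2; congr (_ * _).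
  rewrite (_ : (fun x => _) = fun x => psi k x * s x); last by apply/funext => x; rewrite mulrC.
  rewrite gint_lincomb// -[RHS](sum_delta_seq c kS); apply: eq_big_seq => j jS.
  by rewrite orth// eq_sym.
have -> : \sum_(k <- S) (b k - c k) ^+ 2 = \sum_(k <- S) b k ^+ 2 -
    2 * (\sum_(k <- S) c k * b k) + \sum_(k <- S) c k ^+ 2.
  by rewrite big_distrr -sumrB -big_split; apply: eq_bigr => k _ /=; ring.
by rewrite -/(b _); ring.
Qed.

Lemma bessel_ineq v : bmeas v ->
  \sum_(k <- S) gint (fun x => v x * psi k x) ^+ 2 <= gint (fun x => v x ^+ 2).
Proof.
move=> bv; rewrite -subr_ge0.
have := bessel_identity (fun k => gint (fun x => v x * psi k x)) bv.
rewrite [X in _ = _ + X]big1 ?addr0 => [<-|k _]; last by rewrite subrr expr0n.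
apply: gint_ge0 => [|x]; last exact: sqr_ge0.
have bs : bmeas (fun x => v x - \sum_(k <- S) gint (fun x => v x * psi k x) * psi k x).
  by apply: bmeasB => //; apply: bmeas_sum => k; exact: bmeasZ.
exact: (bmeasM bs bs).
Qed.

End Bessel.

Section Truncation.
Context {R : realType} {G : metric_graph R}.
Notation leb := (@lebesgue_measure R).
Variables (u0 : vertex G) (K : set nat) (lam : nat -> R) (phi : nat -> gpoint G -> R).
Hypotheses (spec : kirchhoff_spectrum K lam phi) (bphi : forall k, bmeas (phi k)).
Implicit Types (f w : gpoint G -> R) (x y : gpoint G) (e : edge G).
Local Notation Kc := (centered_green u0).
Let bK := bker_centered_green u0.

Let lam_gt0 k : K k -> 0 < lam k. Proof. by case: spec => + _ _ _; apply. Qed.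

Let orth j k : K j -> K k -> gint (fun x => phi j x * phi k x) = (j == k)%:R.
Proof. by case: spec => _ _ + _; apply. Qed.

Lemma spectrum_total_len k : K k -> total_len (G := G) != 0.
Proof.
move=> Kk; apply/eqP => L0; have [_ [M hM]] := bmeasM (bphi k) (bphi k).
have := gint_norm_le (bmeasM (bphi k) (bphi k)) hM.
by rewrite L0 mulr0 orth// eqxx normr1 ler10.
Qed.

Lemma kop_centered_eigen k x : K k -> kop Kc (phi k) x = phi k x / lam k.
Proof.
move=> Kk; have [_ /(_ _ Kk) ef _ _] := spec.
by apply: eigenfunction_kop_centered ef; [rewrite gt_eqF// lam_gt0|exact: spectrum_total_len Kk].
Qed.

Definition truncated (S : seq nat) x y : R :=
  Kc x y - \sum_(k <- S) phi k x / lam k * phi k y.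

Lemma truncatedC S x y : truncated S x y = truncated S y x.
Proof.
rewrite /truncated centered_greenC; congr (_ - _); apply: eq_bigr => k _; ring.
Qed.

Lemma bker_truncated S : bker (truncated S).
Proof.
apply: bkerB => //; apply: bker_sum => k.
have := bker_tensor (bmeasZ (lam k)^-1 (bphi k)) (bphi k); congr bker.
by apply/funext => x; apply/funext => y; rewrite (mulrC _ (phi k x)).
Qed.

Lemma kop_truncated S f x : bmeas f ->
  kop (truncated S) f x =
  kop Kc f x - \sum_(k <- S) gint (fun y => f y * phi k y) / lam k * phi k x.
Proof.
move=> bf; rewrite [LHS](_ : _ = gint (fun y => Kc x y * f y -
    f y * \sum_(k <- S) phi k x / lam k * phi k y)); last first.
  by congr gint; apply/funext => y; rewrite /truncated mulrBl [X in _ - X]mulrC.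
rewrite gintB; last 2 first.
- exact: kop_integrand.
- by apply: bmeasM => //; apply: bmeas_sum => k; exact: bmeasZ.
rewrite (gint_lincomb S bphi (fun k => phi k x / lam k) bf); congr (_ - _).
by apply: eq_bigr => k _; ring.
Qed.

(* An eigenfunction f of the truncated kernel is orthogonal to phi k for k in S,
   hence an eigenfunction of the centered Green kernel, hence a Kirchhoff
   eigenfunction; the listed phi k that span its eigenspace all lie in S. *)
Lemma truncated_no_eigenfunction S eps alpha f : uniq S -> (forall k, k \in S -> K k) ->
  0 <= eps -> (forall k, K k -> eps < (lam k)^-1 -> k \in S) ->
  bmeas f -> eps < `|alpha| ->
  (forall x, kop (truncated S) f x = alpha * f x) -> forall x, f x = 0.
Proof.
move=> uS SK eps0 hS bf epsa eig.
have a0 : alpha != 0 by rewrite -normr_gt0 (le_lt_trans eps0).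
have orthS j k : j \in S -> k \in S -> gint (fun x => phi j x * phi k x) = (j == k)%:R.
  by move=> /SK Kj /SK Kk; exact: orth.
have bKf : bmeas (kop Kc f) by exact: kop_bmeas.
have orthf k : k \in S -> gint (fun x => f x * phi k x) = 0.
  move=> kS; apply: (mulfI a0); rewrite mulr0.
  have bfk : bmeas (fun x => f x * phi k x) by exact: bmeasM.
  rewrite -gintZ//.
  transitivity (gint (fun x => kop (truncated S) f x * phi k x)).
    by congr gint; apply/funext => x; rewrite eig mulrA.
  rewrite kop_adjoint//; [|exact: bker_truncated|exact: truncatedC].
  transitivity (gint (fun x : gpoint G => 0 : R)); last by rewrite gint_cst mul0r.
  congr gint; apply/funext => x; rewrite kop_truncated// (kop_centered_eigen _ (SK _ kS)).
  rewrite (bigD1_seq k)//= orthS// eqxx big1_seq ?addr0 => [|j /andP[jk jS]].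
    by rewrite mul1r (mulrC (phi k x)) subrr mulr0.
  by rewrite orthS// eq_sym (negbTE jk) !mul0r.
have eigc x : kop Kc f x = alpha * f x.
  rewrite -eig kop_truncated// big1_seq ?subr0// => k /andP[_ kS].
  by rewrite orthf// !mul0r.
have f0 : gint f = 0.
  apply: (mulfI a0); rewrite mulr0 -gintZ// -(gint_kop_centered_green u0 bf).
  by congr gint; apply/funext => x; rewrite eigc.
pose g x := alpha^-1 * f x.
have bg : bmeas g by exact: bmeasZ.
have g0 : gint g = 0 by rewrite gintZ// f0 mulr0.
pose c := gint (fun y => gmean (green u0 y) * g y).
(* Regularity from the equation: [f] is an image of the Green operator, hence continuous; then [g]
   is continuous, and [f] lies in the Kirchhoff domain. *)
have fE : f = fun x => kop (green u0) g x - c.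
  apply/funext => x; rewrite /c -kop_centered_green// kopZ// eigc mulKf//.
have cf : graph_continuous f.
  rewrite fE => e; have h := @kop_green_continuous _ _ u0 _ bg e.
  exact: (within_continuousBc (c := c) (f := edge_fun (kop (green u0) g) e) h).
have cg : graph_continuous g.
  move=> e; have /subspace_continuousP h := cf e; apply/subspace_continuousP => t tl.
  by apply: cvgM; [exact: cvg_cst|exact: h].
have Df : kirchhoff_domain f.
  by rewrite fE; apply: kirchhoff_domainBc; exact: kop_green_domain.
have ff0 : gint (fun x => f x ^+ 2) = 0.
  have [allz|/existsNP[x fx]] := pselect (forall x, f x = 0).
    transitivity (gint (fun x : gpoint G => 0 : R)); last by rewrite gint_cst mul0r.
    by congr gint; apply/funext => x; rewrite allz expr0n.
  have [_ _ _ /(_ alpha^-1 f)] := spec; rewrite invr_eq0 => /(_ a0)[].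
    split => //; first by exists x; apply/eqP.
    move=> e; apply: aeW => t tl; have {}tl : 0 <= t <= len e by move: tl; rewrite /= in_itv.
    rewrite [in LHS]fE (edge_derivBc 1 (kop (green u0) g)) kop_green_deriv2// opprK.
    by [].
  move=> s [d [sK fs]].
  rewrite (_ : (fun x => _) = fun x => f x * \sum_(k <- s) d k * phi k x); last first.
    by apply/funext => y; rewrite -fs expr2.
  rewrite gint_lincomb// big1_seq// => k /andP[_ /sK[Kk lk]].
  rewrite orthf ?mulr0//; apply: hS => //.
  have := lam_gt0 Kk; rewrite lk invrK invr_gt0 => a1.
  by rewrite gtr0_norm in epsa.
(* A zero norm gives vanishing at every point, not just almost everywhere, because [alpha * f x] is
   an integral of [f] against a section of the kernel. *)
move=> x; apply: (mulfI a0); rewrite mulr0 -eigc; apply/eqP; rewrite -sqrf_eq0.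
rewrite eq_le sqr_ge0 andbT -(mulr0 (gint (fun y => Kc x y ^+ 2))) -ff0.
by apply: gint_cauchy_schwarz => //; exact: bker_section.
Qed.

End Truncation.

(** * Uniform approximation of kernel sections by the range of the operator *)

Section Density.
Context {R : realType} {G : metric_graph R}.
Notation leb := (@lebesgue_measure R).
Variable u0 : vertex G.
Implicit Types (f w : gpoint G -> R) (x y z : gpoint G) (e : edge G).
Local Notation Kc := (centered_green u0).

Lemma centered_green_lipschitz e : exists2 c, 0 <= c & forall y s t,
  0 <= s <= len e -> 0 <= t <= len e ->
  `|Kc y (on_edge e t) - Kc y (on_edge e s)| <= c * `|t - s|.
Proof.
have [c c0 gc] := green_lipschitz u0 e; exists (2 * c); first exact: mulr_ge0.
have bg x : bmeas (green u0 x) by apply: bker_section; exact: bker_green.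
have main y s t : 0 <= s -> s <= t -> t <= len e ->
    `|Kc y (on_edge e t) - Kc y (on_edge e s)| <= 2 * c * (t - s).
  move=> s0 st tl; rewrite /centered_green !(greenC _ y).
  rewrite [X in `|X|](_ : _ = (green u0 (on_edge e t) y - green u0 (on_edge e s) y) -
    (gmean (green u0 (on_edge e t)) - gmean (green u0 (on_edge e s)))); last by ring.
  rewrite (le_trans (ler_normB _ _))// -mulrA mulr_natl mulr2n; apply: lerD; first exact: gc.
  rewrite -gmeanB//; apply: gmean_norm_le => [||x]; first exact: bmeasB.
    by rewrite mulr_ge0// subr_ge0.
  exact: gc.
move=> y s t /andP[s0 sl] /andP[t0 tl]; have [st|/ltW ts] := leP s t.
  by rewrite (ger0_norm (_ : 0 <= t - s)) ?subr_ge0//; exact: main.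
by rewrite distrC (distrC t) (ger0_norm (_ : 0 <= s - t)) ?subr_ge0//; exact: main.
Qed.

(** The normalized indicator of an arc, expressed through [pos]. The condition [0 < a] separates the
    arc from the points off [e] and from both ends, where [pos] is 0. *)
Lemma arc_indicator e (a b : R) : 0 < a -> a < b -> b < len e ->
  exists u, [/\ bmeas u, forall z, 0 <= u z, gint u = 1 &
    forall z, u z != 0 -> exists2 t, a <= t <= b & z = on_edge e t].
Proof.
move=> a0 ab bl; pose i (t : R) : R := \1_(`[a, b]%classic) t.
pose u z := (b - a)^-1 * i (pos z e).
have ba : 0 < b - a by rewrite subr_gt0.
have i01 t : 0 <= i t by rewrite /i indicE.
exists u; split.
- apply: bmeasZ; split; last first.
    by exists 1 => z; rewrite ger0_norm// /i indicE; case: (_ \in _).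
  move=> e'; apply: (measurableT_comp _ ((bmeas_pos e).1 e')).
  exact: measurable_indic.
- by move=> z; rewrite mulr_ge0// invr_ge0 ltW.
- have uE e' t : 0 <= t <= len e' -> edge_fun u e' t =
      (if e' == e then (b - a)^-1 * i t else 0).
    move=> tl; rewrite /edge_fun /u pos_on_edge//; case: eqVneq => [ee|_] /=; last first.
      by rewrite /i indicE memNset ?mulr0//= in_itv/= leNgt a0.
    case: ltP => // lt; rewrite /i !indicE !memNset//= in_itv/=.
      by rewrite [X in _ && X]leNgt (lt_le_trans bl) ?andbF// -ee.
    by rewrite leNgt a0.
  rewrite /gint (bigD1 e)//= [X in _ + X]big1 ?addr0 => [|e' /negbTE ee'].
    transitivity (\int[leb]_(t in `[0, len e]) ((b - a)^-1 * i t)).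
      apply: eq_Rintegral => t /set_mem; rewrite /= in_itv/= => tl.
      by rewrite uE// eqxx.
    rewrite RintegralZl//; last first.
      apply: (@bounded_itv_integrable _ _ _ 1); first exact: measurable_indic.
      by move=> t; rewrite ger0_norm// /i indicE; case: (_ \in _).
    rewrite /Rintegral /i integral_indic// setIidl; last first.
      by apply: subset_itvScc; rewrite bnd_simp ltW.
    transitivity ((b - a)^-1 * fine (leb `[a, b]%classic)); first by [].
    by rewrite lebesgue_measure_itv/= lte_fin ab /= mulVf// gt_eqF.
  transitivity (\int[leb]_(t in `[0, len e']) (0 : R)).
    apply: eq_Rintegral => t /set_mem; rewrite /= in_itv/= => tl.
    by rewrite uE// ee'.
  by rewrite Rintegral_cst// mul0r.
move=> z; rewrite /u /i indicE mulf_eq0 negb_or => /andP[_].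
have [/set_mem|] := boolP (pos z e \in _); last by rewrite eqxx.
rewrite /= in_itv/= => zab _; exists (pos z e) => //.
case: z zab => [v|e' t] /=; first by rewrite leNgt a0.
case: eqVneq => [ee|_]; last by rewrite leNgt a0.
by subst e'; rewrite on_edge_inner.
Qed.

(** With [u] the uniform density on a short arc close to [x], [kop Kc u y] is an average of the
    values of [Kc y] near [x], and [Kc y] is Lipschitz on the edge uniformly in [y]. *)
Lemma centered_green_approx (e0 : edge G) x (eta : R) : 0 < eta ->
  exists2 u, bmeas u & forall y, `|kop Kc u y - Kc y x| <= eta.
Proof.
move=> eta0; have bK := bker_centered_green u0.
have [e [s [sl ->]]] := on_edgeP e0 x; have l0 := len_gt0 e.
have [c c0 hc] := centered_green_lipschitz e.
have c1 : 0 < c + 1 by rewrite ltr_wpDl.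
(* The first bound leaves room, on at least one side of [s], for an arc inside the open edge; the
   second makes the Lipschitz error at most [eta]. *)
pose d := Num.min (len e / 4) (eta / (c + 1)).
have d0 : 0 < d by rewrite lt_min !divr_gt0.
have d1 : d <= len e / 4 by rewrite ge_min lexx.
have d2 : c * d <= eta.
  have : d <= eta / (c + 1) by rewrite ge_min lexx orbT.
  rewrite ler_pdivlMr// => /(le_trans _); apply; rewrite mulrC; apply: ler_wpM2l; lra.
have [a [b [a0 ab bl hab]]] : exists a b, [/\ 0 < a, a < b, b < len e &
    forall t, a <= t <= b -> `|t - s| <= d].
  have [h|h] := leP s (len e / 2); [exists (s + d / 2), (s + d)|exists (s - d), (s - d / 2)];
    split; try lra; by move=> t /andP[? ?]; rewrite ler_norml; lra.
have [u [bu uge u1 usupp]] := arc_indicator a0 ab bl; exists u => // y.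
have near z : `|Kc y z * u z - Kc y (on_edge e s) * u z| <= eta * u z.
  rewrite -mulrBl normrM (ger0_norm (uge z)).
  have [->|uz] := eqVneq (u z) 0; first by rewrite !mulr0.
  apply: ler_wpM2r => //; have [t tab ->] := usupp z uz.
  apply: (le_trans (hc _ _ _ _ _)) => //.
    by case/andP: tab => *; apply/andP; lra.
  by apply: (le_trans _ d2); apply: ler_wpM2l => //; exact: hab.
have bKu : bmeas (fun z => Kc y z * u z) by exact: kop_integrand.
have bc : bmeas (fun z => Kc y (on_edge e s) * u z) by exact: bmeasZ.
have -> : kop Kc u y - Kc y (on_edge e s) =
    gint (fun z => Kc y z * u z - Kc y (on_edge e s) * u z).
  by rewrite gintB// gintZ// u1 mulr1.
have bd := bmeasB bKu bc; rewrite ler_norml; apply/andP; split.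
  rewrite -[leLHS]mulr1 -u1 -gintZ//; apply: le_gint => //; first exact: bmeasZ.
  by move=> z; have := near z; rewrite ler_norml mulNr => /andP[].
rewrite -[leRHS]mulr1 -u1 -gintZ//; apply: le_gint => //; first exact: bmeasZ.
by move=> z; have := near z; rewrite ler_norml => /andP[].
Qed.

End Density.

(** * Parseval's identity for increments of the Green function *)

Section Parseval.
Context {R : realType} {G : metric_graph R}.
Notation leb := (@lebesgue_measure R).
Variables (u0 : vertex G) (K : set nat) (lam : nat -> R) (phi : nat -> gpoint G -> R).
Hypotheses (spec : kirchhoff_spectrum K lam phi) (bphi : forall k, bmeas (phi k)).
Implicit Types (f w : gpoint G -> R) (x y : gpoint G) (e : edge G).
Local Notation Kc := (centered_green u0).
Let bK := bker_centered_green u0.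

Let lam_gt0 k : K k -> 0 < lam k. Proof. by case: spec => + _ _ _; apply. Qed.

Let orth (S : seq nat) j k : (forall k, k \in S -> K k) -> j \in S -> k \in S ->
  gint (fun x => phi j x * phi k x) = (j == k)%:R.
Proof. by move=> SK /SK Kj /SK Kk; case: spec => _ _ + _; apply. Qed.

(** Bessel's inequality for the section at [x], whose coefficient on [phi k] is [phi k x / lam k],
    integrated over [x]. *)
Lemma sum_inv_eigenvalue_sq (S : seq nat) : uniq S -> (forall k, k \in S -> K k) ->
  \sum_(k <- S) (lam k)^-1 ^+ 2 <= hs Kc Kc.
Proof.
move=> uS SK.
have b2 k : bmeas (fun x => (lam k)^-1 ^+ 2 * phi k x ^+ 2).
  by apply: bmeasZ; exact: (bmeasM (bphi k) (bphi k)).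
have -> : \sum_(k <- S) (lam k)^-1 ^+ 2 =
    gint (fun x => \sum_(k <- S) (lam k)^-1 ^+ 2 * phi k x ^+ 2).
  rewrite gint_sum//; apply: eq_big_seq => k kS.
  by rewrite gintZ; [rewrite (orth SK kS kS) eqxx mulr1|exact: (bmeasM (bphi k) (bphi k))].
apply: le_gint => [||x]; first exact: bmeas_sum.
  by apply: bker_gint; exact: bkerM.
have bKx := bker_section x bK.
apply: le_trans (bessel_ineq bphi uS (fun j k => @orth S j k SK) bKx).
rewrite [leRHS]big_seq [leLHS]big_seq; apply: ler_sum => k kS.
rewrite [X in _ <= X ^+ 2](kop_centered_eigen u0 spec bphi x (SK _ kS)).
by rewrite mulrC -exprMn.
Qed.

(** Each index with [eps < (lam k)^-1] contributes more than [eps ^+ 2] to sums bounded by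
    [hs Kc Kc], so there are finitely many. *)
Lemma spectrum_finite eps : 0 < eps -> exists S : seq nat, [/\ uniq S, forall k, k \in S -> K k &
  forall k, K k -> eps < (lam k)^-1 -> k \in S].
Proof.
move=> eps0; pose A := [set k | K k /\ eps < (lam k)^-1].
have [/finite_seqP[s As]|infA] := pselect (finite_set A).
  exists (undup s); split; first exact: undup_uniq.
    by move=> k; rewrite mem_undup => ks; have [] : A k by rewrite As.
  by move=> k Kk lk; rewrite mem_undup; have : A k by []; rewrite As.
have [B BA Bn] := infinite_set_fset (Num.truncn (hs Kc Kc / eps ^+ 2)).+1 infA.
set S : seq nat := finmap.enum_fset B in Bn.
have SA k : k \in S -> A k by move=> kS; apply: BA.
have uS : uniq S by exact: finmap.fset_uniq.
have := sum_inv_eigenvalue_sq uS (fun k kS => (SA k kS).1).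
rewrite leNgt => /negP[]; apply: (@lt_le_trans _ _ (\sum_(k <- S) eps ^+ 2)); last first.
  rewrite [leRHS]big_seq [leLHS]big_seq; apply: ler_sum => k /SA[_ lk].
  by rewrite lerXn2r ?nnegrE// ltW// (lt_trans eps0).
have e2 : 0 < eps ^+ 2 by rewrite exprn_gt0.
rewrite big_const_seq count_predT iter_addr addr0 -mulr_natr mulrC -ltr_pdivrMr//.
have hh : 0 <= hs Kc Kc by exact: hs_ge0.
apply: (lt_le_trans (truncnS_gt _)).
by rewrite ler_nat.
Qed.

Let w x1 x2 := zero_mean (green_diff u0 x1 x2).

Let bw x1 x2 : bmeas (w x1 x2).
Proof. by apply: zero_mean_bmeas; apply: bmeasB; apply: bker_section; exact: bker_green. Qed.

Lemma green_diff_coefficient x1 x2 k : K k ->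
  gint (fun y => w x1 x2 y * phi k y) = (phi k x1 - phi k x2) / lam k.
Proof.
move=> Kk; rewrite mulrBl -!(kop_centered_eigen u0 spec bphi _ Kk) /kop -gintB; try exact: kop_integrand.
by congr gint; apply/funext => y; rewrite /w centered_green_diff mulrBl.
Qed.

Lemma parseval_upper x1 x2 (S : seq nat) : uniq S -> (forall k, k \in S -> K k) ->
  \sum_(k <- S) (phi k x1 - phi k x2) ^+ 2 / lam k ^+ 2 <= gint (fun y => w x1 x2 y ^+ 2).
Proof.
move=> uS SK.
apply: le_trans (bessel_ineq bphi uS (fun j k => @orth S j k SK) (bw x1 x2)).
rewrite [leRHS]big_seq [leLHS]big_seq; apply: ler_sum => k kS.
by rewrite green_diff_coefficient ?expr_div_n//; exact: SK.
Qed.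

(* The operator of centered_green has large range: w is uniformly close to
   the image of some u, on which the Schmidt bound controls the truncation error. *)
Lemma parseval_lower x1 x2 delta : 0 < delta -> exists S : seq nat, [/\ uniq S,
  forall k, k \in S -> K k & gint (fun y => w x1 x2 y ^+ 2) <=
  \sum_(k <- S) (phi k x1 - phi k x2) ^+ 2 / lam k ^+ 2 + delta].
Proof.
move=> delta0; case: (pickP [pred e : edge G | true]) => [e0 _|noe]; last first.
  by exists [::]; split => //; rewrite /gint big1 ?big_nil ?add0r ?ltW// => e; have := noe e.
pose L := total_len (G := G); have L0 : 0 <= L by exact: total_len_ge0.
(* The approximation error [p] is at most [2 * eta], so twice its squared norm is at most
   [8 * eta ^+ 2 * L], that is at most [delta / 2]. The added 1 covers [L = 0]. *)
pose eta := Num.sqrt (delta / (16 * (L + 1))).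
have q0 : 0 < delta / (16 * (L + 1)) by rewrite divr_gt0// mulr_gt0// ltr_wpDl.
have eta0 : 0 < eta by rewrite sqrtr_gt0.
have [u1 bu1 hu1] := centered_green_approx u0 e0 x1 eta0.
have [u2 bu2 hu2] := centered_green_approx u0 e0 x2 eta0.
pose u y := u1 y - u2 y; have bu : bmeas u by exact: bmeasB.
pose U := gint (fun y => u y ^+ 2).
have U0 : 0 <= U by apply: gint_ge0 => [|y]; [exact: bmeasM|exact: sqr_ge0].
(* The Schmidt bound makes twice the squared norm of the tail [h] at most [2 * eps ^+ 2 * U], that
   is at most [delta / 2]. *)
pose eps := Num.sqrt (delta / (4 * (U + 1))).
have p0 : 0 < delta / (4 * (U + 1)) by rewrite divr_gt0// mulr_gt0// ltr_wpDl.
have eps0 : 0 < eps by rewrite sqrtr_gt0.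
have [S [uS SK hS]] := spectrum_finite eps0; exists S; split => //.
pose p y := w x1 x2 y - kop Kc u y.
pose h := kop (truncated u0 lam phi S) u.
have bT := bker_truncated u0 lam bphi S.
have bp : bmeas p by apply: bmeasB => //; exact: kop_bmeas.
have bh : bmeas h by exact: kop_bmeas.
have pE y : `|p y| <= 2 * eta.
  rewrite /p /w centered_green_diff /u kopB//.
  rewrite (centered_greenC _ x1) (centered_greenC _ x2).
  rewrite [X in `|X|](_ : _ = (kop Kc u2 y - Kc y x2) - (kop Kc u1 y - Kc y x1)); last by ring.
  by rewrite (le_trans (ler_normB _ _))// mulr_natl mulr2n lerD.
have ph : gint (fun y => p y ^+ 2) <= 4 * eta ^+ 2 * L.
  apply: gint_le_cst => [|y]; first exact: (bmeasM bp bp).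
  rewrite -[leLHS](ger0_norm (sqr_ge0 _)) normrX.
  rewrite (_ : 4 * eta ^+ 2 = (2 * eta) ^+ 2); last by ring.
  by rewrite lerXn2r ?nnegrE// mulr_ge0// ltW.
have hh : gint (fun y => h y ^+ 2) <= eps ^+ 2 * U.
  apply: (schmidt_bound bT _ (ltW eps0)) => //; first exact: truncatedC.
  move=> alpha f bf ea eig.
  exact: (truncated_no_eigenfunction spec bphi uS SK (ltW eps0) hS bf ea eig).
pose c k := gint (fun y => u y * phi k y) / lam k.
(* The sum with coefficients [c] is what truncation removes from [kop Kc u], so the remainder is the
   approximation error plus the truncated image of [u]. *)
have rE : (fun y => w x1 x2 y - \sum_(k <- S) c k * phi k y) = fun y => p y + h y.
  by apply/funext => y; rewrite /p /h kop_truncated//; ring.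
have r_le : gint (fun y => (w x1 x2 y - \sum_(k <- S) c k * phi k y) ^+ 2) <=
    2 * gint (fun y => p y ^+ 2) + 2 * gint (fun y => h y ^+ 2).
  have bp2 := bmeasM bp bp; have bh2 := bmeasM bh bh.
  rewrite -!gintZ// -gintD; try exact: bmeasZ.
  under [in leLHS]eq_fun do rewrite (congr1 (fun g => g _) rE).
  apply: le_gint => [||y].
  - have bD := bmeasD bp bh; exact: (bmeasM bD bD).
  - by apply: bmeasD; exact: bmeasZ.
  - have := sqr_ge0 (p y - h y); rewrite !expr2; nra.
have := bessel_identity bphi uS (fun j k => @orth S j k SK) c (bw x1 x2).
(* The coefficients [c] belong to [kop Kc u] and not to [w]. Their discrepancy [T] enters Bessel's
   identity with a favourable sign. *)
set T := \sum_(k <- S) (gint _ - c k) ^+ 2.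
have T0 : 0 <= T by apply: sumr_ge0 => k _; exact: sqr_ge0.
have -> : \sum_(k <- S) gint (fun y => w x1 x2 y * phi k y) ^+ 2 =
    \sum_(k <- S) (phi k x1 - phi k x2) ^+ 2 / lam k ^+ 2.
  apply: eq_big_seq => k kS.
  by rewrite green_diff_coefficient ?expr_div_n//; exact: SK.
have eta2 : 8 * eta ^+ 2 * L <= delta / 2.
  rewrite sqr_sqrtr ?(ltW p0) ?(ltW q0)// (_ : _ * L = delta / 2 * (L / (L + 1))); last by field; lra.
  apply: ler_piMr; first lra.
  by rewrite ler_pdivrMr ?mul1r ?lerDl// ltr_wpDl.
have eps2 : 2 * eps ^+ 2 * U <= delta / 2.
  rewrite sqr_sqrtr ?(ltW p0) ?(ltW q0)// (_ : _ * U = delta / 2 * (U / (U + 1))); last by field; lra.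
  apply: ler_piMr; first lra.
  by rewrite ler_pdivrMr ?mul1r ?lerDl// ltr_wpDl.
lra.
Qed.

End Parseval.

Section BiharmonicKernel.
Context {R : realType} {G : metric_graph R}.

(** A spectrum says nothing about [phi k] for [k] outside [K]; setting these to 0 makes the whole
    sequence bounded and measurable. *)
Lemma kirchhoff_spectrum_bmeas (K : set nat) lam (phi : nat -> gpoint G -> R) :
  kirchhoff_spectrum K lam phi -> exists2 psi, kirchhoff_spectrum K lam psi &
    (forall k, bmeas (psi k)) /\ forall k, K k -> psi k = phi k.
Proof.
move=> [lam0 eig orth spn].
pose psi k : gpoint G -> R := if pselect (K k) then phi k else fun=> 0.
have psiE k : K k -> psi k = phi k by rewrite /psi; case: pselect.
exists psi.
  split => // [k Kk|j k Kj Kk|mu f mu0 ef]; rewrite ?psiE//; first exact: eig.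
    exact: orth.
  have [s [c [sK fE]]] := spn mu f mu0 ef; exists s, c; split => // x.
  by rewrite fE; apply: eq_big_seq => k /sK[Kk _]; rewrite psiE.
split => // k; have [Kk|nKk] := pselect (K k); last first.
  have -> : psi k = fun=> 0 by rewrite /psi; case: pselect.
  exact: bmeas_cst.
rewrite psiE//; by have [[cf _ _] _ _] := eig _ Kk; exact: graph_continuous_bmeas.
Qed.

(** The series is a supremum over finite subsets of [K]: [parseval_upper] bounds every one of them,
    and [parseval_lower] comes within any [delta]. *)
Lemma biharmonic_sqE (u0 : vertex G) (K : set nat) lam (phi : nat -> gpoint G -> R) x1 x2 :
  kirchhoff_spectrum K lam phi ->
  biharmonic_sq K lam phi x1 x2 =
  (gint (fun y => zero_mean (green_diff u0 x1 x2) y ^+ 2))%:E.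
Proof.
move=> /kirchhoff_spectrum_bmeas[psi spec [bpsi psiE]].
have termE (s : seq nat) : (forall k, k \in s -> K k) ->
    (\sum_(k <- s) ((phi k x1 - phi k x2) ^+ 2 / lam k ^+ 2)%:E)%E =
    (\sum_(k <- s) (psi k x1 - psi k x2) ^+ 2 / lam k ^+ 2)%:E.
  by move=> sK; rewrite sumEFin; congr EFin; apply: eq_big_seq => k /sK Kk; rewrite psiE.
rewrite /biharmonic_sq; apply/eqP; rewrite eq_le; apply/andP; split.
  apply: ge_ereal_sup => _ [A [finA AK] <-].
  have sK k : k \in finmap.enum_fset (fset_set A) -> K k.
    by move=> kA; apply: AK; move: kA; rewrite in_fset_set// => /set_mem.
  rewrite fsbig_finite//= termE// lee_fin.
  by apply: (parseval_upper u0 spec bpsi) => //; exact: finmap.fset_uniq.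
apply/lee_addgt0Pr => delta delta0.
have [S [uS SK hS]] := parseval_lower u0 spec bpsi x1 x2 delta0.
apply: (@le_trans _ _ ((\sum_(k <- S) (psi k x1 - psi k x2) ^+ 2 / lam k ^+ 2)%:E + delta%:E)%E).
  by rewrite -EFinD lee_fin.
rewrite leeD2r//; apply: esum_ge; exists [set` S].
  split; first exact: finite_seq.
  by move=> k /= /SK.
by rewrite -fsbig_seq// termE.
Qed.

End BiharmonicKernel.

(** * Gaussian processes *)

Section SquareIntegrable.
Context {d : measure_display} {T : measurableType d} {R : realType}.
Variable P : probability T R.
Implicit Types X Y Z : T -> R.

Definition sqint X := measurable_fun setT X /\
  P.-integrable setT (EFin \o (fun w => X w ^+ 2)).

Lemma sqint_mul X Y : sqint X -> sqint Y ->
  P.-integrable setT (EFin \o (fun w => X w * Y w)).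
Proof.
move=> [mX iX] [mY iY]; pose X2 w := X w ^+ 2; pose Y2 w := Y w ^+ 2.
have iD : P.-integrable setT ((EFin \o X2) \+ (EFin \o Y2))%E by exact: integrableD.
apply: (le_integrable _ _ _ iD) => //.
  by apply/measurable_EFinP; exact: measurable_funM.
move=> w _ /=; rewrite lee_fin (ger0_norm (_ : 0 <= X2 w + Y2 w)); last first.
  by rewrite addr_ge0 ?sqr_ge0.
rewrite ler_norml /X2 /Y2 !expr2; apply/andP; split.
  by have := sqr_ge0 (X w + Y w); rewrite expr2; nra.
by have := sqr_ge0 (X w - Y w); rewrite expr2; nra.
Qed.

Lemma sqint_cst c : sqint (fun=> c).
Proof. by split => //; exact: finite_measure_integrable_cst. Qed.

Lemma sqint_integrable X : sqint X -> P.-integrable setT (EFin \o X).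
Proof.
move=> sX; have := sqint_mul sX (sqint_cst 1); apply: eq_integrable => // w _ /=.
by rewrite mulr1.
Qed.

Lemma sqintZ c X : sqint X -> sqint (fun w => c * X w).
Proof.
move=> [mX iX]; split; first exact: measurable_funM.
have := integrableZl measurableT (c ^+ 2) iX; apply: eq_integrable => // w _ /=.
by rewrite -EFinM -exprMn.
Qed.

Lemma sqintD X Y : sqint X -> sqint Y -> sqint (fun w => X w + Y w).
Proof.
move=> sX sY; have [mX iX] := sX; have [mY iY] := sY; split; first exact: measurable_funD.
have h := integrableD measurableT (integrableD measurableT iX iY)
  (integrableZl measurableT 2 (sqint_mul sX sY)).
apply: eq_integrable h => // w _ /=.
by rewrite -EFinM -!EFinD; congr EFin; ring.
Qed.

Lemma sqint_sum (J : Type) (s : seq J) (X : J -> T -> R) : (forall j, sqint (X j)) ->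
  sqint (fun w => \sum_(j <- s) X j w).
Proof.
move=> sX; elim: s => [|j s IH].
  by under eq_fun do rewrite big_nil; exact: sqint_cst.
by under eq_fun do rewrite big_cons; exact: sqintD.
Qed.

Definition mean X : R := \int[P]_(w in setT) X w.
Definition mprod X Y : R := mean (fun w => X w * Y w).

Lemma meanD X Y : sqint X -> sqint Y -> mean (fun w => X w + Y w) = mean X + mean Y.
Proof. by move=> /sqint_integrable iX /sqint_integrable iY; rewrite /mean RintegralD. Qed.

Lemma meanZ c X : sqint X -> mean (fun w => c * X w) = c * mean X.
Proof. by move=> /sqint_integrable iX; rewrite /mean RintegralZl. Qed.

Lemma mean_sum (J : Type) (s : seq J) (X : J -> T -> R) : (forall j, sqint (X j)) ->
  mean (fun w => \sum_(j <- s) X j w) = \sum_(j <- s) mean (X j).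
Proof.
move=> sX; elim: s => [|j s IH].
  under eq_fun do rewrite big_nil.
  by rewrite big_nil /mean Rintegral_cst// mul0r.
under eq_fun do rewrite big_cons.
by rewrite big_cons meanD ?IH//; exact: sqint_sum.
Qed.

Lemma mprodC X Y : mprod X Y = mprod Y X.
Proof. by rewrite /mprod; congr mean; apply/funext => w; rewrite mulrC. Qed.

Lemma mprodDl X Y Z : sqint X -> sqint Y -> sqint Z ->
  mprod (fun w => X w + Y w) Z = mprod X Z + mprod Y Z.
Proof.
move=> sX sY sZ; rewrite /mprod /mean -RintegralD//; try exact: sqint_mul.
by apply: eq_Rintegral => w _; rewrite mulrDl.
Qed.

Lemma mprodZl c X Z : sqint X -> sqint Z -> mprod (fun w => c * X w) Z = c * mprod X Z.
Proof.
move=> sX sZ; rewrite /mprod /mean -RintegralZl//; last exact: sqint_mul.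
by apply: eq_Rintegral => w _; rewrite mulrA.
Qed.

Lemma mprod_suml (J : Type) (s : seq J) (X : J -> T -> R) Z :
  (forall j, sqint (X j)) -> sqint Z ->
  mprod (fun w => \sum_(j <- s) X j w) Z = \sum_(j <- s) mprod (X j) Z.
Proof.
move=> sX sZ; elim: s => [|j s IH].
  under eq_fun do rewrite big_nil.
  rewrite big_nil /mprod; under eq_fun do rewrite mul0r.
  by rewrite /mean Rintegral_cst// mul0r.
under eq_fun do rewrite big_cons.
by rewrite big_cons mprodDl ?IH//; exact: sqint_sum.
Qed.

Lemma expectation_mean X : sqint X -> 'E_P[X]%E = (mean X)%:E.
Proof.
move=> /sqint_integrable iX; rewrite unlock /mean /Rintegral fineK//.
exact: integrable_fin_num.
Qed.

Lemma covariance_mprod X Y : sqint X -> sqint Y -> mean X = 0 -> mean Y = 0 ->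
  covariance P X Y = (mprod X Y)%:E.
Proof.
move=> sX sY X0 Y0; have subc0 Z : Z \- cst 0 = Z by apply/funext => w /=; rewrite subr0.
rewrite unlock (expectation_mean sX) (expectation_mean sY) X0 Y0 /= !subc0.
rewrite unlock /mprod /mean /Rintegral fineK; last first.
  by apply: integrable_fin_num => //; exact: sqint_mul.
by [].
Qed.

Lemma variance_sub X Y : sqint X -> sqint Y -> mean X = 0 -> mean Y = 0 ->
  variance P (X \- Y) = (mprod X X - mprod X Y - (mprod Y X - mprod Y Y))%:E.
Proof.
move=> sX sY X0 Y0; have sN := sqintZ (-1) sY; have sD := sqintD sX sN.
have -> : X \- Y = fun w => X w + -1 * Y w by apply/funext => w /=; rewrite mulN1r.
rewrite /variance covariance_mprod//; try by rewrite meanD// meanZ// X0 Y0 mulr0 addr0.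
congr EFin; rewrite mprodDl// mprodZl// !(mprodC _ (fun w => X w + _)) !mprodDl// !mprodZl//.
rewrite (mprodC Y X); ring.
Qed.

(** Measurability comes from the linear combination with a single term, and the second moment is the
    covariance [C i i], a real number. *)
Lemma centered_gaussian_process_sqint (I : Type) (D : set I) (X : I -> T -> R)
    (C : I -> I -> R) i : centered_gaussian_process P D X C -> D i ->
  sqint (X i) /\ mean (X i) = 0.
Proof.
move=> [gp E0 cov] Di.
have mX : measurable_fun setT (X i).
  have [+ _] := gp 1%N (fun=> i) (fun=> 1) (fun=> Di).
  by apply: eq_measurable_fun => w _; rewrite big_ord_recl big_ord0 mul1r addr0.
have sX : sqint (X i).
  split=> //; apply/integrableP; split.
    by apply/measurable_EFinP; exact: measurable_funX.
  have : (\int[P]_w (X i w ^+ 2)%:E = (C i i)%:E)%E.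
    rewrite -(cov i i Di Di) unlock (E0 i Di) /=.
    by rewrite (_ : X i \- cst 0 = X i) ?unlock//; apply/funext => w /=; rewrite subr0.
  have -> : (\int[P]_w (X i w ^+ 2)%:E = \int[P]_w `|(X i w ^+ 2)%:E|)%E.
    by apply: eq_integral => w _ /=; rewrite ger0_norm ?sqr_ge0.
  by move=> ->; rewrite ltry.
split => //; have := E0 i Di; rewrite expectation_mean//; by case.
Qed.

Lemma variogram_gaussian (I : Type) (Z : I -> T -> R) (k g : I -> I -> R) x1 x2 :
  centered_gaussian_process P setT Z k -> variogram P Z g ->
  g x1 x2 = k x1 x1 - k x1 x2 - (k x2 x1 - k x2 x2).
Proof.
move=> gZ vg; have sZ x := centered_gaussian_process_sqint gZ (Logic.I : [set: I] x).
have kE x y : k x y = mprod (Z x) (Z y).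
  have [_ _ /(_ x y Logic.I Logic.I)] := gZ.
  by have [? ?] := sZ x; have [? ?] := sZ y; rewrite covariance_mprod// => -[].
have := vg x1 x2; have [s1 m1] := sZ x1; have [s2 m2] := sZ x2.
by rewrite variance_sub// -!kE => -[].
Qed.

(** The joint law agrees with the product of the marginals on rectangles, hence everywhere. Fubini's
    theorem then puts the mean of [Y] inside as a factor. *)
Lemma independent_mprod0 X Y : sqint X -> sqint Y -> mean Y = 0 ->
  (forall A B : set R, measurable A -> measurable B ->
    fine (P (X @^-1` A `&` Y @^-1` B)) = fine (P (X @^-1` A)) * fine (P (Y @^-1` B))) ->
  mprod X Y = 0.
Proof.
move=> sX sY Y0 ind; have [mX _] := sX; have [mY _] := sY.
pose X' : {RV P >-> R} := HB.pack X (isMeasurableFun.Build _ _ _ _ X mX).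
pose Y' : {RV P >-> R} := HB.pack Y (isMeasurableFun.Build _ _ _ _ Y mY).
pose XY w := (X w, Y w).
have mXY : measurable_fun setT XY by exact: measurable_fun_pair.
pose XY' : {RV P >-> (R * R)%type} := HB.pack XY (isMeasurableFun.Build _ _ _ _ XY mXY).
pose f (p : R * R) := (p.1 * p.2)%:E : \bar R.
have mf : measurable_fun setT f by apply/measurable_EFinP; exact: measurable_funM.
have law (A : set (R * R)) : measurable A ->
    (distribution P X' \x distribution P Y')%E A = distribution P XY' A.
  apply: product_measure_unique => U V mU mV.
  have mU' : measurable (X @^-1` U) by rewrite -[X in measurable X]setTI; exact: (mX measurableT _ mU).
  have mV' : measurable (Y @^-1` V) by rewrite -[X in measurable X]setTI; exact: (mY measurableT _ mV).
  have PE : P (X @^-1` U `&` Y @^-1` V) = (P (X @^-1` U) * P (Y @^-1` V))%E.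
    rewrite -[LHS]fineK ?fin_num_measure//; last exact: measurableI.
    by rewrite ind// EFinM !fineK ?fin_num_measure.
  exact: PE.
have iXY : P.-integrable setT (f \o XY) by exact: sqint_mul.
have i1 : (distribution P XY').-integrable setT f.
  exact: (integrable_pushforward mXY mf iXY measurableT).
have i2 : (distribution P X' \x distribution P Y')%E.-integrable setT f.
  move/integrableP: i1 => [_ fin]; apply/integrableP; split => //.
  apply: le_lt_trans fin; rewrite le_eqVlt; apply/orP; left; apply/eqP.
  by apply: eq_measure_integral => A mA _; exact: law.
have E : (\int[P]_w (f \o XY) w = 0)%E.
  rewrite -(integral_pushforward mXY mf (D := setT) iXY measurableT).
  transitivity (\int[(distribution P X' \x distribution P Y')%E]_p f p)%E.
    by apply/esym/eq_measure_integral => A mA _; exact: law.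
  rewrite -integral12_prod_meas1//; apply: integral0_eq => x _.
  have mE : measurable_fun setT (fun y : R => y%:E) by exact/measurable_EFinP/measurable_id.
  have iY : (distribution P Y').-integrable setT (fun y => y%:E).
    exact: (integrable_pushforward mY mE (sqint_integrable sY) measurableT).
  rewrite /fubini_F /f /=; under eq_integral do rewrite EFinM.
  rewrite integralZl//.
  have -> : (\int[distribution P Y']_y y%:E = 0)%E.
    rewrite (integral_pushforward mY mE (D := setT) (sqint_integrable sY) measurableT).
    by have := expectation_mean sY; rewrite Y0 unlock.
  by rewrite mule0.
by rewrite /mprod /mean /Rintegral [X in fine X]E.
Qed.

End SquareIntegrable.

Section Independence.
Context {d : measure_display} {T : measurableType d} {R : realType}.
Variable P : probability T R.

Lemma process_sigmaT (I : Type) (D : set I) (X : I -> T -> R) : process_sigma D X setT.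
Proof. by move=> M [[M0 MC _] _]; have := MC _ M0; rewrite setD0. Qed.

Lemma process_sigma_preimage (I : Type) (D : set I) (X : I -> T -> R) i (A : set R) :
  D i -> measurable A -> process_sigma D X (X i @^-1` A).
Proof. by move=> Di mA; apply: sub_sigma_algebra; exists i; split => //; exists A. Qed.

Lemma independent_sigmas_pair (J : finType) (S : J -> set (set T)) j k A B :
  independent_sigmas P S -> (forall l, S l setT) -> j != k -> S j A -> S k B ->
  fine (P (A `&` B)) = fine (P A) * fine (P B).
Proof.
move=> ind ST jk SA SB.
pose F l := if l == j then A else if l == k then B else setT.
have kj : k == j = false by rewrite eq_sym (negbTE jk).
have SF l : S l (F l) by rewrite /F; case: eqVneq => [->//|_]; case: eqVneq => [->|].
have := ind F SF; rewrite (bigD1 j)//= (bigD1 k)/= ?kj// big1 ?mulr1.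
  rewrite /F eqxx kj eqxx => <-; congr (fine (P _)); apply/seteqP; split => [w [Aw Bw] l _|w h].
    by case: eqP => // _; case: eqP.
  by split; [have := h j Logic.I; rewrite eqxx|have := h k Logic.I; rewrite kj eqxx].
by move=> l /andP[lj lk]; rewrite /F (negbTE lj) (negbTE lk) probability_setT.
Qed.

End Independence.

(** * Covariance of the process defining the resistance distance *)

Section ResistanceDistance.
Context {R : realType} {G : metric_graph R}.
Context {d : measure_display} {T : measurableType d}.
Variables (P : probability T R) (u0 : vertex G).
Variables (Y : vertex G -> T -> R) (B : edge G -> R -> T -> R).
Hypothesis gY : centered_gaussian_process P [set: vertex G] Y
  (fun v w => invmx (laplacian_A u0) (enum_rank v) (enum_rank w)).
Hypothesis gB : forall e, brownian_bridge P (len e) (B e).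
Hypothesis ind : independent_sigmas P (fun j : option (edge G) =>
  if j is Some e then process_sigma `[0, len e] (B e)
  else process_sigma [set: vertex G] Y).
Implicit Types (x y : gpoint G) (e : edge G) (u v : vertex G).

Lemma Z_muE x w : Z_mu Y x w = interp (fun u => Y u w) x.
Proof.
case: x => [v|e t]; first by rewrite interp_vertex.
rewrite -on_edge_inner interp_on_edge ?on_edge_inner//.
by have /andP[/ltW-> /ltW->] := valP t.
Qed.

(** Away from the open edge [e] the position is 0, where the bridge vanishes for every outcome;
    extension by zero is thus built into [pos]. *)
Lemma Z_edgeE e x w : Z_edge B e x w = B e (pos x e) w.
Proof.
have [_ B0 _] := gB e; case: x => [v|e' t] /=; first by rewrite B0.
by case: eqVneq => // _; rewrite B0.
Qed.

Let Yc u : sqint P (Y u) /\ mean P (Y u) = 0.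
Proof. exact: (centered_gaussian_process_sqint gY (Logic.I : [set: vertex G] u)). Qed.

Let pos_in x e : `[0, len e]%classic (pos x e).
Proof. by rewrite /= in_itv/= pos_itv. Qed.

Let Bc x e : sqint P (B e (pos x e)) /\ mean P (B e (pos x e)) = 0.
Proof. by have [gp _ _] := gB e; exact: (centered_gaussian_process_sqint gp (pos_in x e)). Qed.

Let mprodYY u v : mprod P (Y u) (Y v) = green_mx u0 u v.
Proof.
have [_ _ /(_ u v Logic.I Logic.I)] := gY.
by have [? ?] := Yc u; have [? ?] := Yc v; rewrite covariance_mprod// => -[].
Qed.

Let SpT (j : option (edge G)) : (if j is Some e then process_sigma `[0, len e] (B e)
  else process_sigma [set: vertex G] Y) setT.
Proof. by case: j => [e|]; exact: process_sigmaT. Qed.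

Let mprodYB u x e : mprod P (Y u) (B e (pos x e)) = 0.
Proof.
have [? ?] := Yc u; have [? ?] := Bc x e; apply: independent_mprod0 => // A C mA mC.
apply: (@independent_sigmas_pair _ _ _ _ _ _ None (Some e) _ _ ind SpT) => //.
  exact: process_sigma_preimage.
exact: (process_sigma_preimage (X := B e) (pos_in x e) mC).
Qed.

Let mprodBB x y e e' : mprod P (B e (pos x e)) (B e' (pos y e')) =
  if e == e' then tent (len e) (pos x e) (pos y e) else 0.
Proof.
have [? ?] := Bc x e; have [? ?] := Bc y e'; case: eqVneq => [ee|ee].
  subst e'; have [[_ _ /(_ _ _ (pos_in x e) (pos_in y e)) cov] _ _] := gB e.
  by move: cov; rewrite covariance_mprod// => -[].
apply: independent_mprod0 => // A C mA mC.
apply: (@independent_sigmas_pair _ _ _ _ _ _ (Some e) (Some e') _ _ ind SpT) => //.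
  exact: (process_sigma_preimage (X := B e) (pos_in x e) mA).
exact: (process_sigma_preimage (X := B e') (pos_in y e') mC).
Qed.

Let A x w := \sum_u hat u x * Y u w.
Let Q x w := \sum_e B e (pos x e) w.

Let hY x u : sqint P (fun w => hat u x * Y u w).
Proof. by apply: sqintZ; case: (Yc u). Qed.

Let sA x : sqint P (A x). Proof. exact: sqint_sum. Qed.
Let sQ x : sqint P (Q x). Proof. by apply: sqint_sum => e; case: (Bc x e). Qed.

Lemma Z_tildeE x : Z_tilde Y B x = fun w => A x w + Q x w.
Proof.
apply/funext => w; rewrite /Z_tilde Z_muE; congr (_ + _).
by apply: eq_bigr => e _; rewrite Z_edgeE.
Qed.

(** Independence removes the products of vertex terms with bridges and of bridges on distinct edges.
    The vertex terms give the interpolated matrix, the bridges the tents. *)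
Lemma mprod_Z_tilde x y : mprod P (Z_tilde Y B x) (Z_tilde Y B y) = green u0 x y.
Proof.
have AQ z1 z2 : mprod P (A z1) (Q z2) = 0.
  rewrite mprod_suml// big1// => u _; have [sY _] := Yc u.
  rewrite mprodZl// mprodC mprod_suml//; last by move=> e; case: (Bc z2 e).
  by rewrite big1 ?mulr0// => e _; rewrite mprodC mprodYB.
rewrite !Z_tildeE mprodDl//; last exact: sqintD.
rewrite !(mprodC _ _ (fun w => A y w + Q y w)) !mprodDl// (mprodC _ (Q y)) !AQ addr0 add0r /green; congr (_ + _).
  rewrite mprodC mprod_suml// /interp; apply: eq_bigr => u _; have [sY _] := Yc u.
  rewrite mprodZl// mprodC mprod_suml//; congr (_ * _); apply: eq_bigr => v _.
  by have [sYv _] := Yc v; rewrite mprodZl// mprodC mprodYY.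
rewrite mprodC mprod_suml//; last by move=> e; case: (Bc x e).
apply: eq_bigr => e _; have [sB _] := Bc x e.
rewrite mprodC mprod_suml//; last by move=> e'; case: (Bc y e').
rewrite (bigD1 e)//= big1 ?addr0 => [|e' ee'].
  by rewrite mprodC mprodBB eqxx.
by rewrite mprodC mprodBB eq_sym (negbTE ee').
Qed.

Lemma Z_tilde_sqint x : sqint P (Z_tilde Y B x) /\ mean P (Z_tilde Y B x) = 0.
Proof.
rewrite Z_tildeE; split; first exact: sqintD.
rewrite meanD// mean_sum// big1 ?add0r => [|u _]; last first.
  by have [sY Y0] := Yc u; rewrite meanZ// Y0 mulr0.
by rewrite mean_sum ?big1// => e; [move=> _|]; case: (Bc x e).
Qed.

Lemma resistance_distance_green dR x1 x2 : variogram P (Z_tilde Y B) dR ->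
  dR x1 x2 = kquad (green u0) x1 x2.
Proof.
move=> /(_ x1 x2); have [s1 m1] := Z_tilde_sqint x1; have [s2 m2] := Z_tilde_sqint x2.
by rewrite variance_sub// !mprod_Z_tilde => -[].
Qed.

End ResistanceDistance.

Theorem proposition3p4 (R : realType) (G : metric_graph R) :
  (forall (u0 : vertex G) (gamma1 dR : gpoint G -> gpoint G -> R),
     is_gamma 1 gamma1 -> is_resistance_distance u0 dR ->
     forall x1 x2 : gpoint G, gamma1 x1 x2 = dR x1 x2) /\
  (forall gamma2 : gpoint G -> gpoint G -> R, is_gamma 2 gamma2 ->
     forall (K : set nat) (lam : nat -> R) (phi : nat -> gpoint G -> R),
     kirchhoff_spectrum K lam phi ->
     forall x1 x2 : gpoint G,
       gamma2 x1 x2 = sqrt_dist gamma2 x1 x2 ^+ 2 /\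
       (gamma2 x1 x2)%:E = biharmonic_sq K lam phi x1 x2).
Proof.
split.
  move=> u0 gamma1 dR [d [T [P [Z [k [rk gZ vZ]]]]]].
  move=> [d' [T' [P' [Y [B [gY gB ind vR]]]]]] x1 x2.
  rewrite (variogram_gaussian x1 x2 gZ vZ) (resistance_distance_green gY gB ind x1 x2 vR).
  exact: kernel1_green.
move=> gamma2 [d [T [P [Z [k [rk gZ vZ]]]]]] K lam phi spec x1 x2.
(* The second assertion names no base vertex; the Green function takes one from [x1]. *)
have u0 : vertex G by case: (x1) => [v|e _]; [exact: v|exact: src e].
rewrite (biharmonic_sqE u0 x1 x2 spec) /sqrt_dist (variogram_gaussian x1 x2 gZ vZ).
rewrite -/(kquad k x1 x2) (kernel2_green u0 x1 x2 rk) sqr_sqrtr//.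
have bg x := bker_section x (bker_green u0).
have bw : bmeas (zero_mean (green_diff u0 x1 x2)) by apply: zero_mean_bmeas; exact: bmeasB.
by apply: gint_ge0 => [|y]; [exact: (bmeasM bw bw)|exact: sqr_ge0].
Qed.
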